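(* Let $(e^{2u(t)}|dz|^2)_{t\in[0,T]}$ be a smooth, instantaneously complete Ricci flow on the complex plane $\mathbb C$. Then there exists a constant $C<\infty$, depending only on $u|_{[0,T]\times\mathbb D_2}$ and $T$, such that for all $|z|\ge2$ and $t\in(0,T]$ \[ u(t,z)\ge -C-\log\big(|z|\log|z|\big)+\tfrac12\log(2t). \]
   Context: The conformal factor of a Ricci flow $e^{2u}|dz|^2$ evolves by $\partial_tu=e^{-2u}\Delta u$. Instantaneously complete: the metric is complete for every $t\in(0,T]$. $\mathbb D_2$ is the disc of radius 2 centered at $0$. *)

(* Defs.v *)
From Stdlib Require Import Reals Lra List.
Open Scope R_scope.

(* A time-dependent function on C = R^2 is represented as u : R -> R -> R -> R,
   u t x y = u(t, x + i y). *)
Definition F3 := R -> R -> R -> R.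

Definition cont_on (T : R) (f : F3) : Prop :=
  forall t x y, 0 <= t <= T ->
  forall eps, eps > 0 -> exists delta, delta > 0 /\
    forall t' x' y', 0 <= t' <= T ->
      Rabs (t' - t) < delta -> Rabs (x' - x) < delta -> Rabs (y' - y) < delta ->
      Rabs (f t' x' y' - f t x y) < eps.

Inductive dir := Dt | Dx | Dy.

Definition is_partial (T : R) (d : dir) (f g : F3) : Prop :=
  forall t x y, 0 <= t <= T ->
  match d with
  | Dt => limit1_in (fun h => (f (t + h) x y - f t x y) / h)
            (fun h => h <> 0 /\ 0 <= t + h <= T) (g t x y) 0
  | Dx => derivable_pt_lim (fun x' => f t x' y) x (g t x y)
  | Dy => derivable_pt_lim (fun y' => f t x y') y (g t x y)
  end.

(* Smoothness on [0,T] x R^2: a family of all iterated partial derivatives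
   D l (l = list of directions, applied right-to-left: D (d :: l) is the
   d-partial of D l), all jointly continuous, with D nil = u. *)
Definition smooth_family (T : R) (u : F3) (D : list dir -> F3) : Prop :=
  D nil = u /\
  (forall l, cont_on T (D l)) /\
  (forall l d, is_partial T d (D l) (D (d :: l))).

Definition smooth_on (T : R) (u : F3) : Prop :=
  exists D, smooth_family T u D.

Definition ricci_flow (T : R) (u : F3) : Prop :=
  exists D, smooth_family T u D /\
    forall t x y, 0 <= t <= T ->
      D (Dt :: nil) t x y =
        exp (-2 * u t x y) * (D (Dx :: Dx :: nil) t x y + D (Dy :: Dy :: nil) t x y).

Definition path_length (v : R -> R -> R) (p q : R * R) (L : R) : Prop :=
  exists (gx gy dx dy : R -> R),
    (forall s, derivable_pt_lim gx s (dx s)) /\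
    (forall s, derivable_pt_lim gy s (dy s)) /\
    continuity dx /\ continuity dy /\
    gx 0 = fst p /\ gy 0 = snd p /\ gx 1 = fst q /\ gy 1 = snd q /\
    exists pr : Riemann_integrable
        (fun s => exp (v (gx s) (gy s)) * sqrt (dx s ^ 2 + dy s ^ 2)) 0 1,
      RiemannInt pr = L.

(* Riemannian distance d_v(p,q) < eps  (d_v = inf of lengths of C^1 paths). *)
Definition dist_lt (v : R -> R -> R) (p q : R * R) (eps : R) : Prop :=
  exists L, path_length v p q L /\ L < eps.

Definition complete_metric (v : R -> R -> R) : Prop :=
  forall a : nat -> R * R,
    (forall eps, eps > 0 -> exists N, forall m n, (m >= N)%nat -> (n >= N)%nat ->
        dist_lt v (a m) (a n) eps) ->
    exists p, forall eps, eps > 0 -> exists N, forall n, (n >= N)%nat ->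
        dist_lt v (a n) p eps.

Definition inst_complete (T : R) (u : F3) : Prop :=
  forall t, 0 < t <= T -> complete_metric (u t).

Definition modz (x y : R) : R := sqrt (x ^ 2 + y ^ 2).

(* Main.v *)
Require Import Defs.
From Stdlib Require Import Reals Lra Lia List Classical ClassicalEpsilon.
From Coquelicot Require Import Coquelicot.
(* [Reals] also declares a [Dx]. *)
Import Defs.
Open Scope R_scope.

(* Let [w = - ln (r ln r)], the conformal factor of the hyperbolic metric on the exterior of the
   unit disc. For C >= 0 the function [v = ln (2 (t - tau)) / 2 + w - C] is a subsolution of the
   flow which is -oo at time tau, and for C large it lies below u on 3/2 <= r <= 7/4. It remains to
   exclude that [phi = v - u] is positive far out. With d the distance from 0 in the metric of u at
   time t, [phi <= eps - ln (1 - d / rad)] for large rad: at a first touching point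
   [(d/dt - Laplacian) d >= - A], with A depending only on u near 0, contradicts the strong
   absorption in [phi_t <= Laplacian phi + (1 - exp (2 phi)) / (2 (t - tau))]. As d need not be
   smooth one works with the lengths of curves instead, varied by parallel fields: in complex
   notation, the Laplacian in q of the length of [gamma + q f] at q = 0, for f a cutoff times the
   parallel unit field, cancels against the time derivative of the length outside the region where
   the cutoff varies. Completeness makes the balls of radius rad bounded, uniformly in
   [tau <= t <= T1], so all Taylor remainders are uniform. Finally rad -> oo, eps -> 0, tau -> 0. *)

(** * Real analysis preliminaries *)

(** Two obstacles shape the argument: a maximising point or curve need not exist, and lengths can
    only be varied with uniform constants once everything is confined to a bounded region. Hence the
    scheme is discrete. From a time, an endpoint and a curve one passes to the time [t - rho^2 / 4]
    and to four displaced curves. Errors are [O(rho^3)] with constants independent of the curve,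
    while the net gain is at least [rho^2 / rad^2], so one step size [rho] serves throughout. The
    logarithm in the barrier is dictated by scaling. Above the barrier [exp (2 * phi)] exceeds
    [exp (2 * eps) * rad^2 / (rad - L)^2], the same order in [rad - L] as the second derivative of
    [- ln (rad - L)], and the factor [rad^2] makes absorption win for large [rad]. The comparison is
    prescribed on a whole annulus because steps are discrete: a step of length at most 1/20 that
    starts beyond radius 7/4 cannot jump inside radius 3/2. *)

Lemma exp_le (x y : R) : x <= y -> exp x <= exp y.
Proof. intros [H| ->]; [left; now apply exp_increasing|lra]. Qed.

Lemma le_of_derive (f g f' g' : R -> R) (a b : R) :
  a <= b ->
  (forall x, is_derive f x (f' x)) -> (forall x, is_derive g x (g' x)) ->
  (forall x, a <= x <= b -> f' x <= g' x) -> f b - f a <= g b - g a.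
Proof.
  intros Hab Hf Hg Hle.
  destruct (MVT_gen (fun x => g x - f x) a b (fun x => g' x - f' x)) as [c [Hc Hc']].
  - intros x _. apply @is_derive_minus; auto.
  - intros x _. apply continuity_pt_minus; apply derivable_continuous_pt;
      eexists; apply is_derive_Reals; [apply Hg | apply Hf].
  - rewrite Rmin_left, Rmax_right in Hc by lra.
    specialize (Hle c Hc). nra.
Qed.

Lemma is_derive_continuity_pt (f : R -> R) (x l : R) :
  is_derive f x l -> continuity_pt f x.
Proof.
  intros H. apply derivable_continuous_pt. exists l. now apply is_derive_Reals.
Qed.

Lemma antiderivative_exists (f : R -> R) :
  continuity f -> exists F, F 0 = 0 /\ forall x, is_derive F x (f x).
Proof.
  intros Hf. exists (fun x => RInt f 0 x).
  split; [apply (RInt_point 0 f) |].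
  intros x. apply (is_derive_RInt f _ 0).
  - apply filter_forall. intros y. apply (@RInt_correct R_CompleteNormedModule).
    apply (@ex_RInt_continuous R_CompleteNormedModule).
    intros z _. apply continuity_pt_filterlim, Hf.
  - apply continuity_pt_filterlim, Hf.
Qed.

(** Take the supremum of the times up to which [g] has stayed at most [c]. Applied to the modulus
    along a curve, this stops the curve where it first meets a circle, so that bounds valid only
    inside the disc hold all the way to that time. *)
Lemma first_passage (g : R -> R) (c b : R) :
  continuity g -> 0 <= b -> g 0 < c -> c <= g b ->
  exists s, 0 < s <= b /\ g s = c /\ forall r, 0 <= r <= s -> g r <= c.
Proof.
  intros Hg Hb H0 H1.
  set (E := fun s => 0 <= s <= b /\ forall r, 0 <= r <= s -> g r <= c).
  destruct (completeness E) as [S [HS1 HS2]].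
  - exists b. intros s [Hs _]. lra.
  - exists 0. split; [lra|]. intros r Hr. replace r with 0 by lra. lra.
  - assert (HE0 : E 0) by (split; [lra|]; intros r Hr; replace r with 0 by lra; lra).
    assert (HS0 : 0 <= S) by (apply HS1, HE0).
    assert (HSb : S <= b) by (apply HS2; intros s [Hs _]; lra).
    assert (Hlt : forall r, 0 <= r < S -> g r <= c).
    { intros r Hr. destruct (Rle_lt_dec (g r) c) as [|Hgt]; [assumption|].
      exfalso. assert (S <= r); [|lra]. apply HS2. intros s [Hs1 Hs2].
      destruct (Rle_lt_dec s r); [assumption|]. specialize (Hs2 r). lra. }
    assert (Hcont : forall x eps, eps > 0 -> exists d, d > 0 /\
               forall y, Rabs (y - x) < d -> Rabs (g y - g x) < eps).
    { intros x eps Heps. destruct (Hg x eps Heps) as [d [Hd Hd']].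
      exists d. split; [exact Hd|]. intros y Hy.
      destruct (Req_dec y x) as [->|Hyx].
      - rewrite Rminus_diag, Rabs_R0. exact Heps.
      - apply (Hd' y). split; [split; [exact I|auto]|exact Hy]. }
    assert (HSc : g S <= c).
    { destruct (Rle_lt_dec (g S) c) as [|Hgt]; [assumption|exfalso].
      destruct (Hcont S (g S - c)) as [d [Hd Hd']]; [lra|].
      destruct (Rle_lt_dec S 0) as [Hz|Hz].
      { replace S with 0 in Hgt by lra. lra. }
      set (r := Rmax 0 (S - d / 2)).
      assert (0 <= r < S /\ Rabs (r - S) < d) as [Hr1 Hr2].
      { unfold r, Rmax. destruct (Rle_dec 0 (S - d / 2)); split; try lra;
        rewrite Rabs_left1; lra. }
      specialize (Hlt r Hr1). specialize (Hd' r Hr2).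
      apply Rabs_def2 in Hd'. lra. }
    assert (Hle : forall r, 0 <= r <= S -> g r <= c).
    { intros r Hr. destruct (Req_dec r S) as [->|]; [assumption|]. apply Hlt. lra. }
    assert (Heq : g S = c).
    { destruct (Rle_lt_or_eq_dec _ _ HSc) as [Hl|]; [exfalso|assumption].
      assert (S < b).
      { destruct (Rle_lt_or_eq_dec _ _ HSb) as [|Hq]; [assumption|]. rewrite Hq in Hl. lra. }
      destruct (Hcont S (c - g S)) as [d [Hd Hd']]; [lra|].
      set (r := Rmin b (S + d / 2)).
      assert (S < r <= b /\ r <= S + d / 2) as [Hr1 Hr2].
      { unfold r, Rmin. destruct (Rle_dec b (S + d / 2)); lra. }
      assert (r <= S); [|lra]. apply HS1. split; [lra|]. intros q Hq.
      destruct (Rle_lt_dec q S); [apply Hle; lra|].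
      assert (Hq' : Rabs (q - S) < d) by (rewrite Rabs_right; lra).
      specialize (Hd' q Hq'). apply Rabs_def2 in Hd'. lra. }
    exists S. repeat split; auto.
    destruct (Rle_lt_or_eq_dec _ _ HS0) as [|Hz]; [assumption|]. rewrite <- Hz in Heq. lra.
Qed.

Lemma cont_on_bounded (T W : R) (f : F3) :
  cont_on T f -> exists B, 0 <= B /\ forall t x y, 0 <= t <= T ->
    Rabs x <= W -> Rabs y <= W -> Rabs (f t x y) <= B.
Proof.
  intros Hf.
  (* [compactness_value] yields one [d] such that every point lies in the gauge of some tag whose
     radius is at least [d]. Capping each radius by the reciprocal of the local bound makes [/ d] a
     uniform bound. The same device recurs in the compactness arguments for balls. *)
  assert (Hd : forall z : R * (R * (R * unit)), exists d : posreal,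
    let '(t, (x, (y, _))) := z in
    (0 <= t <= T -> d <= / (Rabs (f t x y) + 1) /\
      forall t' x' y', 0 <= t' <= T -> Rabs (t' - t) < d -> Rabs (x' - x) < d ->
        Rabs (y' - y) < d -> Rabs (f t' x' y') <= Rabs (f t x y) + 1)).
  { intros [t [x [y []]]].
    destruct (classic (0 <= t <= T)) as [Ht|Ht].
    2: exists (mkposreal 1 Rlt_0_1); intros; tauto.
    destruct (Hf t x y Ht 1 Rlt_0_1) as [d [Hd Hd']].
    assert (Hp : 0 < / (Rabs (f t x y) + 1)).
    { apply Rinv_0_lt_compat. pose proof (Rabs_pos (f t x y)). lra. }
    exists (mkposreal (Rmin d (/ (Rabs (f t x y) + 1))) (Rmin_pos _ _ Hd Hp)).
    intros _. simpl. split; [apply Rmin_r|].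
    intros t' x' y' Ht' H1 H2 H3.
    pose proof (Rmin_l d (/ (Rabs (f t x y) + 1))) as Hm.
    specialize (Hd' t' x' y' Ht' ltac:(lra) ltac:(lra) ltac:(lra)).
    pose proof (Rabs_triang_inv (f t' x' y') (f t x y)). lra. }
  set (delta := fun z => proj1_sig (constructive_indefinite_description _ (Hd z))).
  destruct (compactness_value 3 (0, (- W, (- W, tt))) (T, (W, (W, tt))) delta) as [d Hdv].
  exists (/ d). split; [left; apply Rinv_0_lt_compat, cond_pos|].
  intros t x y Ht Hx Hy. apply Rabs_le_between in Hx, Hy.
  destruct (Rle_lt_dec (Rabs (f t x y)) (/ d)) as [|Hgt]; [assumption|exfalso].
  apply (Hdv (t, (x, (y, tt)))); [simpl; intuition lra|].
  intros [[t0 [x0 [y0 []]]] [Hb [Hc Hle]]].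
  unfold delta in Hc, Hle.
  destruct (constructive_indefinite_description _ _) as [e He]. simpl in Hc, Hle, He, Hb.
  destruct He as [He1 He2]; [lra|].
  specialize (He2 t x y Ht ltac:(tauto) ltac:(tauto) ltac:(tauto)).
  pose proof (Rabs_pos (f t0 x0 y0)).
  assert (d <= / (Rabs (f t0 x0 y0) + 1)) by lra.
  assert (Rabs (f t0 x0 y0) + 1 <= / d); [|lra].
  rewrite <- (Rinv_inv (Rabs (f t0 x0 y0) + 1)).
  apply Rinv_le_contravar; [apply cond_pos|assumption].
Qed.

Lemma cont_on_bounded_order (T W : R) (n : nat) (D : list dir -> F3) :
  (forall l, cont_on T (D l)) -> exists B, 0 <= B /\ forall l, (length l <= n)%nat ->
    forall t x y, 0 <= t <= T -> Rabs x <= W -> Rabs y <= W -> Rabs (D l t x y) <= B.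
Proof.
  revert D. induction n as [|n IH]; intros D HD.
  - destruct (cont_on_bounded T W (D nil) (HD nil)) as [B [HB0 HB]].
    exists B. split; [exact HB0|]. intros [|d l] Hl; [exact HB|simpl in Hl; lia].
  - destruct (cont_on_bounded T W (D nil) (HD nil)) as [B [HB0 HB]].
    destruct (IH (fun l => D (Dt :: l)) (fun l => HD _)) as [Bt [Ht0 Ht]].
    destruct (IH (fun l => D (Dx :: l)) (fun l => HD _)) as [Bx [Hx0 Hx]].
    destruct (IH (fun l => D (Dy :: l)) (fun l => HD _)) as [By [Hy0 Hy]].
    exists (B + Bt + Bx + By). split; [lra|].
    intros [|[] l] Hl t x y H1 H2 H3; simpl in Hl.
    + specialize (HB t x y H1 H2 H3). lra.
    + specialize (Ht l ltac:(lia) t x y H1 H2 H3). lra.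
    + specialize (Hx l ltac:(lia) t x y H1 H2 H3). lra.
    + specialize (Hy l ltac:(lia) t x y H1 H2 H3). lra.
Qed.

Definition cont2 (v : R -> R -> R) : Prop :=
  forall x y eps, eps > 0 -> exists delta, delta > 0 /\
    forall x' y', Rabs (x' - x) < delta -> Rabs (y' - y) < delta ->
      Rabs (v x' y' - v x y) < eps.

Lemma cont_on_cont2 (T t : R) (f : F3) : cont_on T f -> 0 <= t <= T -> cont2 (f t).
Proof.
  intros Hf Ht x y eps He. destruct (Hf t x y Ht eps He) as [d [Hd Hd']].
  exists d. split; [exact Hd|]. intros x' y' Hx Hy.
  apply Hd'; auto. rewrite Rminus_diag, Rabs_R0. lra.
Qed.

Lemma continuity_pt_eps (f : R -> R) (x : R) : continuity_pt f x <->
  forall eps, eps > 0 -> exists d, d > 0 /\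
    forall y, Rabs (y - x) < d -> Rabs (f y - f x) < eps.
Proof.
  split.
  - intros H eps Heps. destruct (H eps Heps) as [d [Hd Hd']].
    exists d. split; [exact Hd|]. intros y Hy.
    destruct (Req_dec y x) as [->|Hyx].
    + rewrite Rminus_diag, Rabs_R0. exact Heps.
    + apply (Hd' y). split; [split; [exact I|auto]|exact Hy].
  - intros H eps Heps. destruct (H eps Heps) as [d [Hd Hd']].
    exists d. split; [exact Hd|]. intros y [_ Hy]. apply Hd', Hy.
Qed.

Lemma cont2_comp (v : R -> R -> R) (g h : R -> R) :
  cont2 v -> continuity g -> continuity h -> continuity (fun s => v (g s) (h s)).
Proof.
  intros Hv Hg Hh s. apply continuity_pt_eps. intros eps He.
  destruct (Hv (g s) (h s) eps He) as [d [Hd Hd']].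
  destruct (proj1 (continuity_pt_eps g s) (Hg s) d Hd) as [d1 [Hd1 H1]].
  destruct (proj1 (continuity_pt_eps h s) (Hh s) d Hd) as [d2 [Hd2 H2]].
  exists (Rmin d1 d2). split; [apply Rmin_pos; auto|].
  intros y Hy. pose proof (Rmin_l d1 d2). pose proof (Rmin_r d1 d2).
  apply Hd'; [apply H1|apply H2]; lra.
Qed.

(** * Curves, arc length and distance *)

Lemma continuity_cst (k : R) : continuity (fun _ => k).
Proof. apply continuity_const. intros ? ?. reflexivity. Qed.

Lemma modz_sqr (x y : R) : modz x y * modz x y = x ^ 2 + y ^ 2.
Proof. unfold modz. apply sqrt_sqrt. nra. Qed.

Lemma modz_pos (x y : R) : 0 <= modz x y.
Proof. apply sqrt_pos. Qed.

Lemma modz_ge_coord (x y : R) : Rabs x <= modz x y /\ Rabs y <= modz x y.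
Proof.
  pose proof (modz_sqr x y). pose proof (modz_pos x y).
  split; apply Rabs_le; nra.
Qed.

Lemma modz_le_sum (x y : R) : modz x y <= Rabs x + Rabs y.
Proof.
  pose proof (modz_sqr x y). pose proof (modz_pos x y).
  pose proof (Rabs_pos x). pose proof (Rabs_pos y).
  rewrite <- (pow2_abs x), <- (pow2_abs y) in H. nra.
Qed.

Lemma dot_le_modz (a b x y : R) : a * x + b * y <= modz a b * modz x y.
Proof.
  pose proof (modz_sqr x y). pose proof (modz_pos x y).
  pose proof (modz_sqr a b). pose proof (modz_pos a b).
  apply Rle_trans with (Rabs (a * x + b * y)); [apply Rle_abs|].
  rewrite <- (Rabs_right (modz a b * modz x y)) by nra.
  apply Rsqr_le_abs_0. unfold Rsqr.
  replace (modz a b * modz x y * (modz a b * modz x y))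
    with ((modz a b * modz a b) * (modz x y * modz x y)) by ring.
  rewrite H, H1. pose proof (pow2_ge_0 (a * y - b * x)). nra.
Qed.

Lemma modz_triang (a b x y : R) : modz (a + x) (b + y) <= modz a b + modz x y.
Proof.
  pose proof (dot_le_modz a b x y).
  pose proof (modz_sqr x y). pose proof (modz_pos x y).
  pose proof (modz_sqr a b). pose proof (modz_pos a b).
  pose proof (modz_sqr (a + x) (b + y)). pose proof (modz_pos (a + x) (b + y)).
  nra.
Qed.

Lemma modz_opp (x y : R) : modz (- x) (- y) = modz x y.
Proof. unfold modz. f_equal. ring. Qed.

Lemma modz_continuity (f g : R -> R) :
  continuity f -> continuity g -> continuity (fun s => modz (f s) (g s)).
Proof.
  intros Hf Hg s. unfold modz.
  apply (continuity_pt_comp (fun s => f s ^ 2 + g s ^ 2) sqrt).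
  - simpl. specialize (Hf s). specialize (Hg s). reg.
  - apply continuity_pt_sqrt. nra.
Qed.

Record curve : Type := Curve {
  cx : R -> R; cy : R -> R; cdx : R -> R; cdy : R -> R;
  cx_derive : forall s, is_derive cx s (cdx s);
  cy_derive : forall s, is_derive cy s (cdy s);
  cdx_cont : continuity cdx;
  cdy_cont : continuity cdy }.

(** An antiderivative of the speed on the whole line: reparametrisation becomes the chain rule, and
    lengths are compared through [le_of_derive]. *)
Definition arclength (v : R -> R -> R) (c : curve) (S : R -> R) : Prop :=
  S 0 = 0 /\
  forall s, is_derive S s (exp (v (cx c s) (cy c s)) * modz (cdx c s) (cdy c s)).

Lemma cx_cont (c : curve) : continuity (cx c).
Proof. intros s. eapply is_derive_continuity_pt, cx_derive. Qed.

Lemma cy_cont (c : curve) : continuity (cy c).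
Proof. intros s. eapply is_derive_continuity_pt, cy_derive. Qed.

Lemma speed_cont (v : R -> R -> R) (c : curve) : cont2 v ->
  continuity (fun s => exp (v (cx c s) (cy c s)) * modz (cdx c s) (cdy c s)).
Proof.
  intros Hv s. apply continuity_pt_mult.
  - apply (continuity_pt_comp (fun s => v (cx c s) (cy c s)) exp).
    + apply cont2_comp; auto using cx_cont, cy_cont.
    + apply derivable_continuous_pt, derivable_pt_exp.
  - apply modz_continuity; apply cdx_cont || apply cdy_cont.
Qed.

Lemma arclength_exists (v : R -> R -> R) (c : curve) :
  cont2 v -> exists S, arclength v c S.
Proof. intros Hv. apply (antiderivative_exists _ (speed_cont v c Hv)). Qed.

Lemma speed_ge0 (v : R -> R -> R) (c : curve) (s : R) :
  0 <= exp (v (cx c s) (cy c s)) * modz (cdx c s) (cdy c s).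
Proof. apply Rmult_le_pos; [left; apply exp_pos | apply modz_pos]. Qed.

Lemma arclength_mono (v : R -> R -> R) (c : curve) (S : R -> R) (a b : R) :
  arclength v c S -> a <= b -> S a <= S b.
Proof.
  intros [_ HS] Hab.
  pose proof (le_of_derive (fun _ => 0) S (fun _ => 0) _ a b Hab
    (fun x => is_derive_const 0 x) HS (fun x _ => speed_ge0 v c x)). simpl in H. lra.
Qed.

Definition dlt (v : R -> R -> R) (p q : R * R) (L : R) : Prop :=
  exists c S, arclength v c S /\
    (cx c 0, cy c 0) = p /\ (cx c 1, cy c 1) = q /\ S 1 < L.

Lemma dist_lt_iff (v : R -> R -> R) (p q : R * R) (L : R) :
  cont2 v -> (dist_lt v p q L <-> dlt v p q L).
Proof.
  intros Hv. split.
  - intros [l [(gx & gy & dx & dy & Hx & Hy & Hdx & Hdy & E1 & E2 & E3 & E4 & pr & Hl) HL]].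
    set (c := Curve gx gy dx dy (fun s => proj2 (is_derive_Reals _ _ _) (Hx s))
      (fun s => proj2 (is_derive_Reals _ _ _) (Hy s)) Hdx Hdy).
    destruct (arclength_exists v c Hv) as [S HS]. exists c, S.
    split; [exact HS|]. split; [|split].
    + destruct p. simpl in *. congruence.
    + destruct q. simpl in *. congruence.
    + destruct HS as [H0 HS].
      enough (S 1 = l) by lra. rewrite <- Hl, <- RInt_Reals. symmetry.
      replace (S 1) with (minus (S 1) (S 0)) by (unfold minus, plus, opp; simpl; lra).
      apply is_RInt_unique.
      apply (is_RInt_derive S (fun s => exp (v (gx s) (gy s)) * sqrt (dx s ^ 2 + dy s ^ 2))).
      * intros x _. apply HS.
      * intros x _. apply continuity_pt_filterlim, (speed_cont v c Hv).
  - intros (c & S & [H0 HS] & <- & <- & HL). exists (S 1). split; [|exact HL].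
    exists (cx c), (cy c), (cdx c), (cdy c).
    assert (HI : is_RInt (fun s => exp (v (cx c s) (cy c s)) *
        sqrt (cdx c s ^ 2 + cdy c s ^ 2)) 0 1 (S 1)).
    { replace (S 1) with (minus (S 1) (S 0)) by (unfold minus, plus, opp; simpl; lra).
      apply (is_RInt_derive S).
      * intros x _. apply HS.
      * intros x _. apply continuity_pt_filterlim, (speed_cont v c Hv). }
    repeat split; try (intros s; apply is_derive_Reals); simpl;
      auto using cx_derive, cy_derive, cdx_cont, cdy_cont.
    exists (ex_RInt_Reals_0 _ _ _ (ex_intro _ _ HI)).
    rewrite <- RInt_Reals. apply is_RInt_unique, HI.
Qed.

Lemma comp_curve_derive (f df h dh : R -> R) (s : R) :
  (forall s, is_derive f s (df s)) -> is_derive h s (dh s) ->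
  is_derive (fun s => f (h s)) s (dh s * df (h s)).
Proof. intros Hf Hh. apply (is_derive_comp f h); auto. Qed.

Lemma comp_cont (df h dh : R -> R) :
  continuity df -> (forall s, is_derive h s (dh s)) -> continuity dh ->
  continuity (fun s => dh s * df (h s)).
Proof.
  intros Hf Hh Hd s. apply continuity_pt_mult; [apply Hd|].
  apply (continuity_pt_comp h df); [eapply is_derive_continuity_pt, Hh|apply Hf].
Qed.

Lemma arclength_comp (v : R -> R -> R) (c : curve) (S h : R -> R) (s d : R) :
  arclength v c S -> is_derive h s d ->
  is_derive (fun s => S (h s)) s
    (d * (exp (v (cx c (h s)) (cy c (h s))) * modz (cdx c (h s)) (cdy c (h s)))).
Proof. intros [_ HS] Hh. apply (is_derive_comp S h); [apply HS|exact Hh]. Qed.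

Definition reparam (c : curve) (h dh : R -> R)
  (Hh : forall s, is_derive h s (dh s)) (Hd : continuity dh) : curve :=
  Curve (fun s => cx c (h s)) (fun s => cy c (h s))
    (fun s => dh s * cdx c (h s)) (fun s => dh s * cdy c (h s))
    (fun s => comp_curve_derive _ _ h dh s (cx_derive c) (Hh s))
    (fun s => comp_curve_derive _ _ h dh s (cy_derive c) (Hh s))
    (comp_cont _ h dh (cdx_cont c) Hh Hd) (comp_cont _ h dh (cdy_cont c) Hh Hd).

Lemma modz_scal (k x y : R) : modz (k * x) (k * y) = Rabs k * modz x y.
Proof.
  unfold modz. replace ((k * x) ^ 2 + (k * y) ^ 2) with (k ^ 2 * (x ^ 2 + y ^ 2)) by ring.
  rewrite sqrt_mult_alt by nra. f_equal. rewrite <- sqrt_Rsqr_abs. f_equal. unfold Rsqr. ring.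
Qed.

Lemma dlt_subcurve (v : R -> R -> R) (c : curve) (S : R -> R) (a b L : R) :
  arclength v c S -> a <= b -> S b - S a < L ->
  dlt v (cx c a, cy c a) (cx c b, cy c b) L.
Proof.
  intros [H0 HS] Hab HL.
  assert (Hh : forall s, is_derive (fun s => a + (b - a) * s) s (b - a))
    by (intros s; auto_derive; [trivial|ring]).
  exists (reparam c (fun s => a + (b - a) * s) (fun _ => b - a) Hh
    (continuity_cst _)).
  exists (fun s => S (a + (b - a) * s) - S a).
  split; [split|split; [|split]]; simpl.
  - rewrite Rmult_0_r, Rplus_0_r. ring.
  - intros s. rewrite modz_scal, Rabs_right by lra.
    replace (exp _ * _) with ((b - a) * (exp (v (cx c (a + (b - a) * s)) (cy c (a + (b - a) * s))) *
      modz (cdx c (a + (b - a) * s)) (cdy c (a + (b - a) * s))) - 0) by ring.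
    apply @is_derive_minus; [|apply @is_derive_const].
    apply (arclength_comp v c S (fun s => a + (b - a) * s)); [split; auto|auto].
  - rewrite Rmult_0_r, Rplus_0_r. reflexivity.
  - rewrite Rmult_1_r. replace (a + (b - a)) with b by ring. reflexivity.
  - rewrite Rmult_1_r. replace (a + (b - a)) with b by ring. exact HL.
Qed.

Lemma dlt_sym (v : R -> R -> R) (p q : R * R) (L : R) : dlt v p q L -> dlt v q p L.
Proof.
  intros (c & S & [H0 HS] & <- & <- & HL).
  assert (Hh : forall s, is_derive (fun s => 1 - s) s (-1))
    by (intros s; auto_derive; [trivial|ring]).
  exists (reparam c (fun s => 1 - s) (fun _ => -1) Hh
    (continuity_cst _)).
  exists (fun s => S 1 - S (1 - s)).
  split; [split|split; [|split]]; simpl.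
  - rewrite Rminus_0_r. ring.
  - intros s. rewrite modz_scal, Rabs_left by lra.
    replace (exp _ * _) with (0 - (-1) * (exp (v (cx c (1 - s)) (cy c (1 - s))) *
      modz (cdx c (1 - s)) (cdy c (1 - s)))) by ring.
    apply @is_derive_minus; [apply @is_derive_const|].
    apply (arclength_comp v c S (fun s => 1 - s)); [split; auto|auto].
  - rewrite Rminus_0_r. reflexivity.
  - rewrite Rminus_diag. reflexivity.
  - rewrite Rminus_diag. lra.
Qed.

(** On the unit interval this is [3 s^2 - 2 s^3]. A curve run along such a step comes to rest at
    both ends, which is what a C^1 concatenation requires. *)
Lemma smooth_step : exists H dH : R -> R,
  (forall s, is_derive H s (dH s)) /\ continuity dH /\ (forall s, 0 <= dH s) /\
  (forall s, s <= 0 -> H s = 0 /\ dH s = 0) /\ (forall s, 1 <= s -> H s = 1 /\ dH s = 0).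
Proof.
  set (dH := fun s => Rmax 0 (6 * s * (1 - s))).
  assert (Hc : continuity dH).
  { intros s. apply continuity_pt_filterlim. unfold dH.
    apply (continuous_comp (fun s => 6 * s * (1 - s)) (fun r => Rmax 0 r)).
    - apply @ex_derive_continuous. auto_derive. trivial.
    - apply continuity_pt_filterlim. apply continuity_pt_eps. intros eps He.
      exists eps. split; [exact He|]. intros y Hy. unfold Rmax.
      apply Rabs_def2 in Hy. apply Rabs_def1; repeat destruct Rle_dec; lra. }
  destruct (antiderivative_exists dH Hc) as [H [H0 HH]].
  exists H, dH. split; [exact HH|]. split; [exact Hc|]. split; [intros s; apply Rmax_l|].
  assert (Hz : forall a b, a <= b -> (forall x, a <= x <= b -> dH x = 0) -> H a = H b).
  { intros a b Hab Hx.
    pose proof (le_of_derive (fun _ => 0) H (fun _ => 0) _ a b Hab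
      (fun x => is_derive_const 0 x) HH (fun x Hx' => Req_le _ _ (eq_sym (Hx x Hx')))).
    pose proof (le_of_derive H (fun _ => 0) _ (fun _ => 0) a b Hab HH
      (fun x => is_derive_const 0 x) (fun x Hx' => Req_le _ _ (Hx x Hx'))).
    simpl in *. lra. }
  assert (Hneg : forall s, s <= 0 -> dH s = 0) by (intros s Hs; apply Rmax_left; nra).
  assert (Hbig : forall s, 1 <= s -> dH s = 0) by (intros s Hs; apply Rmax_left; nra).
  assert (H1 : H 1 = 1).
  { assert (Hd : forall x, is_derive (fun s => 3 * s ^ 2 - 2 * s ^ 3) x (6 * x * (1 - x)))
      by (intros x; auto_derive; [trivial|ring]).
    assert (He : forall x, 0 <= x <= 1 -> dH x = 6 * x * (1 - x))
      by (intros x Hx; apply Rmax_right; nra).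
    pose proof (le_of_derive _ _ _ _ 0 1 Rle_0_1 HH Hd (fun x Hx => Req_le _ _ (He x Hx))).
    pose proof (le_of_derive _ _ _ _ 0 1 Rle_0_1 Hd HH
      (fun x Hx => Req_le _ _ (eq_sym (He x Hx)))).
    simpl in *. lra. }
  split; intros s Hs.
  - split; [|auto]. rewrite (Hz s 0 Hs); [exact H0|]. intros x Hx. apply Hneg. lra.
  - split; [|auto]. rewrite <- (Hz 1 s Hs); [exact H1|]. intros x Hx. apply Hbig. lra.
Qed.

(** The joined curve is the sum of the two reparametrised curves minus the junction point. At every
    time at least one summand rests at the junction, so positions and speeds are those of the other
    one. *)
Lemma dlt_trans (v : R -> R -> R) (p q r : R * R) (L1 L2 : R) :
  dlt v p q L1 -> dlt v q r L2 -> dlt v p r (L1 + L2).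
Proof.
  intros (c1 & S1 & [A0 AS] & <- & Eq1 & HL1) (c2 & S2 & [B0 BS] & <- & <- & HL2).
  injection Eq1 as Ex Ey.
  destruct smooth_step as (H & dH & HH & Hc & Hp & Hneg & Hbig).
  set (h1 := fun s => H (2 * s)). set (d1 := fun s => 2 * dH (2 * s)).
  set (h2 := fun s => H (2 * s - 1)). set (d2 := fun s => 2 * dH (2 * s - 1)).
  assert (Hh1 : forall s, is_derive h1 s (d1 s)).
  { intros s. apply (comp_curve_derive H dH (fun s => 2 * s) (fun _ => 2)); auto.
    auto_derive; [trivial|ring]. }
  assert (Hh2 : forall s, is_derive h2 s (d2 s)).
  { intros s. apply (comp_curve_derive H dH (fun s => 2 * s - 1) (fun _ => 2)); auto.
    auto_derive; [trivial|ring]. }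
  assert (Hd1 : continuity d1).
  { apply (comp_cont dH (fun s => 2 * s) (fun _ => 2)); auto.
    - intros s. auto_derive; [trivial|ring].
    - apply continuity_cst. }
  assert (Hd2 : continuity d2).
  { apply (comp_cont dH (fun s => 2 * s - 1) (fun _ => 2)); auto.
    - intros s. auto_derive; [trivial|ring].
    - apply continuity_cst. }
  set (g1 := reparam c1 h1 d1 Hh1 Hd1). set (g2 := reparam c2 h2 d2 Hh2 Hd2).
  assert (Hx : forall s, is_derive (fun s => cx g1 s + cx g2 s - cx c2 0) s (cdx g1 s + cdx g2 s)).
  { intros s. replace (cdx g1 s + cdx g2 s) with (cdx g1 s + cdx g2 s - 0) by ring.
    apply @is_derive_minus; [|apply @is_derive_const].
    apply @is_derive_plus; apply cx_derive. }
  assert (Hy : forall s, is_derive (fun s => cy g1 s + cy g2 s - cy c2 0) s (cdy g1 s + cdy g2 s)).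
  { intros s. replace (cdy g1 s + cdy g2 s) with (cdy g1 s + cdy g2 s - 0) by ring.
    apply @is_derive_minus; [|apply @is_derive_const].
    apply @is_derive_plus; apply cy_derive. }
  exists (Curve _ _ _ _ Hx Hy
    (continuity_plus _ _ (cdx_cont g1) (cdx_cont g2))
    (continuity_plus _ _ (cdy_cont g1) (cdy_cont g2))).
  exists (fun s => S1 (h1 s) + S2 (h2 s)).
  destruct (Hneg 0 ltac:(lra)) as [N0 _]. destruct (Hneg (-1) ltac:(lra)) as [N1 _].
  destruct (Hbig 1 ltac:(lra)) as [P1 _]. destruct (Hbig 2 ltac:(lra)) as [P2 _].
  assert (E10 : h1 0 = 0) by (unfold h1; rewrite Rmult_0_r; exact N0).
  assert (E20 : h2 0 = 0) by (unfold h2; replace (2 * 0 - 1) with (-1) by ring; exact N1).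
  assert (E11 : h1 1 = 1) by (unfold h1; rewrite Rmult_1_r; exact P2).
  assert (E21 : h2 1 = 1) by (unfold h2; replace (2 * 1 - 1) with 1 by ring; exact P1).
  split; [split|split; [|split]]; simpl.
  - rewrite E10, E20. lra.
  - intros s.
    replace (exp _ * _) with
      (d1 s * (exp (v (cx c1 (h1 s)) (cy c1 (h1 s))) * modz (cdx c1 (h1 s)) (cdy c1 (h1 s))) +
       d2 s * (exp (v (cx c2 (h2 s)) (cy c2 (h2 s))) * modz (cdx c2 (h2 s)) (cdy c2 (h2 s)))).
    + apply @is_derive_plus.
      * apply (arclength_comp v c1 S1 h1); [split; auto|auto].
      * apply (arclength_comp v c2 S2 h2); [split; auto|auto].
    + destruct (Rle_lt_dec s (/ 2)) as [Hs|Hs].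
      * destruct (Hneg (2 * s - 1) ltac:(lra)) as [Z1 Z2].
        unfold d2, h2. rewrite Z1, Z2.
        rewrite Rmult_0_r, !Rmult_0_l, !Rplus_0_r.
        replace (cx c1 (h1 s) + cx c2 0 - cx c2 0) with (cx c1 (h1 s)) by ring.
        replace (cy c1 (h1 s) + cy c2 0 - cy c2 0) with (cy c1 (h1 s)) by ring.
        rewrite modz_scal, Rabs_right by (unfold d1; specialize (Hp (2 * s)); lra). ring.
      * destruct (Hbig (2 * s) ltac:(lra)) as [Z1 Z2].
        unfold d1, h1. rewrite Z1, Z2, Ex, Ey.
        rewrite Rmult_0_r, !Rmult_0_l, !Rplus_0_l.
        replace (cx c2 0 + cx c2 (h2 s) - cx c2 0) with (cx c2 (h2 s)) by ring.
        replace (cy c2 0 + cy c2 (h2 s) - cy c2 0) with (cy c2 (h2 s)) by ring.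
        rewrite modz_scal, Rabs_right by (unfold d2; specialize (Hp (2 * s - 1)); lra). ring.
  - rewrite E10, E20. f_equal; ring.
  - rewrite E11, E21, Ex, Ey. f_equal; ring.
  - rewrite E11, E21. lra.
Qed.

Lemma dlt_mono (v : R -> R -> R) (p q : R * R) (L1 L2 : R) :
  dlt v p q L1 -> L1 <= L2 -> dlt v p q L2.
Proof. intros (c & S & H1 & H2 & H3 & H4) H. exists c, S. repeat split; auto; try apply H1. lra. Qed.

(** Cutting at the fraction [a / (a + b)] of the length keeps both inequalities strict. *)
Lemma dlt_split (v : R -> R -> R) (p q : R * R) (a b : R) :
  0 < a -> 0 < b -> dlt v p q (a + b) -> exists y, dlt v p y a /\ dlt v y q b.
Proof.
  intros Ha Hb (c & S & HS & <- & <- & HL).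
  assert (H1 : 0 <= S 1).
  { replace 0 with (S 0) by apply HS. apply (arclength_mono v c S 0 1 HS). lra. }
  assert (Hl : a * S 1 / (a + b) <= S 1 /\ 0 <= a * S 1 / (a + b) /\
    a * S 1 / (a + b) < a /\ S 1 - a * S 1 / (a + b) < b).
  { assert (He : a * S 1 / (a + b) = a * (S 1 / (a + b))) by (unfold Rdiv; ring).
    assert (Hq : S 1 = S 1 / (a + b) * (a + b)) by (field; lra).
    assert (0 <= S 1 / (a + b)) by (apply Rdiv_le_0_compat; lra).
    rewrite He. set (z := S 1 / (a + b)) in *. nra. }
  set (l := a * S 1 / (a + b)) in *.
  destruct (IVT_gen S 0 1 l) as [s [Hs HSs]].
  - intros s. eapply is_derive_continuity_pt, HS.
  - rewrite (proj1 HS), Rmin_left, Rmax_right by lra. lra.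
  - rewrite Rmin_left, Rmax_right in Hs by lra.
    exists (cx c s, cy c s). split; apply (dlt_subcurve v c S); auto; try lra.
    rewrite (proj1 HS). lra.
Qed.

Definition segment (p q : R * R) : curve.
Proof.
  refine (Curve (fun s => fst p + s * (fst q - fst p)) (fun s => snd p + s * (snd q - snd p))
    (fun _ => fst q - fst p) (fun _ => snd q - snd p) _ _ _ _).
  - intros s. auto_derive; [trivial|ring].
  - intros s. auto_derive; [trivial|ring].
  - apply continuity_cst.
  - apply continuity_cst.
Defined.

Lemma dlt_segment (v : R -> R -> R) (p q : R * R) (B L : R) :
  cont2 v ->
  (forall s, 0 <= s <= 1 ->
    v (fst p + s * (fst q - fst p)) (snd p + s * (snd q - snd p)) <= B) ->
  exp B * modz (fst q - fst p) (snd q - snd p) < L -> dlt v p q L.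
Proof.
  intros Hv HB HL. destruct (arclength_exists v (segment p q) Hv) as [S HS].
  exists (segment p q), S. split; [exact HS|]. simpl. repeat split.
  - destruct p; simpl; f_equal; ring.
  - destruct q; simpl; f_equal; ring.
  - destruct HS as [H0 HS].
    set (m := modz (fst q - fst p) (snd q - snd p)) in *.
    pose proof (le_of_derive S (fun s => exp B * m * s) _ (fun _ => exp B * m) 0 1 Rle_0_1 HS) as H.
    lapply H; [|intros s; auto_derive; [trivial|ring]].
    clear H; intros H. lapply H.
    + lra.
    + intros x Hx. simpl. apply Rmult_le_compat_r; [apply modz_pos|].
      apply exp_le. apply HB, Hx.
Qed.

(** Up to the first time at distance [r], the speed is at least [exp (- B)] times the velocity
    component in the fixed direction [(a, b)] of the exit point, and that component integrates to
    exactly [r]. A fixed direction avoids differentiating the modulus, which is not smooth at the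
    start. *)
Lemma exit_length (v : R -> R -> R) (c : curve) (S : R -> R) (B r s : R) :
  arclength v c S -> 0 < r -> 0 <= s ->
  (forall x y, modz (x - cx c 0) (y - cy c 0) <= r -> - B <= v x y) ->
  r <= modz (cx c s - cx c 0) (cy c s - cy c 0) -> exp (- B) * r <= S s.
Proof.
  intros HS Hr Hs HB Hex.
  destruct (first_passage (fun s => modz (cx c s - cx c 0) (cy c s - cy c 0)) r s)
    as [t [Ht [Hgt Hle]]]; auto.
  - apply modz_continuity; apply continuity_minus; auto using cx_cont, cy_cont;
      apply continuity_cst.
  - rewrite !Rminus_diag. unfold modz. replace (0 ^ 2 + 0 ^ 2) with 0 by ring.
    rewrite sqrt_0. exact Hr.
  - apply Rle_trans with (S t); [|apply (arclength_mono v c S); tauto || lra].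
    set (a := (cx c t - cx c 0) / r). set (b := (cy c t - cy c 0) / r).
    assert (Hab : modz a b = 1).
    { unfold a, b, Rdiv. rewrite !(Rmult_comm _ (/ r)), modz_scal, Hgt.
      rewrite Rabs_right; [field; lra|]. left. apply Rinv_0_lt_compat, Hr. }
    destruct HS as [H0 HS].
    assert (HA : forall x, is_derive (fun s => exp (- B) * (a * cx c s + b * cy c s)) x
      (exp (- B) * (a * cdx c x + b * cdy c x))).
    { intros x. apply (is_derive_scal (fun s => a * cx c s + b * cy c s)).
      apply @is_derive_plus; apply @is_derive_scal; [apply cx_derive|apply cy_derive]. }
    assert (Hle' : forall x, 0 <= x <= t -> exp (- B) * (a * cdx c x + b * cdy c x) <=
      exp (v (cx c x) (cy c x)) * modz (cdx c x) (cdy c x)).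
    { intros x Hx. pose proof (dot_le_modz a b (cdx c x) (cdy c x)) as Hd.
      rewrite Hab, Rmult_1_l in Hd.
      apply Rle_trans with (exp (- B) * modz (cdx c x) (cdy c x)).
      - apply Rmult_le_compat_l; [left; apply exp_pos|exact Hd].
      - apply Rmult_le_compat_r; [apply modz_pos|]. apply exp_le, HB, Hle, Hx. }
    pose proof (le_of_derive _ _ _ _ 0 t ltac:(lra) HA HS Hle') as H. simpl in H.
    replace r with (a * (cx c t - cx c 0) + b * (cy c t - cy c 0)); [lra|].
    pose proof (modz_sqr (cx c t - cx c 0) (cy c t - cy c 0)) as E.
    rewrite Hgt in E. unfold a, b.
    replace ((cx c t - cx c 0) / r * (cx c t - cx c 0) + (cy c t - cy c 0) / r * (cy c t - cy c 0))
      with (((cx c t - cx c 0) ^ 2 + (cy c t - cy c 0) ^ 2) / r) by (field; lra).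
    rewrite <- E. field. lra.
Qed.

(** * Hopf-Rinow for conformal metrics on the plane *)

Lemma cont2_bounded (v : R -> R -> R) (W : R) : cont2 v ->
  exists B, 0 <= B /\ forall x y, Rabs x <= W -> Rabs y <= W -> Rabs (v x y) <= B.
Proof.
  intros Hv. destruct (cont_on_bounded 0 W (fun _ => v)) as [B [HB0 HB]].
  - intros t x y _ eps He. destruct (Hv x y eps He) as [d [Hd Hd']].
    exists d. split; [exact Hd|]. intros. apply Hd'; auto.
  - exists B. split; [exact HB0|]. intros x y. apply (HB 0). lra.
Qed.

Lemma dlt_pos (v : R -> R -> R) (p q : R * R) (L : R) : dlt v p q L -> 0 < L.
Proof.
  intros (c & S & HS & _ & _ & HL).
  pose proof (arclength_mono v c S 0 1 HS Rle_0_1). rewrite (proj1 HS) in H. lra.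
Qed.

Lemma dlt_near (v : R -> R -> R) (x0 y0 L : R) : cont2 v -> 0 < L ->
  exists d, 0 < d /\ forall x y, Rabs (x - x0) < d -> Rabs (y - y0) < d ->
    dlt v (x0, y0) (x, y) L.
Proof.
  intros Hv HL. destruct (Hv x0 y0 1 Rlt_0_1) as [e [He Hve]].
  pose proof (exp_pos (v x0 y0 + 1)) as Hp.
  set (E := exp (v x0 y0 + 1)) in *.
  assert (Hq : 0 < L / (4 * E)) by (apply Rdiv_lt_0_compat; lra).
  exists (Rmin e (L / (4 * E))). split; [apply Rmin_pos; assumption|].
  intros x y Hx Hy.
  pose proof (Rmin_l e (L / (4 * E))). pose proof (Rmin_r e (L / (4 * E))).
  assert (Hs : forall s z, 0 <= s <= 1 -> Rabs z < e -> Rabs (s * z) < e).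
  { intros s z Hs Hz. rewrite Rabs_mult, (Rabs_right s) by lra.
    pose proof (Rabs_pos z). nra. }
  assert (Hxe : Rabs (x - x0) < e) by lra. assert (Hye : Rabs (y - y0) < e) by lra.
  apply (dlt_segment v _ _ (v x0 y0 + 1)); auto; simpl.
  - intros s Hs'.
    assert (Hv' := Hve (x0 + s * (x - x0)) (y0 + s * (y - y0))).
    replace (x0 + s * (x - x0) - x0) with (s * (x - x0)) in Hv' by ring.
    replace (y0 + s * (y - y0) - y0) with (s * (y - y0)) in Hv' by ring.
    specialize (Hv' (Hs s _ Hs' Hxe) (Hs s _ Hs' Hye)).
    apply Rabs_def2 in Hv'. lra.
  - pose proof (modz_le_sum (x - x0) (y - y0)).
    fold E. apply Rle_lt_trans with (E * (2 * (L / (4 * E)))).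
    + apply Rmult_le_compat_l; lra.
    + replace (E * (2 * (L / (4 * E)))) with (L / 2) by (field; lra). lra.
Qed.

(** Unbounded in the Euclidean sense. Hopf-Rinow is used in the form that no such ball exists, which
    confines curves of bounded length to a compact set. *)
Definition unbounded_ball (v : R -> R -> R) (p : R * R) (r : R) : Prop :=
  forall rho, exists q, dlt v p q r /\ rho < modz (fst q) (snd q).

Lemma unbounded_ball_trans (v : R -> R -> R) (p q : R * R) (r s : R) :
  dlt v p q r -> unbounded_ball v q s -> unbounded_ball v p (r + s).
Proof.
  intros Hd Hu rho. destruct (Hu rho) as [z [Hz Hz']].
  exists z. split; [eapply dlt_trans; eauto|exact Hz'].
Qed.

Lemma small_ball_bounded (v : R -> R -> R) (p : R * R) : cont2 v ->
  exists r, 0 < r /\ ~ unbounded_ball v p r.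
Proof.
  intros Hv. destruct p as [px py].
  destruct (cont2_bounded v (modz px py + 1) Hv) as [B [HB0 HB]].
  exists (exp (- B)). split; [apply exp_pos|]. intros Hu.
  destruct (Hu (modz px py + 1)) as [q [(c & S & HS & E0 & E1 & HL) Hq]].
  injection E0 as E0x E0y. subst q. simpl in Hq.
  enough (exp (- B) * 1 <= S 1) by lra.
  apply (exit_length v c S); auto; try lra.
  - intros x y. rewrite E0x, E0y. intros Hxy.
    assert (Hm : modz x y <= modz px py + 1).
    { pose proof (modz_triang px py (x - px) (y - py)) as Ht.
      replace (px + (x - px)) with x in Ht by ring.
      replace (py + (y - py)) with y in Ht by ring. lra. }
    destruct (modz_ge_coord x y).
    specialize (HB x y ltac:(lra) ltac:(lra)). apply Rabs_le_between in HB. lra.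
  - rewrite E0x, E0y.
    pose proof (modz_triang px py (cx c 1 - px) (cy c 1 - py)) as Ht.
    replace (px + (cx c 1 - px)) with (cx c 1) in Ht by ring.
    replace (py + (cy c 1 - py)) with (cy c 1) in Ht by ring. lra.
Qed.

(** Among the radii [k * h] the ball about [p] passes from bounded to unbounded at some [k]. Far
    points of the larger ball lie within [h] of points of the smaller one, which is
    Euclidean-bounded. If every [eps]-ball centred in the [r]-ball were bounded, compactness would
    bound these far points as well. *)
Lemma unbounded_ball_step (v : R -> R -> R) (p : R * R) (r eps : R) :
  cont2 v -> 0 < eps -> unbounded_ball v p r ->
  exists y, dlt v p y r /\ unbounded_ball v y eps.
Proof.
  intros Hv He Hu.
  assert (Hr : 0 < r) by (destruct (Hu 0) as [q [Hq _]]; eapply dlt_pos; eauto).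
  set (h := eps / 4).
  assert (Hh : 0 < h) by (unfold h; lra).
  assert (Hk : exists k : nat, ~ unbounded_ball v p (INR k * h) /\
    unbounded_ball v p (INR (S k) * h)).
  { apply NNPP. intros Hn.
    assert (Hall : forall k : nat, ~ unbounded_ball v p (INR k * h)).
    { induction k as [|k IH].
      - intros H. destruct (H 0) as [q [Hq _]]. apply dlt_pos in Hq. simpl in Hq. lra.
      - intros H. apply Hn. exists k. auto. }
    destruct (INR_unbounded (r / h)) as [k Hk].
    apply (Hall k). intros rho. destruct (Hu rho) as [q [Hq Hq']].
    exists q. split; [|exact Hq']. eapply dlt_mono; [exact Hq|].
    assert (r = r / h * h) by (field; lra). nra. }
  destruct Hk as [k [Hb Hb']].
  rewrite S_INR, Rmult_plus_distr_r, Rmult_1_l in Hb'.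
  destruct (Nat.eq_dec k 0) as [->|Hk0].
  { exists p. split.
    - destruct p as [px py]. destruct (dlt_near v px py r Hv Hr) as [d [Hd Hd']].
      apply Hd'; rewrite Rminus_diag, Rabs_R0; exact Hd.
    - intros rho. destruct (Hb' rho) as [q [Hq Hq']]. exists q. split; [|exact Hq'].
      eapply dlt_mono; [exact Hq|]. simpl. unfold h. lra. }
  set (a := INR k * h) in *.
  assert (Ha : 0 < a) by (apply Rmult_lt_0_compat; [apply lt_0_INR; lia|exact Hh]).
  assert (Har : a < r).
  { apply Rnot_le_lt. intros Hle. apply Hb. intros rho. destruct (Hu rho) as [q [Hq Hq']].
    exists q. split; [|exact Hq']. eapply dlt_mono; eauto. }
  apply not_all_ex_not in Hb. destruct Hb as [rho0 Hrho0].
  assert (Hin : forall q, dlt v p q a -> modz (fst q) (snd q) <= rho0).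
  { intros q Hq. apply Rnot_lt_le. intros Hlt. apply Hrho0. exists q. auto. }
  (* The slack for replacing a point by its compactness tag: [m <= r - a] keeps the tag within [r]
     of [p], and [m + h <= 2 * h] keeps the far point inside the [eps]-ball of the tag. *)
  set (m := Rmin h (r - a)).
  assert (Hm : 0 < m) by (apply Rmin_pos; lra).
  pose proof (Rmin_l h (r - a)) as Hm1. pose proof (Rmin_r h (r - a)) as Hm2. fold m in Hm1, Hm2.
  apply NNPP. intros Hno.
  assert (Hd : forall x y, exists d : posreal,
    forall x' y' q, Rabs (x' - x) < d -> Rabs (y' - y) < d ->
      dlt v p (x', y') a -> dlt v (x', y') q h -> modz (fst q) (snd q) <= / d).
  { intros x y. destruct (dlt_near v x y m Hv Hm) as [d [Hd Hnear]].
    destruct (classic (dlt v p (x, y) r)) as [Hp|Hp].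
    - assert (Hnu : ~ unbounded_ball v (x, y) eps) by (intros H; apply Hno; exists (x, y); auto).
      apply not_all_ex_not in Hnu. destruct Hnu as [rho Hrho].
      assert (Hpos : 0 < Rmin d (/ (Rabs rho + 1))).
      { apply Rmin_pos; [exact Hd|]. apply Rinv_0_lt_compat. pose proof (Rabs_pos rho). lra. }
      exists (mkposreal _ Hpos). simpl. intros x' y' q Hx Hy Hpx Hq.
      pose proof (Rmin_l d (/ (Rabs rho + 1))). pose proof (Rmin_r d (/ (Rabs rho + 1))).
      apply Rle_trans with (Rabs rho + 1).
      + apply Rnot_lt_le. intros Hlt. apply Hrho. exists q. split.
        * apply dlt_mono with (m + h); [|unfold h in *; lra].
          eapply dlt_trans; [|exact Hq]. apply Hnear; lra.
        * pose proof (Rle_abs rho). lra.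
      + rewrite <- (Rinv_inv (Rabs rho + 1)) at 1. apply Rinv_le_contravar; [exact Hpos|lra].
    - exists (mkposreal d Hd). simpl. intros x' y' q Hx Hy Hpx Hq. exfalso. apply Hp.
      apply dlt_mono with (a + m); [|lra].
      eapply dlt_trans; [exact Hpx|]. apply dlt_sym, Hnear; auto. }
  set (delta := fun x y => proj1_sig (constructive_indefinite_description _ (Hd x y))).
  destruct (compactness_value_2d (- rho0) rho0 (- rho0) rho0 delta) as [d Hdv].
  destruct (Hb' (/ d)) as [q [Hq Hq']].
  destruct (dlt_split v p q a h Ha Hh Hq) as [[x y] [H1 H2]].
  pose proof (Hin _ H1) as Hxy. simpl in Hxy. destruct (modz_ge_coord x y) as [Hx Hy].
  apply (Hdv x y); try (apply Rabs_le_between; lra).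
  intros (x0 & y0 & _ & _ & Hx0 & Hy0 & Hle). unfold delta in *.
  destruct (constructive_indefinite_description _ _) as [e He']. simpl in *.
  specialize (He' x y q Hx0 Hy0 H1 H2).
  pose proof (Rinv_le_contravar d e (cond_pos d) Hle). lra.
Qed.

(* Hopf-Rinow: from an unbounded ball one follows points with ever smaller unbounded balls; they
   form a Cauchy sequence, and its limit would have no bounded ball around it. *)
Lemma complete_ball_bounded (v : R -> R -> R) (p : R * R) (r : R) :
  cont2 v -> complete_metric v -> ~ unbounded_ball v p r.
Proof.
  intros Hv Hc Hu.
  set (e := fun n : nat => (/ 2) ^ n).
  assert (He : forall n, 0 < e n) by (intros n; apply pow_lt; lra).
  assert (Hstep : forall z : nat * (R * R), exists y : R * R,
    unbounded_ball v (snd z) (e (fst z)) ->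
    dlt v (snd z) y (e (fst z)) /\ unbounded_ball v y (e (S (fst z)))).
  { intros [n z]. destruct (classic (unbounded_ball v z (e n))) as [H|H].
    - destruct (unbounded_ball_step v z (e n) (e (S n)) Hv (He _) H) as [y Hy].
      exists y. auto.
    - exists z. simpl. tauto. }
  destruct (unbounded_ball_step v p r (e 0%nat) Hv (He _) Hu) as [p0 [_ Hp0]].
  set (next := fun z => proj1_sig (constructive_indefinite_description _ (Hstep z))).
  set (a := fix a (n : nat) : R * R := match n with O => p0 | S n => next (n, a n) end).
  assert (Ha : forall n, unbounded_ball v (a n) (e n)).
  { induction n as [|n IH]; [exact Hp0|]. simpl. unfold next.
    destruct (constructive_indefinite_description _ _) as [y Hy]. simpl in *. apply Hy, IH. }
  assert (Had : forall n, dlt v (a n) (a (S n)) (e n)).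
  { intros n. simpl. unfold next.
    destruct (constructive_indefinite_description _ _) as [y Hy]. simpl in *. apply Hy, Ha. }
  (* The bound telescopes because [e n] equals [2 * e n - 2 * e (S n)]. *)
  assert (Hsum : forall n k, dlt v (a n) (a (n + S k)%nat) (2 * e n - 2 * e (n + S k)%nat)).
  { intros n k. induction k as [|k IH].
    - apply dlt_mono with (e n); [rewrite Nat.add_1_r; apply Had|].
      rewrite Nat.add_1_r. unfold e. simpl. lra.
    - replace (n + S (S k))%nat with (S (n + S k)) by lia.
      eapply dlt_mono; [eapply dlt_trans; [exact IH|apply Had]|].
      unfold e. simpl. lra. }
  assert (Hself : forall z L, 0 < L -> dlt v z z L).
  { intros [x y] L HL. destruct (dlt_near v x y L Hv HL) as [d [Hd Hd']].
    apply Hd'; rewrite Rminus_diag, Rabs_R0; exact Hd. }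
  assert (Hlt : forall n m, (n <= m)%nat -> dlt v (a n) (a m) (2 * e n)).
  { intros n m Hnm. destruct (Nat.eq_dec n m) as [->|Hne].
    - apply Hself. specialize (He m). lra.
    - replace m with (n + S (m - n - 1))%nat by lia.
      eapply dlt_mono; [apply Hsum|]. specialize (He (n + S (m - n - 1))%nat). lra. }
  assert (He0 : forall eps, 0 < eps -> exists N, forall n, (n >= N)%nat -> e n < eps).
  { intros eps Heps. destruct (pow_lt_1_zero (/ 2)) with (y := eps) as [N HN].
    - rewrite Rabs_right; lra.
    - exact Heps.
    - exists N. intros n Hn. specialize (HN n Hn). rewrite Rabs_right in HN; [exact HN|].
      left. apply He. }
  destruct (Hc a) as [z Hz].
  { intros eps Heps. destruct (He0 (eps / 4)) as [N HN]; [lra|].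
    exists N. intros m n Hm Hn. apply dist_lt_iff; [exact Hv|].
    pose proof (HN N (Nat.le_refl N)).
    apply dlt_mono with (2 * e N + 2 * e N); [|lra].
    apply dlt_trans with (a N); [apply dlt_sym|]; apply Hlt; assumption. }
  destruct (small_ball_bounded v z Hv) as [s [Hs Hns]].
  apply Hns. destruct (Hz (s / 2)) as [N1 HN1]; [lra|].
  destruct (He0 (s / 2)) as [N2 HN2]; [lra|].
  set (n := max N1 N2).
  specialize (HN1 n (Nat.le_max_l _ _)). specialize (HN2 n (Nat.le_max_r _ _)).
  apply dist_lt_iff in HN1; [|exact Hv]. apply dlt_sym in HN1.
  intros rho. destruct (unbounded_ball_trans v z (a n) _ _ HN1 (Ha n) rho) as [q [Hq Hq']].
  exists q. split; [|exact Hq']. eapply dlt_mono; [exact Hq|]. lra.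
Qed.

(** At the times [0] and [T] the time derivative in [is_partial] is one-sided, so two-sided calculus
    is confined to the open interval. The final time is recovered by continuity in
    [flow_lower_bound]. *)
Lemma partial_t_derive (T : R) (u : F3) (D : list dir -> F3) (l : list dir) (t x y : R) :
  smooth_family T u D -> 0 < t < T ->
  is_derive (fun s => D l s x y) t (D (Dt :: l) t x y).
Proof.
  intros (_ & _ & HD) Ht. apply is_derive_Reals. intros eps Heps.
  destruct (HD l Dt t x y ltac:(lra) eps Heps) as [d [Hd Hd']].
  assert (Hp : 0 < Rmin d (Rmin t (T - t))) by (repeat apply Rmin_pos; lra).
  exists (mkposreal _ Hp). simpl. intros h Hh Hlt.
  pose proof (Rmin_l d (Rmin t (T - t))). pose proof (Rmin_r d (Rmin t (T - t))).
  pose proof (Rmin_l t (T - t)). pose proof (Rmin_r t (T - t)).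
  apply (Hd' h). split.
  - split; [exact Hh|]. apply Rabs_def2 in Hlt. lra.
  - simpl. unfold Rdist. rewrite Rminus_0_r. lra.
Qed.

Lemma time_mvt (T : R) (u : F3) (D : list dir -> F3) (l : list dir) (t1 t2 x y : R) :
  smooth_family T u D -> 0 < t1 < T -> 0 < t2 < T ->
  exists c, Rmin t1 t2 <= c <= Rmax t1 t2 /\
    D l t2 x y - D l t1 x y = D (Dt :: l) c x y * (t2 - t1).
Proof.
  intros Hu H1 H2.
  assert (Hin : forall c, Rmin t1 t2 <= c <= Rmax t1 t2 -> 0 < c < T)
    by (intros c; unfold Rmin, Rmax; destruct Rle_dec; lra).
  apply (MVT_gen (fun s => D l s x y) t1 t2 (fun s => D (Dt :: l) s x y)).
  - intros s Hs. apply (partial_t_derive T u); auto. apply Hin. lra.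
  - intros s Hs. eapply is_derive_continuity_pt, (partial_t_derive T u); auto.
Qed.

Lemma arclength_le (v v' : R -> R -> R) (c : curve) (S S' : R -> R) (k s : R) :
  arclength v c S -> arclength v' c S' -> 0 <= s ->
  (forall x, 0 <= x <= s -> v (cx c x) (cy c x) <= k + v' (cx c x) (cy c x)) ->
  S s <= exp k * S' s.
Proof.
  intros [H0 HS] [H0' HS'] Hs Hle.
  assert (Hd : forall x, is_derive (fun y => exp k * S' y) x
    (exp k * (exp (v' (cx c x) (cy c x)) * modz (cdx c x) (cdy c x))))
    by (intros x; apply is_derive_scal, HS').
  pose proof (le_of_derive _ _ _ _ 0 s Hs HS Hd) as H. simpl in H.
  rewrite H0, H0' in H. enough (S s - 0 <= exp k * S' s - exp k * 0) by lra.
  apply H. intros x Hx. rewrite <- Rmult_assoc, <- exp_plus.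
  apply Rmult_le_compat_r; [apply modz_pos|]. apply exp_le, Hle, Hx.
Qed.

(** At a fixed time the ball of radius [2 * r] lies in a disc of radius [rho]. For nearby times [u]
    differs by at most [ln 2] on the disc of radius [rho + 1], so lengths there at most double. A
    curve of length below [r] at the nearby time, stopped at modulus [rho + 1], would then
    contradict the choice of [rho]. Compactness of the time interval makes the bound uniform. *)
Lemma ball_bounded_uniform (T : R) (u : F3) (D : list dir -> F3) (tau T1 r : R) :
  smooth_family T u D -> inst_complete T u -> 0 < tau -> T1 < T ->
  exists W, 0 <= W /\ forall t q, tau <= t <= T1 -> dlt (u t) (0, 0) q r ->
    modz (fst q) (snd q) <= W.
Proof.
  intros Hu Hc Htau HT1.
  pose proof Hu as (Enil & Hcont & _).
  assert (Hcu : forall t, 0 <= t <= T -> cont2 (u t)).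
  { intros t Ht. rewrite <- Enil. apply (cont_on_cont2 T); auto. }
  assert (Hd : forall t, exists d : posreal, tau <= t <= T1 ->
    forall t' q, Rabs (t' - t) < d -> tau <= t' <= T1 -> dlt (u t') (0, 0) q r ->
      modz (fst q) (snd q) <= / d).
  { intros t. destruct (classic (tau <= t <= T1)) as [Ht|Ht].
    2: exists (mkposreal 1 Rlt_0_1); tauto.
    pose proof (complete_ball_bounded (u t) (0, 0) (2 * r) (Hcu t ltac:(lra)) (Hc t ltac:(lra))) as Hb.
    apply not_all_ex_not in Hb. destruct Hb as [rho0 Hrho0].
    set (rho := Rabs rho0).
    assert (Hrho : 0 <= rho) by apply Rabs_pos.
    assert (Hin : forall q, dlt (u t) (0, 0) q (2 * r) -> modz (fst q) (snd q) <= rho).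
    { intros q Hq. apply Rnot_lt_le. intros Hlt. apply Hrho0. exists q.
      split; [exact Hq|]. unfold rho in Hlt. pose proof (Rle_abs rho0). lra. }
    destruct (cont_on_bounded T (rho + 1) (D (Dt :: nil)) (Hcont _)) as [B [HB0 HB]].
    assert (Hp : 0 < Rmin (ln 2 / (B + 1)) (/ (rho + 1))).
    { apply Rmin_pos; [|apply Rinv_0_lt_compat; lra].
      apply Rdiv_lt_0_compat; [|lra]. rewrite <- ln_1. apply ln_increasing; lra. }
    exists (mkposreal _ Hp). simpl. intros _ t' q Htt Ht' Hq.
    pose proof (Rmin_l (ln 2 / (B + 1)) (/ (rho + 1))).
    pose proof (Rmin_r (ln 2 / (B + 1)) (/ (rho + 1))).
    apply Rle_trans with (rho + 1).
    2: { rewrite <- (Rinv_inv (rho + 1)) at 1. apply Rinv_le_contravar; [exact Hp|lra]. }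
    apply Rnot_lt_le. intros Hlt.
    destruct Hq as (c & S & HS & E0 & <- & HL). injection E0 as E0x E0y. simpl in Hlt.
    destruct (first_passage (fun s => modz (cx c s) (cy c s)) (rho + 1) 1) as [s [Hs [Hgs Hle]]].
    - apply modz_continuity; [apply cx_cont|apply cy_cont].
    - lra.
    - rewrite E0x, E0y. unfold modz. replace (0 ^ 2 + 0 ^ 2) with 0 by ring. rewrite sqrt_0. lra.
    - lra.
    - destruct (arclength_exists (u t) c (Hcu t ltac:(lra))) as [S' HS'].
      assert (Hcmp : S' s <= exp (ln 2) * S s).
      { apply (arclength_le (u t) (u t') c); auto; [lra|]. intros x Hx.
        destruct (time_mvt T u D nil t' t (cx c x) (cy c x) Hu ltac:(lra) ltac:(lra))
          as [k [Hk Ek]].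
        rewrite Enil in Ek.
        specialize (Hle x Hx). simpl in Hle.
        destruct (modz_ge_coord (cx c x) (cy c x)) as [Hx1 Hx2].
        assert (Hk' : 0 <= k <= T).
        { revert Hk. unfold Rmin, Rmax. destruct Rle_dec; lra. }
        specialize (HB k (cx c x) (cy c x) Hk' ltac:(lra) ltac:(lra)).
        assert (D (Dt :: nil) k (cx c x) (cy c x) * (t - t') <= ln 2); [|lra].
        eapply Rle_trans; [apply Rle_abs|]. rewrite Rabs_mult.
        rewrite Rabs_minus_sym in Htt.
        apply Rle_trans with ((B + 1) * (ln 2 / (B + 1))); [|right; field; lra].
        apply Rmult_le_compat; try apply Rabs_pos; lra. }
      rewrite exp_ln in Hcmp by lra.
      assert (S s <= S 1) by (apply (arclength_mono (u t') c S); auto; lra).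
      assert (Hq : dlt (u t) (0, 0) (cx c s, cy c s) (2 * r)).
      { replace (0, 0) with (cx c 0, cy c 0) by congruence.
        apply (dlt_subcurve (u t) c S'); auto; try lra. rewrite (proj1 HS'). lra. }
      apply Hin in Hq. simpl in Hq. lra. }
  set (delta := fun t => proj1_sig (constructive_indefinite_description _ (Hd t))).
  destruct (compactness_value_1d tau T1 delta) as [d Hdv].
  exists (/ d). split; [left; apply Rinv_0_lt_compat, cond_pos|].
  intros t q Ht Hq. apply NNPP. intros Hno. apply (Hdv t Ht).
  intros (t0 & Ht0 & Htt & Hle). apply Hno. unfold delta in *.
  destruct (constructive_indefinite_description _ _) as [e He']. simpl in *.
  specialize (He' Ht0 t q Htt Ht Hq).
  pose proof (Rinv_le_contravar d e (cond_pos d) Hle). lra.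
Qed.

(** * Taylor expansions *)

(** The mean value theorem replaces integration. This gives up a factor [1 / (n + 1)], which is
    harmless since only the power of [a] matters later. *)
Lemma primitive_bound (h h' : R -> R) (B a : R) (n : nat) :
  (forall s, Rabs s <= Rabs a -> is_derive h s (h' s)) -> h 0 = 0 ->
  (forall s, Rabs s <= Rabs a -> Rabs (h' s) <= B * Rabs s ^ n) -> 0 <= B ->
  Rabs (h a) <= B * Rabs a ^ S n.
Proof.
  intros Hd H0 Hb HB.
  assert (Hca : forall c, Rmin 0 a <= c <= Rmax 0 a -> Rabs c <= Rabs a).
  { intros c. unfold Rmin, Rmax. destruct (Rle_dec 0 a); intros Hc.
    - rewrite !Rabs_right; lra.
    - rewrite !Rabs_left1; lra. }
  destruct (MVT_gen h 0 a h') as [c [Hc Ec]].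
  - intros x Hx. apply Hd, Hca. lra.
  - intros x Hx. eapply is_derive_continuity_pt, Hd, Hca, Hx.
  - rewrite H0, !Rminus_0_r in Ec. rewrite Ec, Rabs_mult. simpl.
    specialize (Hb c (Hca c Hc)).
    assert (Rabs c ^ n <= Rabs a ^ n)
      by (apply pow_incr; split; [apply Rabs_pos|apply Hca, Hc]).
    pose proof (Rabs_pos a).
    apply Rle_trans with (B * Rabs a ^ n * Rabs a); [|right; ring].
    apply Rmult_le_compat_r; [lra|]. eapply Rle_trans; [exact Hb|].
    apply Rmult_le_compat_l; assumption.
Qed.

Lemma taylor_order1 (g g1 : R -> R) (x a B : R) :
  (forall s, is_derive g s (g1 s)) ->
  (forall s, Rabs s <= Rabs a -> Rabs (g1 (x + s)) <= B) -> 0 <= B ->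
  Rabs (g (x + a) - g x) <= B * Rabs a.
Proof.
  intros H1 Hb HB.
  pose proof (primitive_bound (fun s => g (x + s) - g x) (fun s => g1 (x + s)) B a 0) as H.
  simpl in H. rewrite !Rmult_1_r in H. apply H; auto.
  - intros s _. replace (g1 (x + s)) with (1 * g1 (x + s) - 0) by ring.
    apply @is_derive_minus; [|apply @is_derive_const].
    apply (is_derive_comp g (fun s => x + s)); [apply H1|auto_derive; [trivial|ring]].
  - rewrite Rplus_0_r. ring.
Qed.

Lemma taylor_order2 (g g1 g2 : R -> R) (x a B : R) :
  (forall s, is_derive g s (g1 s)) -> (forall s, is_derive g1 s (g2 s)) ->
  (forall s, Rabs s <= Rabs a -> Rabs (g2 (x + s)) <= B) -> 0 <= B ->
  Rabs (g (x + a) - g x - a * g1 x) <= B * Rabs a ^ 2.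
Proof.
  intros H1 H2 Hb HB.
  apply (primitive_bound (fun s => g (x + s) - g x - s * g1 x)
    (fun s => g1 (x + s) - g1 x) B a 1); auto.
  - intros s _. replace (g1 (x + s) - g1 x) with (1 * g1 (x + s) - 0 - g1 x) by ring.
    apply @is_derive_minus; [|auto_derive; [trivial|ring]].
    apply @is_derive_minus; [|apply @is_derive_const].
    apply (is_derive_comp g (fun s => x + s)); [apply H1|auto_derive; [trivial|ring]].
  - rewrite Rplus_0_r. ring.
  - intros s Hs. simpl. rewrite Rmult_1_r. apply (taylor_order1 g1 g2); auto.
    intros r Hr. apply Hb. lra.
Qed.

Lemma taylor_order3 (g g1 g2 g3 : R -> R) (x a B : R) :
  (forall s, is_derive g s (g1 s)) -> (forall s, is_derive g1 s (g2 s)) ->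
  (forall s, is_derive g2 s (g3 s)) ->
  (forall s, Rabs s <= Rabs a -> Rabs (g3 (x + s)) <= B) -> 0 <= B ->
  Rabs (g (x + a) - g x - a * g1 x - a ^ 2 / 2 * g2 x) <= B * Rabs a ^ 3.
Proof.
  intros H1 H2 H3 Hb HB.
  apply (primitive_bound (fun s => g (x + s) - g x - s * g1 x - s ^ 2 / 2 * g2 x)
    (fun s => g1 (x + s) - g1 x - s * g2 x) B a 2); auto.
  - intros s _. replace (g1 (x + s) - g1 x - s * g2 x)
      with (1 * g1 (x + s) - 0 - g1 x - s * g2 x) by ring.
    apply @is_derive_minus; [|auto_derive; [trivial|field]].
    apply @is_derive_minus; [|auto_derive; [trivial|ring]].
    apply @is_derive_minus; [|apply @is_derive_const].
    apply (is_derive_comp g (fun s => x + s)); [apply H1|auto_derive; [trivial|ring]].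
  - rewrite Rplus_0_r. field.
  - intros s Hs. apply (taylor_order2 g1 g2 g3); auto.
    intros r Hr. apply Hb. lra.
Qed.

Lemma partial_x_derive (T : R) (u : F3) (D : list dir -> F3) (l : list dir) (t x y : R) :
  smooth_family T u D -> 0 <= t <= T ->
  is_derive (fun s => D l t s y) x (D (Dx :: l) t x y).
Proof. intros (_ & _ & HD) Ht. apply is_derive_Reals, (HD l Dx t x y Ht). Qed.

Lemma partial_y_derive (T : R) (u : F3) (D : list dir -> F3) (l : list dir) (t x y : R) :
  smooth_family T u D -> 0 <= t <= T ->
  is_derive (fun s => D l t x s) y (D (Dy :: l) t x y).
Proof. intros (_ & _ & HD) Ht. apply is_derive_Reals, (HD l Dy t x y Ht). Qed.

Lemma Rabs_shift_le (x s a W : R) : Rabs x + Rabs a <= W -> Rabs s <= Rabs a -> Rabs (x + s) <= W.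
Proof. intros H1 H2. pose proof (Rabs_triang x s). lra. Qed.

Definition bounded_order (T W B : R) (n : nat) (D : list dir -> F3) : Prop :=
  forall l, (length l <= n)%nat -> forall t x y, 0 <= t <= T ->
    Rabs x <= W -> Rabs y <= W -> Rabs (D l t x y) <= B.

Lemma Rabs_le_split (a b A B : R) : Rabs a <= A -> Rabs b <= B -> Rabs (a + b) <= A + B.
Proof. intros. pose proof (Rabs_triang a b). lra. Qed.

(** Expand in [x] at height [y + b], then carry each coefficient down to height [y]. This order
    explains why the mixed derivative appears as [D (Dy :: Dx :: nil)]. *)
Lemma space_taylor (T : R) (u : F3) (D : list dir -> F3) (W B t x y a b : R) :
  smooth_family T u D -> bounded_order T W B 3 D -> 0 <= B -> 0 <= t <= T ->
  Rabs x + Rabs a <= W -> Rabs y + Rabs b <= W ->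
  Rabs (D nil t (x + a) (y + b) - D nil t x y
    - (a * D (Dx :: nil) t x y + b * D (Dy :: nil) t x y)
    - (a ^ 2 / 2 * D (Dx :: Dx :: nil) t x y + a * b * D (Dy :: Dx :: nil) t x y
       + b ^ 2 / 2 * D (Dy :: Dy :: nil) t x y)) <= B * (Rabs a + Rabs b) ^ 3.
Proof.
  intros Hu HB HB0 Ht Hx Hy.
  pose proof (Rabs_pos a) as Ha. pose proof (Rabs_pos b) as Hb.
  pose proof (Rabs_pos x) as Hx0. pose proof (Rabs_pos y) as Hy0.
  assert (Hxx : Rabs x <= W) by lra. assert (Hyy : Rabs (y + b) <= W) by (eapply Rabs_shift_le; eauto; lra).
  pose proof (taylor_order3 (fun s => D nil t s (y + b)) (fun s => D (Dx :: nil) t s (y + b))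
    (fun s => D (Dx :: Dx :: nil) t s (y + b)) (fun s => D (Dx :: Dx :: Dx :: nil) t s (y + b)) x a B) as E1.
  pose proof (taylor_order3 (fun s => D nil t x s) (fun s => D (Dy :: nil) t x s)
    (fun s => D (Dy :: Dy :: nil) t x s) (fun s => D (Dy :: Dy :: Dy :: nil) t x s) y b B) as E2.
  pose proof (taylor_order2 (fun s => D (Dx :: nil) t x s) (fun s => D (Dy :: Dx :: nil) t x s)
    (fun s => D (Dy :: Dy :: Dx :: nil) t x s) y b B) as E3.
  pose proof (taylor_order1 (fun s => D (Dx :: Dx :: nil) t x s)
    (fun s => D (Dy :: Dx :: Dx :: nil) t x s) y b B) as E4.
  cbv beta in E1, E2, E3, E4.
  assert (F1 := E1 (fun s => partial_x_derive T u D _ t s _ Hu Ht)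
    (fun s => partial_x_derive T u D _ t s _ Hu Ht) (fun s => partial_x_derive T u D _ t s _ Hu Ht)
    (fun s Hs => HB (Dx :: Dx :: Dx :: nil) (le_n 3) t _ _ Ht (Rabs_shift_le _ _ _ _ Hx Hs) Hyy) HB0).
  assert (F2 := E2 (fun s => partial_y_derive T u D _ t _ s Hu Ht)
    (fun s => partial_y_derive T u D _ t _ s Hu Ht) (fun s => partial_y_derive T u D _ t _ s Hu Ht)
    (fun s Hs => HB (Dy :: Dy :: Dy :: nil) (le_n 3) t _ _ Ht Hxx (Rabs_shift_le _ _ _ _ Hy Hs)) HB0).
  assert (F3 := E3 (fun s => partial_y_derive T u D _ t _ s Hu Ht)
    (fun s => partial_y_derive T u D _ t _ s Hu Ht)
    (fun s Hs => HB (Dy :: Dy :: Dx :: nil) (le_n 3) t _ _ Ht Hxx (Rabs_shift_le _ _ _ _ Hy Hs)) HB0).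
  assert (F4 := E4 (fun s => partial_y_derive T u D _ t _ s Hu Ht)
    (fun s Hs => HB (Dy :: Dx :: Dx :: nil) (le_n 3) t _ _ Ht Hxx (Rabs_shift_le _ _ _ _ Hy Hs)) HB0).
  clear E1 E2 E3 E4.
  set (R1 := D nil t (x + a) (y + b) - _ - _ - _) in F1.
  set (R2 := D nil t x (y + b) - _ - _ - _) in F2.
  set (R3 := D (Dx :: nil) t x (y + b) - _ - _) in F3.
  set (R4 := D (Dx :: Dx :: nil) t x (y + b) - _) in F4.
  match goal with |- Rabs ?e <= _ =>
    replace e with (R1 + (R2 + (a * R3 + a ^ 2 / 2 * R4))) by (unfold R1, R2, R3, R4; field) end.
  apply Rle_trans with (B * Rabs a ^ 3 + (B * Rabs b ^ 3 + (Rabs a * (B * Rabs b ^ 2) +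
    Rabs a ^ 2 / 2 * (B * Rabs b)))).
  - apply Rabs_le_split; [exact F1|]. apply Rabs_le_split; [exact F2|].
    apply Rabs_le_split.
    + rewrite Rabs_mult. apply Rmult_le_compat_l; [exact Ha|exact F3].
    + rewrite Rabs_mult, (Rabs_right (a ^ 2 / 2)) by nra. rewrite (pow2_abs a).
      apply Rmult_le_compat_l; [nra|exact F4].
  - set (p := Rabs a) in *. set (q := Rabs b) in *.
    apply Rminus_le.
    replace (_ - _) with (- (B * (p * q * (2 * q) + p * p * q * (5 / 2)))) by field.
    assert (0 <= p * q) by (apply Rmult_le_pos; assumption).
    assert (0 <= p * q * (2 * q)) by (apply Rmult_le_pos; lra).
    assert (0 <= p * p * q) by (apply Rmult_le_pos; nra).
    enough (0 <= B * (p * q * (2 * q) + p * p * q * (5 / 2))) by lra.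
    apply Rmult_le_pos; lra.
Qed.

(** The time derivative is taken at the undisplaced point, at the cost of [h] times an error linear
    in the displacements. With [h] of order [rho^2] and displacements of order [rho] this is of
    order [rho^3]. *)
Lemma time_taylor (T : R) (u : F3) (D : list dir -> F3) (W B t h x y a b : R) :
  smooth_family T u D -> bounded_order T W B 3 D -> 0 <= B -> 0 <= h -> 0 < t - h -> t < T ->
  Rabs x + Rabs a <= W -> Rabs y + Rabs b <= W ->
  Rabs (D nil (t - h) (x + a) (y + b) - D nil t (x + a) (y + b) + h * D (Dt :: nil) t x y)
    <= h * (B * (h + Rabs a + Rabs b)).
Proof.
  intros Hu HB HB0 Hh Hth HtT Hx Hy.
  pose proof (Rabs_pos a) as Ha. pose proof (Rabs_pos b) as Hb.
  pose proof (Rabs_pos x) as Hx0. pose proof (Rabs_pos y) as Hy0.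
  assert (Hxx : Rabs (x + a) <= W) by (eapply Rabs_shift_le; eauto; lra).
  assert (Hyy : Rabs (y + b) <= W) by (eapply Rabs_shift_le; eauto; lra).
  destruct (time_mvt T u D nil t (t - h) (x + a) (y + b) Hu) as [c [Hc Ec]]; [lra|lra|].
  rewrite Rmin_right, Rmax_left in Hc by lra.
  assert (HtT' : 0 <= t <= T) by lra. assert (Hx' : Rabs x <= W) by lra.
  destruct (time_mvt T u D (Dt :: nil) t c (x + a) (y + b) Hu ltac:(lra) ltac:(lra)) as [c' [Hc' Ec']].
  assert (Hc'' : 0 <= c' <= T).
  { revert Hc'. unfold Rmin, Rmax. destruct Rle_dec; lra. }
  pose proof (HB (Dt :: Dt :: nil) ltac:(simpl; lia) c' _ _ Hc'' Hxx Hyy) as Htt.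
  pose proof (taylor_order1 (fun s => D (Dt :: nil) t s (y + b))
    (fun s => D (Dx :: Dt :: nil) t s (y + b)) x a B
    (fun s => partial_x_derive T u D _ t s _ Hu HtT')
    (fun s Hs => HB (Dx :: Dt :: nil) (le_S _ _ (le_n 2)) t _ _ HtT' (Rabs_shift_le _ _ _ _ Hx Hs) Hyy) HB0) as F1.
  pose proof (taylor_order1 (fun s => D (Dt :: nil) t x s)
    (fun s => D (Dy :: Dt :: nil) t x s) y b B
    (fun s => partial_y_derive T u D _ t _ s Hu HtT')
    (fun s Hs => HB (Dy :: Dt :: nil) (le_S _ _ (le_n 2)) t _ _ HtT' Hx' (Rabs_shift_le _ _ _ _ Hy Hs)) HB0) as F2.
  simpl in F1, F2.
  rewrite Ec.
  replace (D (Dt :: nil) c (x + a) (y + b) * (t - h - t) + h * D (Dt :: nil) t x y) with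
    (- h * ((D (Dt :: nil) c (x + a) (y + b) - D (Dt :: nil) t (x + a) (y + b)) +
       (D (Dt :: nil) t (x + a) (y + b) - D (Dt :: nil) t x (y + b)) +
       (D (Dt :: nil) t x (y + b) - D (Dt :: nil) t x y))) by ring.
  rewrite Rabs_mult, Rabs_Ropp, (Rabs_right h) by lra.
  apply Rmult_le_compat_l; [exact Hh|].
  replace (B * (h + Rabs a + Rabs b)) with (B * h + B * Rabs a + B * Rabs b) by ring.
  apply Rabs_le_split; [apply Rabs_le_split|]; auto.
  rewrite Ec', Rabs_mult. apply Rmult_le_compat; try apply Rabs_pos; [exact Htt|].
  rewrite Rabs_left1; lra.
Qed.

Lemma exp_taylor2 (x : R) : Rabs x <= 1 -> Rabs (exp x - 1 - x) <= 3 * x ^ 2.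
Proof.
  intros Hx. pose proof (taylor_order2 exp exp exp 0 x 3) as H.
  rewrite Rplus_0_l, exp_0, Rmult_1_r, pow2_abs in H.
  apply H; try (intros s; apply is_derive_exp); [|lra].
  intros s Hs. rewrite Rplus_0_l, Rabs_right by (left; apply exp_pos).
  apply Rle_trans with (exp 1); [|apply exp_le_3]. apply exp_le.
  pose proof (Rle_abs s). lra.
Qed.

Lemma exp_taylor3 (x : R) : Rabs x <= 1 ->
  Rabs (exp x - 1 - x - x ^ 2 / 2) <= 3 * Rabs x ^ 3.
Proof.
  intros Hx. pose proof (taylor_order3 exp exp exp exp 0 x 3) as H.
  rewrite Rplus_0_l, exp_0, !Rmult_1_r in H.
  apply H; try (intros s; apply is_derive_exp); [|lra].
  intros s Hs. rewrite Rplus_0_l, Rabs_right by (left; apply exp_pos).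
  apply Rle_trans with (exp 1); [|apply exp_le_3]. apply exp_le.
  pose proof (Rle_abs s). lra.
Qed.

Lemma ln_taylor3 (y : R) : Rabs y <= 1 / 2 ->
  Rabs (ln (1 + y) - y + y ^ 2 / 2) <= 2 * Rabs y ^ 3.
Proof.
  intros Hy.
  apply (primitive_bound (fun y => ln (1 + y) - y + y ^ 2 / 2) (fun y => y ^ 2 / (1 + y)) 2 y 2).
  - intros s Hs. pose proof (Rle_abs (- s)) as Hs'. rewrite Rabs_Ropp in Hs'.
    auto_derive; [lra|field; lra].
  - rewrite Rplus_0_r, ln_1. field.
  - intros s Hs. pose proof (Rle_abs (- s)) as Hs'. rewrite Rabs_Ropp in Hs'.
    assert (Hi : 0 < / (1 + s) <= 2).
    { split; [apply Rinv_0_lt_compat; lra|].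
      replace 2 with (/ (1 / 2)) by field. apply Rinv_le_contravar; lra. }
    rewrite pow2_abs, Rabs_right; unfold Rdiv; pose proof (pow2_ge_0 s); nra.
  - lra.
Qed.

Lemma ln_taylor2 (y : R) : Rabs y <= 1 / 2 -> Rabs (ln (1 + y) - y) <= 2 * y ^ 2.
Proof.
  intros Hy. pose proof (ln_taylor3 y Hy) as H.
  replace (ln (1 + y) - y) with ((ln (1 + y) - y + y ^ 2 / 2) + (- (y ^ 2 / 2))) by ring.
  eapply Rle_trans; [apply Rabs_triang|].
  rewrite Rabs_Ropp, (Rabs_right (y ^ 2 / 2)) by (pose proof (pow2_ge_0 y); lra).
  assert (Rabs y ^ 3 <= y ^ 2 / 2).
  { rewrite <- (pow2_abs y). pose proof (Rabs_pos y). simpl. nra. }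
  pose proof (pow2_ge_0 y). lra.
Qed.

(** In the upper bound the linear term [x] is kept rather than replaced by [rho * a]: a single [x]
    is known only up to [rho^2], but the sum of four of them will be known up to [rho^3]. *)
Lemma exp_near_linear (A C x a rho : R) : 0 <= A -> 0 <= C -> 0 < rho -> rho <= 1 -> (A + C) * rho <= 1 -> Rabs a <= A ->
  Rabs (x - rho * a) <= C * rho ^ 2 ->
  Rabs x <= (A + C) * rho /\
  exp x <= 1 + x + rho ^ 2 * a ^ 2 / 2 + ((A + C) ^ 2 + 3 * (A + C) ^ 3) * rho ^ 3 /\
  Rabs (exp x - 1) <= rho * Rabs a + (C + 3 * (A + C) ^ 2) * rho ^ 2.
Proof.
  intros HA HC Hr Hr1 HG Ha Hx.
  assert (Hxa : Rabs x <= rho * Rabs a + C * rho ^ 2).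
  { replace x with (rho * a + (x - rho * a)) at 1 by ring.
    eapply Rle_trans; [apply Rabs_triang|].
    rewrite Rabs_mult, (Rabs_right rho) by lra. lra. }
  assert (Hrr : rho ^ 2 <= rho) by nra.
  assert (Hxg : Rabs x <= (A + C) * rho).
  { pose proof (Rabs_pos a). nra. }
  set (G := A + C) in *.
  assert (HG0 : 0 <= G) by (unfold G; lra).
  assert (Hx1 : Rabs x <= 1) by lra.
  assert (Hx2 : x ^ 2 <= rho ^ 2 * a ^ 2 + 2 * G ^ 2 * rho ^ 3).
  { rewrite <- (pow2_abs x), <- (pow2_abs a).
    pose proof (Rabs_pos a). pose proof (Rabs_pos x). set (p := Rabs a) in *.
    apply Rle_trans with ((rho * p + C * rho ^ 2) ^ 2); [apply pow_incr; lra|].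
    replace ((rho * p + C * rho ^ 2) ^ 2) with
      (rho ^ 2 * p ^ 2 + 2 * (p * C) * rho ^ 3 + C ^ 2 * rho * rho ^ 3) by ring.
    assert (0 < rho ^ 3) by (apply pow_lt; lra).
    assert (p * C <= A * C) by nra.
    assert (C ^ 2 * rho <= C ^ 2) by (pose proof (pow2_ge_0 C); nra).
    assert (2 * (p * C) + C ^ 2 * rho <= 2 * G ^ 2) by (unfold G; nra).
    nra. }
  assert (Hx3 : Rabs x ^ 3 <= G ^ 3 * rho ^ 3).
  { rewrite <- Rpow_mult_distr. apply pow_incr. split; [apply Rabs_pos|exact Hxg]. }
  split; [exact Hxg|split].
  - pose proof (exp_taylor3 x Hx1) as H. apply Rabs_le_between in H. lra.
  - pose proof (exp_taylor2 x Hx1) as H.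
    replace (exp x - 1) with ((exp x - 1 - x) + x) by ring.
    eapply Rle_trans; [apply Rabs_triang|].
    assert (x ^ 2 <= G ^ 2 * rho ^ 2).
    { rewrite <- Rpow_mult_distr, <- (pow2_abs x). apply pow_incr. split; [apply Rabs_pos|exact Hxg]. }
    lra.
Qed.

Lemma exp_four_points (A C x1 x2 x3 x4 a b S rho : R) :
  0 <= A -> 0 <= C -> 0 < rho -> rho <= 1 -> (A + C) * rho <= 1 -> Rabs a <= A -> Rabs b <= A ->
  Rabs (x1 - rho * a) <= C * rho ^ 2 -> Rabs (x2 - rho * - a) <= C * rho ^ 2 ->
  Rabs (x3 - rho * b) <= C * rho ^ 2 -> Rabs (x4 - rho * - b) <= C * rho ^ 2 ->
  x1 + x2 + x3 + x4 <= rho ^ 2 * S + C * rho ^ 3 ->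
  exp x1 + exp x2 + exp x3 + exp x4 <=
    4 + rho ^ 2 * (S + a ^ 2 + b ^ 2) + (C + 4 * ((A + C) ^ 2 + 3 * (A + C) ^ 3)) * rho ^ 3.
Proof.
  intros HA HC Hr Hr1 HG Ha Hb H1 H2 H3 H4 HS.
  destruct (exp_near_linear A C x1 a rho) as (_ & E1 & _); auto.
  destruct (exp_near_linear A C x2 (- a) rho) as (_ & E2 & _); auto; [now rewrite Rabs_Ropp|].
  destruct (exp_near_linear A C x3 b rho) as (_ & E3 & _); auto.
  destruct (exp_near_linear A C x4 (- b) rho) as (_ & E4 & _); auto; [now rewrite Rabs_Ropp|].
  replace ((- a) ^ 2) with (a ^ 2) in E2 by ring. replace ((- b) ^ 2) with (b ^ 2) in E4 by ring.
  lra.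
Qed.

(* [ln |1 + rho m|^2] for complex [m = m1 + i m2]; multiplying m by i gives [- m2 + i m1]. *)
Definition lnc (rho m1 m2 : R) : R := ln (1 + (2 * rho * m1 + rho ^ 2 * (m1 ^ 2 + m2 ^ 2))).

Lemma lnc_linear (M rho m1 m2 : R) :
  0 <= M -> 0 < rho -> 8 * M * rho <= 1 -> Rabs m1 <= M -> Rabs m2 <= M ->
  0 < 1 + (2 * rho * m1 + rho ^ 2 * (m1 ^ 2 + m2 ^ 2)) /\
  Rabs (lnc rho m1 m2 - rho * (2 * m1)) <= 20 * M ^ 2 * rho ^ 2 /\
  Rabs (2 * rho * m1 + rho ^ 2 * (m1 ^ 2 + m2 ^ 2)) <= 3 * M * rho /\
  Rabs (2 * rho * m1 + rho ^ 2 * (m1 ^ 2 + m2 ^ 2)) <= 1 / 2.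
Proof.
  intros HM Hr HMr H1 H2.
  assert (Hq : 0 <= m1 ^ 2 + m2 ^ 2 <= 2 * M ^ 2).
  { rewrite <- (pow2_abs m1), <- (pow2_abs m2).
    pose proof (Rabs_pos m1). pose proof (Rabs_pos m2). nra. }
  set (q := m1 ^ 2 + m2 ^ 2) in *.
  assert (Hr2 : 0 <= rho ^ 2 * q <= 2 * M ^ 2 * rho ^ 2) by (split; nra).
  assert (Hm : Rabs (2 * rho * m1) <= 2 * M * rho).
  { rewrite !Rabs_mult, (Rabs_right 2), (Rabs_right rho) by lra. nra. }
  assert (HMr2 : 2 * M ^ 2 * rho ^ 2 <= M * rho).
  { replace (2 * M ^ 2 * rho ^ 2) with (2 * (M * rho) * (M * rho)) by ring.
    assert (0 <= M * rho) by nra. nra. }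
  assert (Hy : Rabs (2 * rho * m1 + rho ^ 2 * q) <= 3 * M * rho).
  { eapply Rle_trans; [apply Rabs_triang|]. rewrite (Rabs_right (rho ^ 2 * q)) by lra. lra. }
  assert (Hy' : Rabs (2 * rho * m1 + rho ^ 2 * q) <= 1 / 2) by lra.
  split; [|split; [|split]]; auto.
  - apply Rabs_le_between in Hy'. lra.
  - pose proof (ln_taylor2 _ Hy') as H. unfold lnc. fold q.
    set (y := 2 * rho * m1 + rho ^ 2 * q) in *.
    replace (ln (1 + y) - rho * (2 * m1)) with ((ln (1 + y) - y) + rho ^ 2 * q)
      by (unfold y; ring).
    eapply Rle_trans; [apply Rabs_triang|]. rewrite (Rabs_right (rho ^ 2 * q)) by lra.
    assert (y ^ 2 <= (3 * M * rho) ^ 2).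
    { rewrite <- (pow2_abs y). apply pow_incr. split; [apply Rabs_pos|exact Hy]. }
    nra.
Qed.

(** The function [ln |1 + q|^2] is harmonic, so over the four points
    [q = rho m, - rho m, i rho m, - i rho m] its first and second order terms cancel. Only the
    square of the second argument of [lnc] enters, so its sign is immaterial. *)
Lemma lnc_sum (M rho m1 m2 : R) :
  0 <= M -> 0 < rho -> 8 * M * rho <= 1 -> Rabs m1 <= M -> Rabs m2 <= M ->
  lnc rho m1 m2 + lnc rho (- m1) m2 + lnc rho (- m2) m1 + lnc rho m2 m1 <= 216 * M ^ 3 * rho ^ 3.
Proof.
  intros HM Hr HMr H1 H2.
  assert (H1' : Rabs (- m1) <= M) by now rewrite Rabs_Ropp.
  assert (H2' : Rabs (- m2) <= M) by now rewrite Rabs_Ropp.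
  assert (Hl : forall a b, Rabs a <= M -> Rabs b <= M -> lnc rho a b <=
    (2 * rho * a + rho ^ 2 * (a ^ 2 + b ^ 2)) - (2 * rho * a + rho ^ 2 * (a ^ 2 + b ^ 2)) ^ 2 / 2
    + 54 * M ^ 3 * rho ^ 3).
  { intros a b Ha Hb. destruct (lnc_linear M rho a b) as (_ & _ & Hy & Hy'); auto.
    pose proof (ln_taylor3 _ Hy') as H. unfold lnc.
    set (y := 2 * rho * a + _) in *.
    assert (Rabs y ^ 3 <= (3 * M * rho) ^ 3) by (apply pow_incr; split; [apply Rabs_pos|exact Hy]).
    replace ((3 * M * rho) ^ 3) with (27 * M ^ 3 * rho ^ 3) in H0 by ring.
    apply Rabs_le_between in H. lra. }
  pose proof (Hl _ _ H1 H2) as E1. pose proof (Hl _ _ H1' H2) as E2.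
  pose proof (Hl _ _ H2' H1) as E3. pose proof (Hl _ _ H2 H1) as E4.
  assert (0 <= (rho ^ 2 * (m1 ^ 2 + m2 ^ 2)) ^ 2) by apply pow2_ge_0.
  nra.
Qed.

(** * Four-point means *)

(* The conformal factor of the hyperbolic metric on the exterior of the unit disc. *)
Definition hyp (x y : R) : R := - ln (modz x y * ln (modz x y)).

(** This amounts to [exp (1 / 4) <= 3 / 2], which follows from [(3/2)^4 = 81/16 > 3] and
    [exp 1 <= 3]. *)
Lemma ln_modz_bound (x y : R) : 3 / 2 <= modz x y -> 1 / 4 <= ln (modz x y).
Proof.
  intros Hr. rewrite <- (ln_exp (1 / 4)).
  assert (exp (1 / 4) <= modz x y).
  { apply Rle_trans with (3 / 2); [|exact Hr].
    pose proof (exp_pos (1 / 4)) as Hp. pose proof exp_le_3 as H3.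
    replace 1 with (1 / 4 + 1 / 4 + 1 / 4 + 1 / 4) in H3 by field.
    rewrite !exp_plus in H3. set (z := exp (1 / 4)) in *.
    apply Rnot_lt_le. intros Hlt. assert (9 / 4 < z * z) by nra.
    assert (z * z * z * z = (z * z) * (z * z)) by ring. nra. }
  destruct H as [H|H]; [left; apply ln_increasing; [apply exp_pos|exact H]|rewrite H; lra].
Qed.

(** With [z = x + i y] and [m = m1 + i m2], the displacement is [a + i b = m z], so the modulus is
    multiplied by [|1 + rho m| = exp (lam / 2)]. Then [ln |z|] is multiplied by [1 + lam / l], and
    [hyp] changes by [- lam / 2 - ln (1 + lam / l)]. Expanding the last logarithm, with [lam] close
    to [2 * rho * m1], produces the quadratic term. *)
Lemma hyp_displaced (F x y a b rho : R) :
  0 <= F -> 0 < rho -> 40 * F * rho <= 1 -> Rabs a <= F -> Rabs b <= F -> 3 / 2 <= modz x y ->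
  let m1 := (a * x + b * y) / (x ^ 2 + y ^ 2) in
  let m2 := (b * x - a * y) / (x ^ 2 + y ^ 2) in
  let l := 2 * ln (modz x y) in
  Rabs m1 <= 2 * F /\ Rabs m2 <= 2 * F /\
  hyp (x + rho * a) (y + rho * b) >=
    hyp x y - (1 / 2 + / l) * lnc rho m1 m2 + 2 * rho ^ 2 * m1 ^ 2 / l ^ 2 - 18000 * F ^ 3 * rho ^ 3.
Proof.
  intros HF Hr HFr Ha Hb Hxy m1 m2 l.
  pose proof (modz_sqr x y) as Hsq. pose proof (modz_pos x y) as Hp.
  pose proof (ln_modz_bound x y Hxy) as Hln.
  assert (Hab : modz a b <= 2 * F) by (pose proof (modz_le_sum a b); lra).
  assert (Hab0 : 0 <= modz a b) by apply modz_pos.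
  assert (Hm : forall p q, modz p q = modz a b -> Rabs ((p * x + q * y) / (x ^ 2 + y ^ 2)) <= 2 * F).
  { intros p q Hpq.
    assert (Hd : Rabs (p * x + q * y) <= modz a b * modz x y).
    { apply Rabs_le. pose proof (dot_le_modz p q x y). pose proof (dot_le_modz (- p) (- q) x y).
      rewrite modz_opp in H0. rewrite Hpq in H, H0. lra. }
    unfold Rdiv. rewrite Rabs_mult, <- Hsq.
    rewrite (Rabs_right (/ _)) by (left; apply Rinv_0_lt_compat; nra).
    apply Rmult_le_reg_r with (modz x y * modz x y); [nra|].
    rewrite Rmult_assoc, Rinv_l, Rmult_1_r by nra.
    apply Rle_trans with (2 * F * modz x y).
    - eapply Rle_trans; [exact Hd|]. apply Rmult_le_compat_r; lra.
    - apply Rmult_le_compat_l; [lra|nra]. }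
  assert (Hm1 : Rabs m1 <= 2 * F) by (apply Hm; reflexivity).
  assert (Hm2 : Rabs m2 <= 2 * F).
  { unfold m2. replace (b * x - a * y) with (b * x + - a * y) by ring. apply Hm.
    unfold modz. f_equal. ring. }
  split; [exact Hm1|split; [exact Hm2|]].
  destruct (lnc_linear (2 * F) rho m1 m2) as (Hpos & Hlin & _ & _); auto; try lra.
  set (lam := lnc rho m1 m2) in *.
  assert (Hl : 1 / 2 <= l) by (unfold l; lra).
  assert (Hil : 0 < / l <= 2).
  { split; [apply Rinv_0_lt_compat; lra|]. replace 2 with (/ (1 / 2)) by field.
    apply Rinv_le_contravar; lra. }
  assert (Hlam : Rabs lam <= 10 * F * rho).
  { replace lam with ((lam - rho * (2 * m1)) + rho * (2 * m1)) by ring.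
    eapply Rle_trans; [apply Rabs_triang|].
    rewrite (Rabs_mult rho), Rabs_mult, (Rabs_right rho), (Rabs_right 2) by lra.
    assert (20 * (2 * F) ^ 2 * rho ^ 2 <= 2 * F * rho).
    { replace (20 * (2 * F) ^ 2 * rho ^ 2) with ((2 * F * rho) * (40 * F * rho)) by ring.
      assert (0 <= F * rho) by nra. nra. }
    nra. }
  assert (Hz : Rabs (lam / l) <= 20 * F * rho).
  { unfold Rdiv. rewrite Rabs_mult, (Rabs_right (/ l)) by lra.
    pose proof (Rabs_pos lam). nra. }
  assert (Hz' : Rabs (lam / l) <= 1 / 2) by lra.
  assert (Hnew : modz (x + rho * a) (y + rho * b) = modz x y * exp (lam / 2)).
  { assert (0 <= modz x y * exp (lam / 2)) by (apply Rmult_le_pos; [lra|left; apply exp_pos]).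
    unfold modz at 1. rewrite <- (sqrt_Rsqr (modz x y * exp (lam / 2))) by assumption.
    f_equal. unfold Rsqr.
    replace (modz x y * exp (lam / 2) * (modz x y * exp (lam / 2)))
      with ((modz x y * modz x y) * (exp (lam / 2) * exp (lam / 2))) by ring.
    rewrite <- exp_plus. replace (lam / 2 + lam / 2) with lam by field.
    rewrite Hsq. unfold lam, lnc. rewrite exp_ln by exact Hpos.
    unfold m1, m2. field. nra. }
  assert (Hmul : forall k, -1 < 2 * k / l -> - ln (modz x y * exp k * ln (modz x y * exp k)) =
     hyp x y - k - ln (1 + 2 * k / l)).
  { intros k Hk. unfold hyp.
    assert (E : ln (modz x y * exp k) = ln (modz x y) * (1 + 2 * k / l)).
    { rewrite ln_mult, ln_exp by (try apply exp_pos; lra). unfold l. field. lra. }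
    rewrite E. rewrite !ln_mult, ln_exp; try apply exp_pos; try lra.
    all: try (apply Rmult_lt_0_compat; try apply exp_pos; lra). }
  unfold hyp at 1. rewrite Hnew.
  rewrite Hmul; replace (2 * (lam / 2) / l) with (lam / l) by (field; lra);
    [|apply Rabs_le_between in Hz'; lra].
  pose proof (ln_taylor3 _ Hz') as Hln3.
  assert (Hz3 : Rabs (lam / l) ^ 3 <= 8000 * F ^ 3 * rho ^ 3).
  { replace (8000 * F ^ 3 * rho ^ 3) with ((20 * F * rho) ^ 3) by ring.
    apply pow_incr. split; [apply Rabs_pos|exact Hz]. }
  assert (Hsqr : 4 * rho ^ 2 * m1 ^ 2 - 640 * F ^ 3 * rho ^ 3 <= lam ^ 2).
  { set (e := lam - rho * (2 * m1)) in *.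
    replace (lam ^ 2) with (4 * rho ^ 2 * m1 ^ 2 + 4 * rho * (m1 * e) + e ^ 2) by (unfold e; ring).
    assert (Rabs (m1 * e) <= 2 * F * (20 * (2 * F) ^ 2 * rho ^ 2)).
    { rewrite Rabs_mult. apply Rmult_le_compat; try apply Rabs_pos; auto. }
    apply Rabs_le_between in H. pose proof (pow2_ge_0 e).
    assert (4 * rho * (m1 * e) >= 4 * rho * - (2 * F * (20 * (2 * F) ^ 2 * rho ^ 2))) by nra.
    nra. }
  assert (Hq : 2 * rho ^ 2 * m1 ^ 2 / l ^ 2 - 1280 * F ^ 3 * rho ^ 3 <= (lam / l) ^ 2 / 2).
  { replace ((lam / l) ^ 2 / 2) with (lam ^ 2 * (/ l * / l) / 2) by (field; lra).
    replace (2 * rho ^ 2 * m1 ^ 2 / l ^ 2) with (4 * rho ^ 2 * m1 ^ 2 * (/ l * / l) / 2) by (field; lra).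
    assert (0 <= F ^ 3 * rho ^ 3) by (apply Rmult_le_pos; apply pow_le; lra).
    assert (0 <= / l * / l <= 4) by nra.
    nra. }
  apply Rabs_le_between in Hln3.
  replace ((1 / 2 + / l) * lam) with (lam / 2 + lam / l) by (field; lra).
  assert (0 <= F ^ 3 * rho ^ 3) by (apply Rmult_le_pos; apply pow_le; lra).
  lra.
Qed.

(** A discrete form of Liouville's equation [Laplacian w = exp (2 w)], that is, curvature -1. The
    terms linear in [lnc] cancel by [lnc_sum]; the squares add up to [4 * rho^2 * |m|^2 / l^2], and
    [|m|^2 = (a^2 + b^2) / |z|^2]. *)
Lemma hyp_four_points (F x y a b rho : R) :
  0 <= F -> 0 < rho -> 40 * F * rho <= 1 -> Rabs a <= F -> Rabs b <= F -> 3 / 2 <= modz x y ->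
  hyp (x + rho * a) (y + rho * b) + hyp (x + rho * - a) (y + rho * - b) +
  hyp (x + rho * - b) (y + rho * a) + hyp (x + rho * b) (y + rho * - a) >=
  4 * hyp x y + rho ^ 2 * (a ^ 2 + b ^ 2) * exp (2 * hyp x y) - 80000 * F ^ 3 * rho ^ 3.
Proof.
  intros HF Hr HFr Ha Hb Hxy.
  assert (Ha' : Rabs (- a) <= F) by now rewrite Rabs_Ropp.
  assert (Hb' : Rabs (- b) <= F) by now rewrite Rabs_Ropp.
  pose proof (modz_sqr x y) as Hsq. pose proof (ln_modz_bound x y Hxy) as Hln.
  destruct (hyp_displaced F x y a b rho) as (M1 & M2 & E1); auto.
  destruct (hyp_displaced F x y (- a) (- b) rho) as (_ & _ & E2); auto.
  destruct (hyp_displaced F x y (- b) a rho) as (_ & _ & E3); auto.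
  destruct (hyp_displaced F x y b (- a) rho) as (_ & _ & E4); auto.
  assert (Hn : x ^ 2 + y ^ 2 <> 0) by nra.
  set (m1 := (a * x + b * y) / (x ^ 2 + y ^ 2)) in *.
  set (m2 := (b * x - a * y) / (x ^ 2 + y ^ 2)) in *.
  set (l := 2 * ln (modz x y)) in *.
  replace ((- a * x + - b * y) / (x ^ 2 + y ^ 2)) with (- m1) in E2 by (unfold m1; field; auto).
  replace ((- b * x - - a * y) / (x ^ 2 + y ^ 2)) with (- m2) in E2 by (unfold m2; field; auto).
  replace ((- b * x + a * y) / (x ^ 2 + y ^ 2)) with (- m2) in E3 by (unfold m2; field; auto).
  replace ((a * x - - b * y) / (x ^ 2 + y ^ 2)) with m1 in E3 by (unfold m1; field; auto).
  replace ((b * x + - a * y) / (x ^ 2 + y ^ 2)) with m2 in E4 by (unfold m2; field; auto).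
  replace ((- a * x - b * y) / (x ^ 2 + y ^ 2)) with (- m1) in E4 by (unfold m1; field; auto).
  assert (Hpm : forall p q, lnc rho p (- q) = lnc rho p q).
  { intros p q. unfold lnc. replace ((- q) ^ 2) with (q ^ 2) by ring. reflexivity. }
  rewrite Hpm in E2, E4.
  pose proof (lnc_sum (2 * F) rho m1 m2 ltac:(lra) Hr ltac:(lra) M1 M2) as HS.
  assert (Hl : 1 / 2 <= l) by (unfold l; lra).
  assert (Hil : 0 < / l <= 2).
  { split; [apply Rinv_0_lt_compat; lra|]. replace 2 with (/ (1 / 2)) by field.
    apply Rinv_le_contravar; lra. }
  assert (0 <= F ^ 3 * rho ^ 3) by (apply Rmult_le_pos; apply pow_le; lra).
  assert (HS' : (1 / 2 + / l) * (lnc rho m1 m2 + lnc rho (- m1) m2 + lnc rho (- m2) m1 + lnc rho m2 m1)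
    <= (5 / 2) * (216 * (2 * F) ^ 3 * rho ^ 3)) by nra.
  assert (HE : rho ^ 2 * (a ^ 2 + b ^ 2) * exp (2 * hyp x y) =
    2 * rho ^ 2 * m1 ^ 2 / l ^ 2 + 2 * rho ^ 2 * (- m1) ^ 2 / l ^ 2 +
    2 * rho ^ 2 * (- m2) ^ 2 / l ^ 2 + 2 * rho ^ 2 * m2 ^ 2 / l ^ 2).
  { replace (exp (2 * hyp x y)) with (/ ((x ^ 2 + y ^ 2) * (ln (modz x y) * ln (modz x y)))).
    - unfold m1, m2, l. field. repeat split; try exact Hn; lra.
    - unfold hyp. rewrite <- Hsq.
      replace (2 * - ln (modz x y * ln (modz x y))) with
        (- (ln (modz x y * ln (modz x y)) + ln (modz x y * ln (modz x y)))) by ring.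
      rewrite exp_Ropp, exp_plus, exp_ln; [f_equal; ring|]. apply Rmult_lt_0_compat; lra. }
  rewrite HE. nra.
Qed.

(** The space remainder contributes 8 and the time remainder 1 to the constant; in the coarser bound
    the quadratic part adds 2 and the time derivative 1/4. The number 12 covers both cases. *)
Lemma increment_bounds (T : R) (u : F3) (D : list dir -> F3) (W B F t x y rho a b : R) :
  smooth_family T u D -> bounded_order T W B 3 D -> 0 <= B -> 1 <= F ->
  0 < rho -> rho <= 1 -> 0 < t - rho ^ 2 / 4 -> t < T ->
  Rabs a <= F -> Rabs b <= F -> Rabs x + rho * F <= W -> Rabs y + rho * F <= W ->
  Rabs (D nil (t - rho ^ 2 / 4) (x + rho * a) (y + rho * b) - D nil t x y
    - rho * (a * D (Dx :: nil) t x y + b * D (Dy :: nil) t x y)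
    - rho ^ 2 * (a ^ 2 / 2 * D (Dx :: Dx :: nil) t x y + a * b * D (Dy :: Dx :: nil) t x y
       + b ^ 2 / 2 * D (Dy :: Dy :: nil) t x y)
    + rho ^ 2 / 4 * D (Dt :: nil) t x y) <= 12 * B * F ^ 3 * rho ^ 3 /\
  Rabs (D nil (t - rho ^ 2 / 4) (x + rho * a) (y + rho * b) - D nil t x y
    - rho * (a * D (Dx :: nil) t x y + b * D (Dy :: nil) t x y)) <= 12 * B * F ^ 3 * rho ^ 2.
Proof.
  intros Hu HB HB0 HF Hr Hr1 Ht HtT Ha Hb Hx Hy.
  assert (Hra : Rabs (rho * a) <= rho * F).
  { rewrite Rabs_mult, (Rabs_right rho) by lra. nra. }
  assert (Hrb : Rabs (rho * b) <= rho * F).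
  { rewrite Rabs_mult, (Rabs_right rho) by lra. nra. }
  assert (Hh : 0 < rho ^ 2 / 4) by nra.
  pose proof (space_taylor T u D W B t x y (rho * a) (rho * b) Hu HB HB0 ltac:(lra) ltac:(lra) ltac:(lra)) as E1.
  pose proof (time_taylor T u D W B t (rho ^ 2 / 4) x y (rho * a) (rho * b) Hu HB HB0 ltac:(lra)
    Ht HtT ltac:(lra) ltac:(lra)) as E2.
  pose proof (Rabs_pos (rho * a)). pose proof (Rabs_pos (rho * b)).
  assert (HF3 : F <= F ^ 3 /\ 1 <= F ^ 3 /\ F ^ 2 <= F ^ 3) by (simpl; nra).
  destruct HF3 as (HFa & HFb & HFc).
  assert (Hr3 : 0 < rho ^ 3) by (apply pow_lt; lra).
  assert (Hr23 : rho ^ 3 <= rho ^ 2) by (simpl; nra).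
  assert (B1 : B * (Rabs (rho * a) + Rabs (rho * b)) ^ 3 <= 8 * (B * F ^ 3 * rho ^ 3)).
  { replace (8 * (B * F ^ 3 * rho ^ 3)) with (B * (2 * (rho * F)) ^ 3) by ring.
    apply Rmult_le_compat_l; [exact HB0|]. apply pow_incr. lra. }
  assert (B2 : rho ^ 2 / 4 * (B * (rho ^ 2 / 4 + Rabs (rho * a) + Rabs (rho * b))) <= B * F ^ 3 * rho ^ 3).
  { replace (B * F ^ 3 * rho ^ 3) with (rho ^ 2 / 4 * (B * (4 * (F ^ 3 * rho)))) by field.
    apply Rmult_le_compat_l; [lra|]. apply Rmult_le_compat_l; [exact HB0|].
    assert (rho * F <= F ^ 3 * rho) by nra. assert (rho ^ 2 <= rho) by nra.
    assert (rho <= F ^ 3 * rho) by nra. lra. }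
  set (U' := D nil (t - rho ^ 2 / 4) (x + rho * a) (y + rho * b)) in *.
  set (U1 := D nil t (x + rho * a) (y + rho * b)) in *.
  set (U0 := D nil t x y) in *.
  pose proof (HB (Dx :: Dx :: nil) ltac:(simpl; lia) t x y ltac:(lra)) as Bxx.
  pose proof (HB (Dy :: Dx :: nil) ltac:(simpl; lia) t x y ltac:(lra)) as Byx.
  pose proof (HB (Dy :: Dy :: nil) ltac:(simpl; lia) t x y ltac:(lra)) as Byy.
  pose proof (HB (Dt :: nil) ltac:(simpl; lia) t x y ltac:(lra)) as Bt.
  assert (Hxw : Rabs x <= W) by nra. assert (Hyw : Rabs y <= W) by nra.
  specialize (Bxx Hxw Hyw). specialize (Byx Hxw Hyw). specialize (Byy Hxw Hyw). specialize (Bt Hxw Hyw).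
  set (ux := D (Dx :: nil) t x y) in *. set (uy := D (Dy :: nil) t x y) in *.
  set (uxx := D (Dx :: Dx :: nil) t x y) in *. set (uyx := D (Dy :: Dx :: nil) t x y) in *.
  set (uyy := D (Dy :: Dy :: nil) t x y) in *. set (ut := D (Dt :: nil) t x y) in *.
  set (Q := a ^ 2 / 2 * uxx + a * b * uyx + b ^ 2 / 2 * uyy).
  assert (Hmain : Rabs (U' - U0 - rho * (a * ux + b * uy) - rho ^ 2 * Q + rho ^ 2 / 4 * ut)
    <= 9 * (B * F ^ 3 * rho ^ 3)).
  { match type of E1 with Rabs ?e1 <= _ => match type of E2 with Rabs ?e2 <= _ =>
      replace (U' - U0 - rho * (a * ux + b * uy) - rho ^ 2 * Q + rho ^ 2 / 4 * ut) with (e1 + e2)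
      by (unfold Q; field) end end.
    eapply Rle_trans; [apply Rabs_triang|]. lra. }
  assert (HBF : 0 <= B * F ^ 3 * rho ^ 3) by (apply Rmult_le_pos; [nra|lra]).
  split; [lra|].
  assert (HQ : Rabs Q <= 2 * F ^ 3 * B).
  { assert (Ha2 : a ^ 2 <= F ^ 2) by (rewrite <- (pow2_abs a); apply pow_incr; split; [apply Rabs_pos|auto]).
    assert (Hb2 : b ^ 2 <= F ^ 2) by (rewrite <- (pow2_abs b); apply pow_incr; split; [apply Rabs_pos|auto]).
    unfold Q. eapply Rle_trans; [apply Rabs_triang|].
    assert (Rabs (a ^ 2 / 2 * uxx + a * b * uyx) <= F ^ 2 / 2 * B + F * F * B).
    { eapply Rle_trans; [apply Rabs_triang|]. apply Rplus_le_compat.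
      - rewrite Rabs_mult. apply Rmult_le_compat; try apply Rabs_pos; auto.
        rewrite Rabs_right; pose proof (pow2_ge_0 a); lra.
      - rewrite !Rabs_mult. apply Rmult_le_compat; auto; try apply Rabs_pos.
        + apply Rmult_le_pos; apply Rabs_pos.
        + apply Rmult_le_compat; auto; apply Rabs_pos. }
    assert (Rabs (b ^ 2 / 2 * uyy) <= F ^ 2 / 2 * B).
    { rewrite Rabs_mult. apply Rmult_le_compat; try apply Rabs_pos; auto.
      rewrite Rabs_right; pose proof (pow2_ge_0 b); lra. }
    nra. }
  match type of Hmain with Rabs ?e <= _ =>
    replace (U' - U0 - rho * (a * ux + b * uy)) with (e + (rho ^ 2 * Q + - (rho ^ 2 / 4 * ut))) by ring end.
  eapply Rle_trans; [apply Rabs_triang|].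
  assert (Rabs (rho ^ 2 * Q + - (rho ^ 2 / 4 * ut)) <= rho ^ 2 * (2 * F ^ 3 * B) + rho ^ 2 / 4 * B).
  { apply Rabs_le_split.
    - rewrite Rabs_mult, (Rabs_right (rho ^ 2)) by nra. apply Rmult_le_compat_l; [nra|exact HQ].
    - rewrite Rabs_Ropp, Rabs_mult, (Rabs_right (rho ^ 2 / 4)) by lra.
      apply Rmult_le_compat_l; [lra|exact Bt]. }
  assert (B * F ^ 3 * rho ^ 3 <= B * F ^ 3 * rho ^ 2) by (apply Rmult_le_compat_l; [nra|exact Hr23]).
  assert (rho ^ 2 * B <= B * F ^ 3 * rho ^ 2).
  { replace (B * F ^ 3 * rho ^ 2) with (rho ^ 2 * B * F ^ 3) by ring.
    assert (0 <= rho ^ 2 * B) by (apply Rmult_le_pos; lra). nra. }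
  lra.
Qed.

(** * Variation of curves by parallel fields *)

Lemma chain_rule2 (v vx vy : R -> R -> R) (c : curve) (s : R) :
  cont2 vx -> (forall x y, is_derive (fun z => v z y) x (vx x y)) ->
  (forall x y, is_derive (fun z => v x z) y (vy x y)) ->
  is_derive (fun s => v (cx c s) (cy c s)) s
    (vx (cx c s) (cy c s) * cdx c s + vy (cx c s) (cy c s) * cdy c s).
Proof.
  intros Hc Hx Hy. apply is_derive_Reals, derivable_pt_lim_comp_2d;
    [|apply is_derive_Reals, cx_derive|apply is_derive_Reals, cy_derive].
  apply filterdiff_differentiable_pt_lim.
  apply (is_derive_filterdiff v _ _ vx); auto.
  - apply filter_forall. intros [x y]. apply Hx.
  - apply filterlim_locally. intros eps.
    destruct (Hc (cx c s) (cy c s) eps (cond_pos eps)) as [d [Hd Hd']].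
    exists (mkposreal d Hd). intros [x y] [H1 H2]. apply (Hd' x y); [apply H1|apply H2].
Qed.

Lemma is_derive_Rmult (f g : R -> R) (s df dg : R) :
  is_derive f s df -> is_derive g s dg ->
  is_derive (fun r => f r * g r) s (df * g s + f s * dg).
Proof. intros Hf Hg. apply (is_derive_mult f g s df dg Hf Hg). exact Rmult_comm. Qed.

Lemma continuity_compose (f g : R -> R) :
  continuity f -> continuity g -> continuity (fun s => f (g s)).
Proof. intros Hf Hg. apply (continuity_comp g f Hg Hf). Qed.

(** The profile is [1 - (1 - s / b)^2] up to [b], then 1. It is chosen for [1 - chi^2 <= b * dchi]:
    every error caused by the cutoff becomes a multiple of [dchi], whose integral along the arc
    length is just the total increase 1 of [chi]. *)
Lemma cutoff (b : R) : 0 < b -> exists chi dchi : R -> R,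
  (forall s, is_derive chi s (dchi s)) /\ continuity dchi /\ chi 0 = 0 /\
  forall s, 0 <= s -> 0 <= dchi s <= 2 / b /\ 0 <= chi s <= 1 /\
    1 - chi s ^ 2 <= b * dchi s /\ (b <= s -> chi s = 1 /\ dchi s = 0).
Proof.
  intros Hb.
  set (dchi := fun s => 2 / b * Rmax 0 (1 - s / b)).
  assert (Hib : 0 < / b) by (apply Rinv_0_lt_compat, Hb).
  assert (Hc : continuity dchi).
  { intros s. apply continuity_pt_mult; [apply continuity_cst|].
    apply (continuity_pt_comp (fun s => 1 - s / b) (fun r => Rmax 0 r)).
    - apply (is_derive_continuity_pt _ _ (- / b)). auto_derive; [trivial|]. field. lra.
    - apply continuity_pt_eps. intros eps He.
      exists eps. split; [exact He|]. intros y Hy. unfold Rmax.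
      apply Rabs_def2 in Hy. apply Rabs_def1; repeat destruct Rle_dec; lra. }
  destruct (antiderivative_exists dchi Hc) as [chi [H0 Hchi]].
  exists chi, dchi. split; [exact Hchi|]. split; [exact Hc|]. split; [exact H0|].
  assert (Hin : forall s, 0 <= s <= b -> dchi s = 2 / b * (1 - s / b)).
  { intros s Hs. unfold dchi. f_equal. apply Rmax_right.
    assert (s / b <= 1) by (apply Rle_div_l; lra). lra. }
  assert (Hout : forall s, b <= s -> dchi s = 0).
  { intros s Hs. unfold dchi. rewrite Rmax_left; [ring|].
    assert (1 <= s / b) by (apply Rle_div_r; lra). lra. }
  assert (Hd : forall x, is_derive (fun s => 1 - (1 - s / b) ^ 2) x (2 / b * (1 - x / b)))
    by (intros x; auto_derive; [trivial|field; lra]).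
  assert (Ein : forall s, 0 <= s <= b -> chi s = 1 - (1 - s / b) ^ 2).
  { intros s Hs.
    pose proof (le_of_derive _ _ _ _ 0 s ltac:(lra) Hchi Hd
      (fun x Hx => Req_le _ _ (Hin x ltac:(lra)))).
    pose proof (le_of_derive _ _ _ _ 0 s ltac:(lra) Hd Hchi
      (fun x Hx => Req_le _ _ (eq_sym (Hin x ltac:(lra))))).
    simpl in H, H1. unfold Rdiv in H, H1 |- *. rewrite Rmult_0_l in H, H1. simpl. lra. }
  assert (Eb : chi b = 1).
  { rewrite Ein by lra. field. lra. }
  assert (Eout : forall s, b <= s -> chi s = 1).
  { intros s Hs. rewrite <- Eb.
    pose proof (le_of_derive (fun _ => 0) chi (fun _ => 0) _ b s Hs
      (fun x => is_derive_const 0 x) Hchi (fun x Hx => Req_le _ _ (eq_sym (Hout x (proj1 Hx))))).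
    pose proof (le_of_derive chi (fun _ => 0) _ (fun _ => 0) b s Hs Hchi
      (fun x => is_derive_const 0 x) (fun x Hx => Req_le _ _ (Hout x (proj1 Hx)))).
    simpl in *. lra. }
  intros s Hs. destruct (Rle_lt_dec b s) as [Hbs|Hbs].
  - rewrite (Eout s Hbs), (Hout s Hbs). unfold Rdiv. repeat split; nra.
  - rewrite (Ein s) by lra. rewrite (Hin s) by lra.
    assert (Hp : 0 <= s / b <= 1).
    { split; [apply Rdiv_le_0_compat; lra|apply Rle_div_l; lra]. }
    set (z := s / b) in *. unfold Rdiv.
    split; [|split; [|split]]; try nra.
    replace (b * (2 * / b * (1 - z))) with (2 * (1 - z)) by (field; lra).
    assert (0 <= (1 - z) * (1 - z) <= 1 - z) by nra.
    simpl. nra.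
Qed.

(* In complex notation, with [2 v_z = vx - i vy], the field is [chi (S s) * f0] with
   [f0 = exp (- v + i theta)] solving [f0' = - 2 v_z gamma' f0], i.e. parallel of unit length.
   Then [f' = m gamma'] with [m + 2 v_z f = a1 + i a2] of modulus [dchi (S s)]. *)
Lemma parallel_field (v vx vy : R -> R -> R) (c : curve) (S chi dchi : R -> R) :
  cont2 v -> cont2 vx -> cont2 vy ->
  (forall x y, is_derive (fun z => v z y) x (vx x y)) ->
  (forall x y, is_derive (fun z => v x z) y (vy x y)) ->
  arclength v c S ->
  (forall s, is_derive chi s (dchi s)) -> continuity dchi -> chi 0 = 0 ->
  exists fx fy dfx dfy : R -> R,
    (forall s, is_derive fx s (dfx s)) /\ (forall s, is_derive fy s (dfy s)) /\
    continuity dfx /\ continuity dfy /\ fx 0 = 0 /\ fy 0 = 0 /\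
    (forall s, fx s ^ 2 + fy s ^ 2 = chi (S s) ^ 2 * exp (- 2 * v (cx c s) (cy c s))) /\
    forall s, exists a1 a2, a1 ^ 2 + a2 ^ 2 = dchi (S s) ^ 2 /\
      let m1 := a1 - (fx s * vx (cx c s) (cy c s) + fy s * vy (cx c s) (cy c s)) in
      let m2 := a2 - (fy s * vx (cx c s) (cy c s) - fx s * vy (cx c s) (cy c s)) in
      dfx s = m1 * cdx c s - m2 * cdy c s /\ dfy s = m1 * cdy c s + m2 * cdx c s.
Proof.
  intros Hv Hvx Hvy Dx' Dy' HS Hchi Hdchi Hchi0.
  set (X := cdx c). set (Y := cdy c).
  set (gx := fun s => vx (cx c s) (cy c s)). set (gy := fun s => vy (cx c s) (cy c s)).
  assert (Cgx : continuity gx) by (apply cont2_comp; auto using cx_cont, cy_cont).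
  assert (Cgy : continuity gy) by (apply cont2_comp; auto using cx_cont, cy_cont).
  assert (CX : continuity X) by apply cdx_cont. assert (CY : continuity Y) by apply cdy_cont.
  (* The angle [th] has as derivative the imaginary part of [- 2 v_z gamma']; the real part is
     accounted for by the factor [exp (- v)]. *)
  destruct (antiderivative_exists (fun s => gy s * X s - gx s * Y s)) as [th [_ Hth]].
  { apply continuity_minus; apply continuity_mult; assumption. }
  set (E := fun s => exp (- v (cx c s) (cy c s))).
  set (sp := fun s => exp (v (cx c s) (cy c s)) * modz (X s) (Y s)).
  set (a := fun s => chi (S s)). set (da := fun s => dchi (S s) * sp s).
  assert (Ha : forall s, is_derive a s (da s)).
  { intros s. unfold a, da. rewrite Rmult_comm.
    apply (is_derive_comp chi S); [apply Hchi|apply HS]. }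
  assert (HE : forall s, is_derive E s (- (gx s * X s + gy s * Y s) * E s)).
  { intros s. unfold E. apply (is_derive_comp exp (fun s => - v (cx c s) (cy c s))).
    - apply is_derive_exp.
    - apply @is_derive_opp. apply chain_rule2; auto. }
  assert (CS : continuity S) by (intros s; eapply is_derive_continuity_pt, HS).
  assert (Ca : continuity a) by (intros s; eapply is_derive_continuity_pt, Ha).
  assert (CE : continuity E) by (intros s; eapply is_derive_continuity_pt, HE).
  assert (Cth : continuity th) by (intros s; eapply is_derive_continuity_pt, Hth).
  assert (Cc : continuity (fun s => cos (th s))) by (apply continuity_compose; auto using continuity_cos).
  assert (Cs : continuity (fun s => sin (th s))) by (apply continuity_compose; auto using continuity_sin).
  assert (Cda : continuity da).
  { apply continuity_mult; [apply (continuity_compose dchi S); auto|apply speed_cont, Hv]. }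
  assert (Hcos : forall s, is_derive (fun s => cos (th s)) s
    ((gy s * X s - gx s * Y s) * - sin (th s))).
  { intros s. apply (is_derive_comp cos th); [apply is_derive_cos|apply Hth]. }
  assert (Hsin : forall s, is_derive (fun s => sin (th s)) s
    ((gy s * X s - gx s * Y s) * cos (th s))).
  { intros s. apply (is_derive_comp sin th); [apply is_derive_sin|apply Hth]. }
  set (w := fun s => - (gx s * X s + gy s * Y s)). set (q := fun s => gy s * X s - gx s * Y s).
  assert (Cw : continuity w)
    by (apply continuity_opp, continuity_plus; apply continuity_mult; assumption).
  assert (Cq : continuity q) by (apply continuity_minus; apply continuity_mult; assumption).
  set (P := fun s => a s * E s * cos (th s)). set (Q := fun s => a s * E s * sin (th s)).
  set (dP := fun s => da s * E s * cos (th s) + (w s * P s - q s * Q s)).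
  set (dQ := fun s => da s * E s * sin (th s) + (w s * Q s + q s * P s)).
  assert (CP : continuity P) by (unfold P; repeat apply continuity_mult; assumption).
  assert (CQ : continuity Q) by (unfold Q; repeat apply continuity_mult; assumption).
  assert (CdE : continuity (fun s => da s * E s)) by (apply (continuity_mult da E); assumption).
  exists P, Q, dP, dQ. split; [|split; [|split; [|split; [|split; [|split; [|split]]]]]].
  - intros s. unfold P, dP.
    replace (_ + _) with ((da s * E s + a s * (w s * E s)) * cos (th s) +
      (a s * E s) * (q s * - sin (th s))) by (unfold P, Q; ring).
    apply (is_derive_Rmult (fun s => a s * E s) (fun s => cos (th s))); [|apply Hcos].
    apply (is_derive_Rmult a E); [apply Ha|apply HE].
  - intros s. unfold Q, dQ.
    replace (_ + _) with ((da s * E s + a s * (w s * E s)) * sin (th s) +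
      (a s * E s) * (q s * cos (th s))) by (unfold P, Q; ring).
    apply (is_derive_Rmult (fun s => a s * E s) (fun s => sin (th s))); [|apply Hsin].
    apply (is_derive_Rmult a E); [apply Ha|apply HE].
  - apply continuity_plus; [apply (continuity_mult _ _ CdE Cc)|].
    apply continuity_minus; apply continuity_mult; assumption.
  - apply continuity_plus; [apply (continuity_mult _ _ CdE Cs)|].
    apply continuity_plus; apply continuity_mult; assumption.
  - unfold P, a. rewrite (proj1 HS), Hchi0. ring.
  - unfold Q, a. rewrite (proj1 HS), Hchi0. ring.
  - intros s. unfold P, Q.
    replace (exp (-2 * v (cx c s) (cy c s))) with (E s * E s)
      by (unfold E; rewrite <- exp_plus; f_equal; ring).
    fold (a s). pose proof (sin2_cos2 (th s)) as H. unfold Rsqr in H.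
    replace ((a s * E s * cos (th s)) ^ 2 + (a s * E s * sin (th s)) ^ 2) with
      (a s ^ 2 * (E s * E s) * (sin (th s) * sin (th s) + cos (th s) * cos (th s))) by ring.
    rewrite H. ring.
  - intros s. fold (gx s) (gy s) (X s) (Y s).
    pose proof (modz_sqr (X s) (Y s)) as Hn.
    pose proof (sin2_cos2 (th s)) as Hsc. unfold Rsqr in Hsc.
    assert (HEs : E s * exp (v (cx c s) (cy c s)) = 1).
    { unfold E. rewrite <- exp_plus, Rplus_opp_l. apply exp_0. }
    destruct (Req_dec (modz (X s) (Y s)) 0) as [Hz|Hz].
    (* Where the curve stands still the field does too, so any [a1 + i a2] of the right modulus will
       do. *)
    + exists (dchi (S s)), 0. split; [ring|].
      rewrite Hz, Rmult_0_l in Hn.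
      assert (HX : X s = 0) by nra. assert (HY : Y s = 0) by nra.
      unfold dP, dQ, da, sp, w, q. rewrite Hz, HX, HY. split; ring.
    + set (n := modz (X s) (Y s)) in *.
      assert (Hda : da s * E s = dchi (S s) * n).
      { unfold da, sp. fold n.
        replace (dchi (S s) * (exp (v (cx c s) (cy c s)) * n) * E s) with
          (dchi (S s) * n * (E s * exp (v (cx c s) (cy c s)))) by ring.
        rewrite HEs. ring. }
      (* This is [dchi] times [exp (i th)] times the conjugate of [gamma' / |gamma'|], so that its
         product with [gamma'] is the part of the derivative coming from the cutoff. *)
      exists (dchi (S s) * ((cos (th s) * X s + sin (th s) * Y s) / n)),
        (dchi (S s) * ((sin (th s) * X s - cos (th s) * Y s) / n)).
      split.
      * replace (_ + _) with (dchi (S s) ^ 2 *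
          ((sin (th s) * sin (th s) + cos (th s) * cos (th s)) * (X s ^ 2 + Y s ^ 2)) / (n * n))
          by (field; auto).
        rewrite Hsc, <- Hn. field. auto.
      * unfold dP, dQ. rewrite Hda. unfold w, q.
        split; [transitivity (dchi (S s) * cos (th s) * ((X s ^ 2 + Y s ^ 2) / n) +
          (- (gx s * X s + gy s * Y s) * P s - (gy s * X s - gx s * Y s) * Q s))
          | transitivity (dchi (S s) * sin (th s) * ((X s ^ 2 + Y s ^ 2) / n) +
          (- (gx s * X s + gy s * Y s) * Q s + (gy s * X s - gx s * Y s) * P s))];
        try (rewrite <- Hn; field; auto); field; auto.
Qed.

(** The content of [ricci_flow] with the family of derivatives exposed, so that estimates can refer
    to it. *)
Definition solves (T : R) (u : F3) (D : list dir -> F3) : Prop :=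
  smooth_family T u D /\
  forall t x y, 0 <= t <= T ->
    D (Dt :: nil) t x y =
      exp (-2 * u t x y) * (D (Dx :: Dx :: nil) t x y + D (Dy :: Dy :: nil) t x y).

(* With step [rho] in space the time step is [rho ^ 2 / 4]: this matches the heat operator, since
   the mean of the four increments [+-rho (a, b)], [+-rho (- b, a)] is
   [rho ^ 2 / 4 * (a ^ 2 + b ^ 2)] times the Laplacian. *)
Lemma four_increments (T : R) (u : F3) (D : list dir -> F3) (W B F t x y rho a b k : R) :
  solves T u D -> bounded_order T W B 3 D -> 0 <= B -> 1 <= F ->
  0 < rho -> rho <= 1 -> 0 < t - rho ^ 2 / 4 -> t < T ->
  Rabs a <= F -> Rabs b <= F -> Rabs x + rho * F <= W -> Rabs y + rho * F <= W ->
  a ^ 2 + b ^ 2 = k * exp (- 2 * u t x y) ->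
  let d p q := u (t - rho ^ 2 / 4) (x + rho * p) (y + rho * q) - u t x y in
  Rabs (d a b + d (- a) (- b) + d (- b) a + d b (- a)
    - rho ^ 2 * ((k - 1) * D (Dt :: nil) t x y)) <= 48 * B * F ^ 3 * rho ^ 3 /\
  (forall p q, Rabs p <= F -> Rabs q <= F ->
    Rabs (d p q - rho * (p * D (Dx :: nil) t x y + q * D (Dy :: nil) t x y))
      <= 12 * B * F ^ 3 * rho ^ 2).
Proof.
  intros [Hu Hpde] HB HB0 HF Hr Hr1 Ht HtT Ha Hb Hx Hy Hk d.
  assert (Hinc := fun p q Hp Hq =>
    increment_bounds T u D W B F t x y rho p q Hu HB HB0 HF Hr Hr1 Ht HtT Hp Hq Hx Hy).
  rewrite (proj1 Hu) in Hinc.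
  split; [|intros p q Hp Hq; apply (Hinc p q Hp Hq)].
  assert (Ha' : Rabs (- a) <= F) by now rewrite Rabs_Ropp.
  assert (Hb' : Rabs (- b) <= F) by now rewrite Rabs_Ropp.
  destruct (Hinc a b Ha Hb) as [E1 _]. destruct (Hinc (- a) (- b) Ha' Hb') as [E2 _].
  destruct (Hinc (- b) a Hb' Ha) as [E3 _]. destruct (Hinc b (- a) Hb Ha') as [E4 _].
  clear Hinc. unfold d. clear d.
  specialize (Hpde t x y ltac:(nra)).
  assert (HS : (k - 1) * D (Dt :: nil) t x y =
    (a ^ 2 + b ^ 2) * (D (Dx :: Dx :: nil) t x y + D (Dy :: Dy :: nil) t x y) - D (Dt :: nil) t x y).
  { rewrite Hk. rewrite Hpde. ring. }
  rewrite HS.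
  match type of E1 with Rabs ?e1 <= _ => match type of E2 with Rabs ?e2 <= _ =>
  match type of E3 with Rabs ?e3 <= _ => match type of E4 with Rabs ?e4 <= _ =>
    match goal with |- Rabs ?e <= _ => replace e with (e1 + e2 + e3 + e4) by field end
  end end end end.
  replace (48 * B * F ^ 3 * rho ^ 3) with (12 * B * F ^ 3 * rho ^ 3 + 12 * B * F ^ 3 * rho ^ 3
    + 12 * B * F ^ 3 * rho ^ 3 + 12 * B * F ^ 3 * rho ^ 3) by ring.
  repeat apply Rabs_le_split; assumption.
Qed.

Lemma modz_rotate (X Y m1 m2 rho : R) :
  0 < 1 + (2 * rho * m1 + rho ^ 2 * (m1 ^ 2 + m2 ^ 2)) ->
  modz (X + rho * (m1 * X - m2 * Y)) (Y + rho * (m1 * Y + m2 * X)) =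
    modz X Y * exp (lnc rho m1 m2 / 2).
Proof.
  intros Hpos.
  assert (0 <= modz X Y * exp (lnc rho m1 m2 / 2))
    by (apply Rmult_le_pos; [apply modz_pos|left; apply exp_pos]).
  unfold modz at 1. rewrite <- (sqrt_Rsqr (modz X Y * exp (lnc rho m1 m2 / 2))) by assumption.
  f_equal. unfold Rsqr.
  replace (modz X Y * exp (lnc rho m1 m2 / 2) * (modz X Y * exp (lnc rho m1 m2 / 2)))
    with ((modz X Y * modz X Y) * (exp (lnc rho m1 m2 / 2) * exp (lnc rho m1 m2 / 2))) by ring.
  rewrite <- exp_plus. replace (lnc rho m1 m2 / 2 + lnc rho m1 m2 / 2) with (lnc rho m1 m2) by field.
  rewrite modz_sqr. unfold lnc. rewrite exp_ln by exact Hpos. ring.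
Qed.

(* The constant of [exp_four_points], where C collects the errors of [four_increments], [lnc_linear]
   and [lnc_sum]. *)
Definition err (B F M A : R) : R :=
  let C := 48 * B * F ^ 3 + 10 * M ^ 2 + 108 * M ^ 3 in
  C + 4 * ((A + C) ^ 2 + 3 * (A + C) ^ 3).

(** Displacing by a field [f] with [f' = m gamma'] multiplies the speed by the exponential of the
    increment of [u] plus half of [lnc]. To first order this exponent is [rho * a1], where
    [a1 + i a2 = m + 2 u_z f], so the parallel part drops out. Multiplying [f] by [-1], [i], [-i]
    multiplies [m] and [a1 + i a2] alike. The sum of the four exponents comes from [four_increments]
    and [lnc_sum], and [exp_four_points] adds the squares. The individual bounds are kept for the
    quadratic error in [log_four_points]. *)
Lemma speed_four_points (T : R) (u : F3) (D : list dir -> F3) (W B F M A t x y rho a b k : R)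
    (X Y a1 a2 : R) :
  solves T u D -> bounded_order T W B 3 D -> 0 <= B -> 1 <= F ->
  0 < rho -> rho <= 1 -> 0 < t - rho ^ 2 / 4 -> t < T ->
  Rabs a <= F -> Rabs b <= F -> Rabs x + rho * F <= W -> Rabs y + rho * F <= W ->
  a ^ 2 + b ^ 2 = k * exp (- 2 * u t x y) ->
  0 <= A -> Rabs a1 <= A -> Rabs a2 <= A -> M = A + 2 * B * F -> 8 * M * rho <= 1 ->
  err B F M A * rho <= 1 ->
  let m1 := a1 - (a * D (Dx :: nil) t x y + b * D (Dy :: nil) t x y) in
  let m2 := a2 - (b * D (Dx :: nil) t x y - a * D (Dy :: nil) t x y) in
  let da := m1 * X - m2 * Y in
  let db := m1 * Y + m2 * X in
  let N p q dp dq := exp (u (t - rho ^ 2 / 4) (x + rho * p) (y + rho * q)) *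
                     modz (X + rho * dp) (Y + rho * dq) in
  let N0 := exp (u t x y) * modz X Y in
  N a b da db + N (- a) (- b) (- da) (- db) + N (- b) a (- db) da + N b (- a) db (- da) <=
    N0 * (4 + rho ^ 2 * ((k - 1) * D (Dt :: nil) t x y + (a1 ^ 2 + a2 ^ 2)) + err B F M A * rho ^ 3) /\
  (forall p q dp dq, (p, q, dp, dq) = (a, b, da, db) \/ (p, q, dp, dq) = (- a, - b, - da, - db) \/
     (p, q, dp, dq) = (- b, a, - db, da) \/ (p, q, dp, dq) = (b, - a, db, - da) ->
     Rabs (N p q dp dq - N0) <= N0 * (rho * sqrt (a1 ^ 2 + a2 ^ 2) + err B F M A * rho ^ 2)).
Proof.
  intros Hsol HB HB0 HF Hr Hr1 Ht HtT Ha Hb Hx Hy Hk HA Ha1 Ha2 HM HMr Her m1 m2 da db N N0.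
  destruct (four_increments T u D W B F t x y rho a b k) as [Hsum Hlin]; auto.
  set (C := 48 * B * F ^ 3 + 10 * M ^ 2 + 108 * M ^ 3).
  assert (HF3 : 0 < F ^ 3) by (apply pow_lt; lra).
  assert (HBF0 : 0 <= B * F ^ 3) by nra.
  assert (HBF : 0 <= B * F) by nra.
  assert (HM0 : 0 <= M) by lra.
  assert (HM3 : 0 <= M ^ 3) by (apply pow_le; lra).
  assert (HM2 : 0 <= M ^ 2) by (apply pow_le; lra).
  assert (HC : 0 <= C) by (unfold C; lra).
  assert (HG2 : 0 <= (A + C) ^ 2) by (apply pow_le; lra).
  assert (HG3 : 0 <= (A + C) ^ 3) by (apply pow_le; lra).
  assert (HerrE : err B F M A = C + 4 * ((A + C) ^ 2 + 3 * (A + C) ^ 3)) by reflexivity.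
  set (K := err B F M A) in *.
  (* If [G * rho > 1] then [G > 1], hence [G <= G^3 <= K], against [K * rho <= 1]. *)
  assert (HK1 : (A + C) * rho <= 1).
  { set (G := A + C) in *. assert (HG0 : 0 <= G) by (unfold G; lra).
    destruct (Rle_lt_dec (G * rho) 1) as [|Hgt]; [assumption|].
    assert (HG1 : 1 < G) by nra. assert (G <= G ^ 3) by (simpl; nra).
    assert (G <= K) by lra. nra. }
  set (ux := D (Dx :: nil) t x y) in *. set (uy := D (Dy :: nil) t x y) in *.
  set (ut := D (Dt :: nil) t x y) in *.
  assert (Hxw : Rabs x <= W) by nra. assert (Hyw : Rabs y <= W) by nra.
  assert (Hux : Rabs ux <= B) by (apply HB; auto; simpl; lia || nra).
  assert (Huy : Rabs uy <= B) by (apply HB; auto; simpl; lia || nra).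
  assert (Hg : forall p q, Rabs p <= F -> Rabs q <= F -> Rabs (p * ux + q * uy) <= 2 * B * F).
  { intros p q Hp Hq. replace (2 * B * F) with (F * B + F * B) by ring.
    apply Rabs_le_split; rewrite Rabs_mult; apply Rmult_le_compat; auto; apply Rabs_pos. }
  assert (Ha' : Rabs (- a) <= F) by now rewrite Rabs_Ropp.
  assert (Hb' : Rabs (- b) <= F) by now rewrite Rabs_Ropp.
  assert (Hm1 : Rabs m1 <= M).
  { unfold m1, Rminus. rewrite HM. apply Rabs_le_split; [exact Ha1|]. rewrite Rabs_Ropp. auto. }
  assert (Hm2 : Rabs m2 <= M).
  { unfold m2. rewrite HM. replace (a2 - (b * ux - a * uy)) with (a2 + - (b * ux + - a * uy)) by ring.
    apply Rabs_le_split; [exact Ha2|]. rewrite Rabs_Ropp. auto. }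
  assert (Hm1' : Rabs (- m1) <= M) by now rewrite Rabs_Ropp.
  assert (Hm2' : Rabs (- m2) <= M) by now rewrite Rabs_Ropp.
  assert (HN : forall p q l1 l2 dp dq, Rabs l1 <= M -> Rabs l2 <= M ->
    dp = l1 * X - l2 * Y -> dq = l1 * Y + l2 * X ->
    N p q dp dq = N0 * exp ((u (t - rho ^ 2 / 4) (x + rho * p) (y + rho * q) - u t x y)
      + lnc rho l1 l2 / 2)).
  { intros p q l1 l2 dp dq Hl1 Hl2 -> ->. unfold N, N0.
    rewrite modz_rotate by (apply (lnc_linear M); auto).
    rewrite exp_plus. unfold Rminus. rewrite exp_plus, exp_Ropp. field.
    apply Rgt_not_eq, exp_pos. }
  set (d := fun p q => u (t - rho ^ 2 / 4) (x + rho * p) (y + rho * q) - u t x y) in *.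
  assert (Hx1 : forall p q l1 l2 al, Rabs p <= F -> Rabs q <= F -> Rabs l1 <= M -> Rabs l2 <= M ->
     l1 = al - (p * ux + q * uy) ->
     Rabs ((d p q + lnc rho l1 l2 / 2) - rho * al) <= C * rho ^ 2).
  { intros p q l1 l2 al Hp Hq Hl1 Hl2 El.
    destruct (lnc_linear M rho l1 l2) as (_ & L & _ & _); auto.
    specialize (Hlin p q Hp Hq).
    replace ((d p q + lnc rho l1 l2 / 2) - rho * al) with
      ((d p q - rho * (p * ux + q * uy)) + (lnc rho l1 l2 - rho * (2 * l1)) / 2)
      by (rewrite El; field).
    apply Rle_trans with (12 * B * F ^ 3 * rho ^ 2 + 10 * M ^ 2 * rho ^ 2).
    - apply Rabs_le_split; [exact Hlin|]. unfold Rdiv. rewrite Rabs_mult, (Rabs_right (/ 2)) by lra. lra.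
    - rewrite <- Rmult_plus_distr_r. apply Rmult_le_compat_r; [apply pow2_ge_0|]. unfold C. lra. }
  pose proof (Hx1 a b m1 m2 a1 Ha Hb Hm1 Hm2 eq_refl) as X1.
  pose proof (Hx1 (- a) (- b) (- m1) m2 (- a1) Ha' Hb' Hm1' Hm2 ltac:(unfold m1; ring)) as X2.
  pose proof (Hx1 (- b) a (- m2) m1 (- a2) Hb' Ha Hm2' Hm1 ltac:(unfold m2; ring)) as X3.
  pose proof (Hx1 b (- a) m2 m1 a2 Hb Ha' Hm2 Hm1 ltac:(unfold m2; ring)) as X4.
  assert (Hpm : forall p q, lnc rho p (- q) = lnc rho p q).
  { intros p q. unfold lnc. replace ((- q) ^ 2) with (q ^ 2) by ring. reflexivity. }
  assert (E1 := HN a b m1 m2 da db Hm1 Hm2 eq_refl eq_refl).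
  assert (E2 := HN (- a) (- b) (- m1) (- m2) (- da) (- db) Hm1' Hm2' ltac:(unfold da; ring) ltac:(unfold db; ring)).
  assert (E3 := HN (- b) a (- m2) m1 (- db) da Hm2' Hm1 ltac:(unfold db; ring) ltac:(unfold da; ring)).
  assert (E4 := HN b (- a) m2 (- m1) db (- da) Hm2 Hm1' ltac:(unfold db; ring) ltac:(unfold da; ring)).
  rewrite Hpm in E2, E4.
  fold (d a b) in E1. fold (d (- a) (- b)) in E2. fold (d (- b) a) in E3. fold (d b (- a)) in E4.
  assert (HN0 : 0 <= N0) by (apply Rmult_le_pos; [left; apply exp_pos|apply modz_pos]).
  pose proof (lnc_sum M rho m1 m2 HM0 Hr HMr Hm1 Hm2) as HS.
  set (x1 := d a b + lnc rho m1 m2 / 2) in *.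
  set (x2 := d (- a) (- b) + lnc rho (- m1) m2 / 2) in *.
  set (x3 := d (- b) a + lnc rho (- m2) m1 / 2) in *.
  set (x4 := d b (- a) + lnc rho m2 m1 / 2) in *.
  assert (Ha1' : Rabs (- a1) <= A) by now rewrite Rabs_Ropp.
  assert (Ha2' : Rabs (- a2) <= A) by now rewrite Rabs_Ropp.
  split.
  - rewrite E1, E2, E3, E4, <- !Rmult_plus_distr_l.
    apply Rmult_le_compat_l; [exact HN0|].
    rewrite HerrE, <- Rplus_assoc.
    pose proof (exp_four_points A C x1 x2 x4 x3 a1 a2 ((k - 1) * ut) rho) as HE.
    assert (HSx : x1 + x2 + x4 + x3 <= rho ^ 2 * ((k - 1) * ut) + C * rho ^ 3).
    { apply Rabs_le_between in Hsum. fold (d a b) (d (- a) (- b)) (d (- b) a) (d b (- a)) in Hsum.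
      assert (0 <= M ^ 2 * rho ^ 3) by (apply Rmult_le_pos; [lra|apply pow_le; lra]).
      unfold x1, x2, x3, x4, C. lra. }
    specialize (HE HA HC Hr Hr1 HK1 Ha1 Ha2 X1 X2 X4 X3 HSx). lra.
  - assert (Hone : forall xx al, Rabs al <= A -> Rabs al <= sqrt (a1 ^ 2 + a2 ^ 2) ->
      Rabs (xx - rho * al) <= C * rho ^ 2 ->
      Rabs (N0 * exp xx - N0) <= N0 * (rho * sqrt (a1 ^ 2 + a2 ^ 2) + K * rho ^ 2)).
    { intros xx al Hal Hal' Hxx.
      destruct (exp_near_linear A C xx al rho) as (_ & _ & HE); auto.
      replace (N0 * exp xx - N0) with (N0 * (exp xx - 1)) by ring.
      rewrite Rabs_mult, (Rabs_right N0) by lra.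
      apply Rmult_le_compat_l; [exact HN0|].
      assert (rho * Rabs al <= rho * sqrt (a1 ^ 2 + a2 ^ 2)) by (apply Rmult_le_compat_l; lra).
      assert ((C + 3 * (A + C) ^ 2) * rho ^ 2 <= K * rho ^ 2).
      { apply Rmult_le_compat_r; [apply pow2_ge_0|]. lra. }
      lra. }
    destruct (modz_ge_coord a1 a2) as [S1 S2]. unfold modz in S1, S2.
    intros p q dp dq [Eq|[Eq|[Eq|Eq]]]; injection Eq as -> -> -> ->.
    + rewrite E1. apply (Hone x1 a1); auto.
    + rewrite E2. apply (Hone x2 (- a1)); auto. now rewrite Rabs_Ropp.
    + rewrite E3. apply (Hone x3 (- a2)); auto. now rewrite Rabs_Ropp.
    + rewrite E4. apply (Hone x4 a2); auto.
Qed.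

(** The exact length of some curve, not a distance: the maximum principle runs over endpoints
    together with the lengths of curves leading to them. *)
Definition reach (v : R -> R -> R) (p q : R * R) (L : R) : Prop :=
  exists c S, arclength v c S /\ (cx c 0, cy c 0) = p /\ (cx c 1, cy c 1) = q /\ S 1 = L.

Lemma shift_derive (f g df dg : R -> R) (k : R) :
  (forall s, is_derive f s (df s)) -> (forall s, is_derive g s (dg s)) ->
  forall s, is_derive (fun r => f r + k * g r) s (df s + k * dg s).
Proof.
  intros Hf Hg s. apply @is_derive_plus; [apply Hf|]. apply is_derive_scal, Hg.
Qed.

Lemma shift_cont (df dg : R -> R) (k : R) :
  continuity df -> continuity dg -> continuity (fun s => df s + k * dg s).
Proof. intros Hf Hg. apply continuity_plus; [exact Hf|]. apply continuity_scal, Hg. Qed.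

Definition shift (c : curve) (k : R) (f g df dg : R -> R)
    (Hf : forall s, is_derive f s (df s)) (Hg : forall s, is_derive g s (dg s))
    (Cf : continuity df) (Cg : continuity dg) : curve :=
  Curve (fun s => cx c s + k * f s) (fun s => cy c s + k * g s)
    (fun s => cdx c s + k * df s) (fun s => cdy c s + k * dg s)
    (shift_derive _ f _ df k (cx_derive c) Hf) (shift_derive _ g _ dg k (cy_derive c) Hg)
    (shift_cont _ df k (cdx_cont c) Cf) (shift_cont _ dg k (cdy_cont c) Cg).

(* Moving the endpoint along the four directions of an orthonormal frame while stepping back in
   time: the curvature terms of the second variation of length and of its time derivative cancel
   wherever the cutoff is 1. *)
Lemma length_variation (T : R) (u : F3) (D : list dir -> F3) (W B b K0 t rho : R)
    (c : curve) (S : R -> R) :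
  let F := exp B in
  let M := 2 / b + 2 * B * F in
  let K := err B F M (2 / b) in
  solves T u D -> bounded_order T W B 3 D -> 0 <= B -> 0 < b -> 0 <= K0 ->
  0 < rho -> rho <= 1 -> 0 < t - rho ^ 2 / 4 -> t < T -> 8 * M * rho <= 1 -> K * rho <= 1 ->
  arclength (u t) c S ->
  (forall s, 0 <= s <= 1 -> Rabs (cx c s) + rho * F <= W /\ Rabs (cy c s) + rho * F <= W) ->
  (forall s, 0 <= s <= 1 -> S s < b -> Rabs (D (Dt :: nil) t (cx c s) (cy c s)) <= K0) ->
  b <= S 1 ->
  exists p q L1 L2 L3 L4,
    p ^ 2 + q ^ 2 = exp (- 2 * u t (cx c 1) (cy c 1)) /\ Rabs p <= F /\ Rabs q <= F /\
    let reach' x y L := reach (u (t - rho ^ 2 / 4)) (cx c 0, cy c 0)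
                          (cx c 1 + rho * x, cy c 1 + rho * y) L in
    reach' p q L1 /\ reach' (- p) (- q) L2 /\ reach' (- q) p L3 /\ reach' q (- p) L4 /\
    L1 + L2 + L3 + L4 <= 4 * S 1 + rho ^ 2 * (K0 * b + 2 / b) + K * rho ^ 3 * S 1 /\
    (forall L, L = L1 \/ L = L2 \/ L = L3 \/ L = L4 -> Rabs (L - S 1) <= rho + K * rho ^ 2 * S 1).
Proof.
  intros F M K Hsol HB HB0 Hb HK0 Hr Hr1 Ht HtT HMr HKr HS Hbox HutK HbS.
  pose proof Hsol as [Hu _]. pose proof Hu as (Enil & Hcont & _).
  assert (HF : 1 <= F) by (unfold F; rewrite <- exp_0; apply exp_le; lra).
  assert (HtT' : 0 <= t <= T) by nra.
  destruct (cutoff b Hb) as (chi & dchi & Hchi & Cdchi & Hchi0 & Hcut).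
  destruct (parallel_field (u t) (D (Dx :: nil) t) (D (Dy :: nil) t) c S chi dchi)
    as (fx & fy & dfx & dfy & Hfx & Hfy & Cfx & Cfy & Fx0 & Fy0 & Hmod & Hdf); auto.
  1: rewrite <- Enil. 1, 2, 3: apply (cont_on_cont2 T); auto.
  1, 2: intros x y; rewrite <- Enil; (apply (partial_x_derive T u) || apply (partial_y_derive T u)); auto.
  assert (HS0 : forall s, 0 <= s -> 0 <= S s).
  { intros s Hs. rewrite <- (proj1 HS). apply (arclength_mono (u t) c S 0 s HS Hs). }
  assert (Hux : forall s, 0 <= s <= 1 -> - B <= u t (cx c s) (cy c s)).
  { intros s Hs. destruct (Hbox s Hs). rewrite <- Enil.
    assert (Hn : Rabs (D nil t (cx c s) (cy c s)) <= B) by (apply HB; auto; simpl; lia || nra).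
    apply Rabs_le_between in Hn. lra. }
  assert (Hfb : forall s, 0 <= s <= 1 -> Rabs (fx s) <= F /\ Rabs (fy s) <= F).
  { intros s Hs. destruct (modz_ge_coord (fx s) (fy s)) as [G1 G2].
    assert (modz (fx s) (fy s) <= F); [|lra].
    pose proof (modz_sqr (fx s) (fy s)) as Hq. rewrite Hmod in Hq.
    pose proof (modz_pos (fx s) (fy s)).
    destruct (Hcut (S s) (HS0 s (proj1 Hs))) as (_ & Hc1 & _).
    assert (He : exp (-2 * u t (cx c s) (cy c s)) <= F * F).
    { unfold F. rewrite <- exp_plus. apply exp_le. specialize (Hux s Hs). lra. }
    pose proof (exp_pos (-2 * u t (cx c s) (cy c s))).
    assert (chi (S s) ^ 2 <= 1) by (simpl; nra).
    assert (modz (fx s) (fy s) * modz (fx s) (fy s) <= F * F) by (rewrite Hq; nra).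
    nra. }
  assert (Hn : forall f df, (forall s, is_derive f s (df s)) ->
    forall s, is_derive (fun s => - f s) s (- df s)) by (intros f df H s; apply @is_derive_opp, H).
  (* The four variations by [f], [- f], [i f] and [- i f], where [i f] has components [- fy] and
     [fx]. All vanish at parameter 0, so the starting point stays fixed. *)
  set (c1 := shift c rho fx fy dfx dfy Hfx Hfy Cfx Cfy).
  set (c2 := shift c rho _ _ _ _ (Hn _ _ Hfx) (Hn _ _ Hfy) (continuity_opp _ Cfx) (continuity_opp _ Cfy)).
  set (c3 := shift c rho _ _ _ _ (Hn _ _ Hfy) Hfx (continuity_opp _ Cfy) Cfx).
  set (c4 := shift c rho _ _ _ _ Hfy (Hn _ _ Hfx) Cfy (continuity_opp _ Cfx)).
  assert (Hv' : cont2 (u (t - rho ^ 2 / 4))).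
  { rewrite <- Enil. apply (cont_on_cont2 T); auto. nra. }
  destruct (arclength_exists _ c1 Hv') as [S1 HS1].
  destruct (arclength_exists _ c2 Hv') as [S2 HS2].
  destruct (arclength_exists _ c3 Hv') as [S3 HS3].
  destruct (arclength_exists _ c4 Hv') as [S4 HS4].
  set (Sd := fun s => exp (u t (cx c s) (cy c s)) * modz (cdx c s) (cdy c s)).
  assert (HSd : forall s, is_derive S s (Sd s)) by apply HS.
  assert (Hcd : forall s, is_derive (fun s => chi (S s)) s (dchi (S s) * Sd s)).
  { intros s. rewrite Rmult_comm. apply (is_derive_comp chi S); auto. }
  assert (Hpt : forall s, 0 <= s <= 1 ->
    let N ck := exp (u (t - rho ^ 2 / 4) (cx ck s) (cy ck s)) * modz (cdx ck s) (cdy ck s) in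
    N c1 + N c2 + N c3 + N c4 <= 4 * Sd s + rho ^ 2 * (K0 * b + 2 / b) * (dchi (S s) * Sd s)
      + K * rho ^ 3 * Sd s /\
    forall ck, ck = c1 \/ ck = c2 \/ ck = c3 \/ ck = c4 ->
      Rabs (N ck - Sd s) <= rho * (dchi (S s) * Sd s) + K * rho ^ 2 * Sd s).
  { intros s Hs N.
    destruct (Hdf s) as (a1 & a2 & Ha & Hd1 & Hd2).
    destruct (Hcut (S s) (HS0 s (proj1 Hs))) as (Hdc & Hc1 & Hc2 & Hc3).
    destruct (Hfb s Hs) as [Ff1 Ff2]. destruct (Hbox s Hs) as [Bx By].
    assert (Hsq : sqrt (a1 ^ 2 + a2 ^ 2) = dchi (S s)).
    { rewrite Ha. replace (dchi (S s) ^ 2) with (Rsqr (dchi (S s))) by (unfold Rsqr; ring).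
      apply sqrt_Rsqr. lra. }
    destruct (modz_ge_coord a1 a2) as [A1 A2]. unfold modz in A1, A2. rewrite Hsq in A1, A2.
    destruct (speed_four_points T u D W B F M (2 / b) t (cx c s) (cy c s) rho (fx s) (fy s)
      (chi (S s) ^ 2) (cdx c s) (cdy c s) a1 a2) as [E1 E2]; auto; try lra.
    rewrite <- Hd1, <- Hd2 in E1, E2. rewrite Hsq in E2. fold K in E1, E2. fold (Sd s) in E1, E2.
    assert (HSd0 : 0 <= Sd s) by (apply Rmult_le_pos; [left; apply exp_pos|apply modz_pos]).
    split.
    - eapply Rle_trans; [exact E1|]. rewrite Ha.
      (* Beyond arc length [b] both terms vanish identically, so the size of the time derivative
         there is irrelevant. Before [b] the properties of the cutoff turn both into multiples of
         [dchi]. *)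
      assert (Hkey : (chi (S s) ^ 2 - 1) * D (Dt :: nil) t (cx c s) (cy c s) + dchi (S s) ^ 2
        <= (K0 * b + 2 / b) * dchi (S s)).
      { destruct (Rle_lt_dec b (S s)) as [Hbs|Hbs].
        - destruct (Hc3 Hbs) as [->  ->]. nra.
        - specialize (HutK s Hs Hbs). apply Rabs_le_between in HutK.
          set (ut := D (Dt :: nil) t (cx c s) (cy c s)) in *.
          assert (0 <= 1 - chi (S s) ^ 2) by (simpl; nra).
          assert ((chi (S s) ^ 2 - 1) * ut <= (1 - chi (S s) ^ 2) * K0) by nra.
          assert ((1 - chi (S s) ^ 2) * K0 <= b * dchi (S s) * K0) by nra.
          assert (dchi (S s) ^ 2 <= 2 / b * dchi (S s)) by (simpl; nra).
          lra. }
      assert (Hr2 : 0 <= rho ^ 2 * Sd s) by (apply Rmult_le_pos; [apply pow2_ge_0|exact HSd0]).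
      assert (rho ^ 2 * Sd s * ((chi (S s) ^ 2 - 1) * D (Dt :: nil) t (cx c s) (cy c s) + dchi (S s) ^ 2)
        <= rho ^ 2 * Sd s * ((K0 * b + 2 / b) * dchi (S s))) by (apply Rmult_le_compat_l; assumption).
      lra.
    - intros ck Hck.
      apply Rle_trans with (Sd s * (rho * dchi (S s) + K * rho ^ 2)); [|right; ring].
      destruct Hck as [-> |[-> |[-> | ->]]]; apply E2; tauto. }
  destruct (Hfb 1 ltac:(lra)) as [Ff1 Ff2].
  destruct (Hcut (S 1) ltac:(lra)) as (_ & Hc1 & _ & Hc3). specialize (Hc3 HbS).
  assert (HS1' : 0 <= S 1) by lra.
  exists (fx 1), (fy 1), (S1 1), (S2 1), (S3 1), (S4 1).
  assert (Hreach : forall ck Sk x y, arclength (u (t - rho ^ 2 / 4)) ck Sk ->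
    cx ck 0 = cx c 0 -> cy ck 0 = cy c 0 -> cx ck 1 = x -> cy ck 1 = y ->
    reach (u (t - rho ^ 2 / 4)) (cx c 0, cy c 0) (x, y) (Sk 1)).
  { intros ck Sk x y Hk E1 E2 E3 E4. exists ck, Sk. repeat split; try apply Hk; congruence. }
  split; [|split; [|split; [|split; [|split; [|split; [|split; [|split]]]]]]]; auto.
  - rewrite Hmod, (proj1 Hc3). ring.
  - apply (Hreach c1 S1); auto; simpl; rewrite ?Fx0, ?Fy0; ring.
  - apply (Hreach c2 S2); auto; simpl; rewrite ?Fx0, ?Fy0; ring.
  - apply (Hreach c3 S3); auto; simpl; rewrite ?Fx0, ?Fy0; ring.
  - apply (Hreach c4 S4); auto; simpl; rewrite ?Fx0, ?Fy0; ring.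
  - set (N := fun ck s => exp (u (t - rho ^ 2 / 4) (cx ck s) (cy ck s)) * modz (cdx ck s) (cdy ck s)).
    assert (HA : forall s, is_derive (fun s => S1 s + S2 s + S3 s + S4 s) s
      (N c1 s + N c2 s + N c3 s + N c4 s)).
    { intros s. apply @is_derive_plus; [apply @is_derive_plus; [apply @is_derive_plus|]|];
        [apply HS1|apply HS2|apply HS3|apply HS4]. }
    (* An explicit antiderivative of the pointwise bound. Its cutoff term rises from 0 to 1 because
       [S 1] is at least [b]. *)
    assert (HAd : forall s, is_derive (fun s => 4 * S s + rho ^ 2 * (K0 * b + 2 / b) * chi (S s)
      + K * rho ^ 3 * S s) s (4 * Sd s + rho ^ 2 * (K0 * b + 2 / b) * (dchi (S s) * Sd s)
      + K * rho ^ 3 * Sd s)).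
    { intros s. apply @is_derive_plus; [apply @is_derive_plus|]; apply is_derive_scal; auto. }
    pose proof (le_of_derive _ _ _ _ 0 1 Rle_0_1 HA HAd (fun s Hs => proj1 (Hpt s Hs))) as H.
    simpl in H. rewrite (proj1 HS1), (proj1 HS2), (proj1 HS3), (proj1 HS4), (proj1 HS), Hchi0 in H.
    rewrite (proj1 Hc3) in H. simpl. lra.
  - assert (HR : forall s, is_derive (fun s => rho * chi (S s) + K * rho ^ 2 * S s) s
      (rho * (dchi (S s) * Sd s) + K * rho ^ 2 * Sd s)).
    { intros s. apply @is_derive_plus; apply is_derive_scal; auto. }
    assert (Hone : forall ck Sk, arclength (u (t - rho ^ 2 / 4)) ck Sk ->
      ck = c1 \/ ck = c2 \/ ck = c3 \/ ck = c4 -> Rabs (Sk 1 - S 1) <= rho + K * rho ^ 2 * S 1).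
    { intros ck Sk [Hk0 Hk] Hck.
      assert (HD1 : forall s, is_derive (fun s => Sk s - S s) s
        (exp (u (t - rho ^ 2 / 4) (cx ck s) (cy ck s)) * modz (cdx ck s) (cdy ck s) - Sd s))
        by (intros s; apply @is_derive_minus; auto).
      assert (HD2 : forall s, is_derive (fun s => S s - Sk s) s
        (Sd s - exp (u (t - rho ^ 2 / 4) (cx ck s) (cy ck s)) * modz (cdx ck s) (cdy ck s)))
        by (intros s; apply @is_derive_minus; auto).
      assert (I1 := le_of_derive _ _ _ _ 0 1 Rle_0_1 HD1 HR
        (fun s Hs => Rle_trans _ _ _ (Rle_abs _) (proj2 (Hpt s Hs) ck Hck))).
      assert (I2 := le_of_derive _ _ _ _ 0 1 Rle_0_1 HD2 HR
        (fun s Hs => Rle_trans _ _ _ (Rle_trans _ _ _ (Rle_abs _) (Req_le _ _ (Rabs_minus_sym _ _)))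
          (proj2 (Hpt s Hs) ck Hck))).
      simpl in I1, I2. rewrite Hk0, (proj1 HS), Hchi0, (proj1 Hc3) in I1, I2.
      apply Rabs_le. simpl. lra. }
    intros L [-> |[-> |[-> | ->]]]; [apply (Hone c1 S1)|apply (Hone c2 S2)|apply (Hone c3 S3)|apply (Hone c4 S4)]; auto.
Qed.

(** * The maximum principle *)

Lemma ln_le_mono (x y : R) : 0 < x -> x <= y -> ln x <= ln y.
Proof. intros Hx [H| ->]; [left; now apply ln_increasing|lra]. Qed.

(** The [phi] of the overview. For [C = 0] the subtracted comparison function is the expanding
    hyperbolic flow, whose metric is [2 * (t - tau)] times the hyperbolic one. *)
Definition gap (u : F3) (tau C t x y : R) : R :=
  / 2 * ln (2 * (t - tau)) + hyp x y - C - u t x y.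

(** The differential inequality for [phi], read backwards in time. The frame has unit length for
    [u], that is [k = 1] in [four_increments], so the increments of [u] cancel at order [rho^2]. The
    hyperbolic part gives the exponential term, where [0 <= C] is used, and the time logarithm loses
    [rho^2 / (2 * (t - tau))]. The lower bound [th] on the elapsed time controls the remainder of
    that logarithm. *)
Lemma gap_four_points (T : R) (u : F3) (D : list dir -> F3) (W B F C tau th t x y rho p q : R) :
  solves T u D -> bounded_order T W B 3 D -> 0 <= B -> 1 <= F -> 0 <= C ->
  0 < rho -> rho <= 1 -> 0 < th -> th <= t - tau -> rho ^ 2 / 4 <= th / 2 -> 0 <= tau -> t < T ->
  40 * F * rho <= 1 ->
  Rabs p <= F -> Rabs q <= F -> Rabs x + rho * F <= W -> Rabs y + rho * F <= W ->
  p ^ 2 + q ^ 2 = exp (- 2 * u t x y) -> 3 / 2 <= modz x y ->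
  let g a b := gap u tau C (t - rho ^ 2 / 4) (x + rho * a) (y + rho * b) in
  g p q + g (- p) (- q) + g (- q) p + g q (- p) >=
    4 * gap u tau C t x y + rho ^ 2 * ((exp (2 * gap u tau C t x y) - 1) / (2 * (t - tau)))
    - (/ (4 * th ^ 2) + 80000 * F ^ 3 + 48 * B * F ^ 3) * rho ^ 3.
Proof.
  intros Hsol HB HB0 HF HC Hr Hr1 Hth Htth Hh Htau HtT HFr Hp Hq Hx Hy Hpq Hxy g.
  destruct (four_increments T u D W B F t x y rho p q 1) as [Hsum _]; auto; try lra.
  pose proof (hyp_four_points F x y p q rho ltac:(lra) Hr HFr Hp Hq Hxy) as Hh4.
  set (h := rho ^ 2 / 4) in *.
  assert (Hh0 : 0 < h) by (unfold h; nra).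
  set (y0 := h / (t - tau)).
  assert (Hy0 : 0 <= y0 <= 1 / 2).
  { unfold y0. split; [apply Rdiv_le_0_compat; lra|]. apply Rle_div_l; lra. }
  assert (Hln : ln (2 * (t - h - tau)) >= ln (2 * (t - tau)) - y0 - 2 * y0 ^ 2).
  { replace (2 * (t - h - tau)) with (2 * (t - tau) * (1 + - y0)) by (unfold y0; field; lra).
    rewrite ln_mult by lra.
    pose proof (ln_taylor2 (- y0)) as H. rewrite Rabs_Ropp, Rabs_right in H by lra.
    specialize (H ltac:(lra)). replace ((- y0) ^ 2) with (y0 ^ 2) in H by ring.
    apply Rabs_le_between in H. lra. }
  assert (Hy2 : 4 * y0 ^ 2 <= / (4 * th ^ 2) * rho ^ 3).
  { assert (Hy1 : y0 <= h / th).
    { unfold y0, Rdiv. apply Rmult_le_compat_l; [lra|]. apply Rinv_le_contravar; lra. }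
    apply Rle_trans with (4 * (h / th) ^ 2).
    - apply Rmult_le_compat_l; [lra|]. apply pow_incr. lra.
    - replace (4 * (h / th) ^ 2) with (/ (4 * th ^ 2) * rho ^ 4) by (unfold h; field; lra).
      apply Rmult_le_compat_l.
      + left. apply Rinv_0_lt_compat. assert (0 < th ^ 2) by (apply pow_lt; lra). lra.
      + assert (0 < rho ^ 3) by (apply pow_lt; lra). simpl in *. nra. }
  assert (HE : exp (2 * gap u tau C t x y) <=
    2 * (t - tau) * ((p ^ 2 + q ^ 2) * exp (2 * hyp x y))).
  { rewrite Hpq, <- exp_plus. rewrite <- (exp_ln (2 * (t - tau))) at 1 by lra.
    rewrite <- exp_plus. apply exp_le. unfold gap. lra. }
  assert (HE' : exp (2 * gap u tau C t x y) / (2 * (t - tau)) <=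
    (p ^ 2 + q ^ 2) * exp (2 * hyp x y)) by (apply Rle_div_l; lra).
  assert (Hr2 : 0 < rho ^ 2) by (apply pow_lt; lra).
  assert (HE2 : rho ^ 2 * (exp (2 * gap u tau C t x y) / (2 * (t - tau))) <=
    rho ^ 2 * ((p ^ 2 + q ^ 2) * exp (2 * hyp x y))) by (apply Rmult_le_compat_l; lra).
  replace (rho ^ 2 * ((exp (2 * gap u tau C t x y) - 1) / (2 * (t - tau)))) with
    (rho ^ 2 * (exp (2 * gap u tau C t x y) / (2 * (t - tau))) - 2 * y0)
    by (unfold y0, h; field; lra).
  set (G := exp (2 * gap u tau C t x y)) in *.
  unfold g, gap. apply Rabs_le_between in Hsum. fold h in Hsum. lra.
Qed.

(** The term [A / (rad - L)] carries the mean change of length. The term [8 / (rad - L)^2] is the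
    price of concavity: four quadratic remainders [2 z^2] with [z] of size about [rho / (rad - L)].
    The lower bound [kap] makes the cubic error uniform. *)
Lemma log_four_points (rad L L1 L2 L3 L4 A Q kap rho : R) :
  0 < kap -> kap <= rad - L -> 0 <= Q -> 0 < rho -> 2 * (1 + Q) / kap * rho <= 1 ->
  L1 + L2 + L3 + L4 <= 4 * L + rho ^ 2 * A + Q * rho ^ 3 ->
  (forall L', L' = L1 \/ L' = L2 \/ L' = L3 \/ L' = L4 -> Rabs (L' - L) <= rho + Q * rho ^ 2) ->
  rho <= 1 ->
  (0 < rad - L1 /\ 0 < rad - L2 /\ 0 < rad - L3 /\ 0 < rad - L4) /\
  ln (rad - L1) + ln (rad - L2) + ln (rad - L3) + ln (rad - L4) >=
    4 * ln (rad - L) - rho ^ 2 * (A / (rad - L) + 8 / (rad - L) ^ 2)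
    - (Q / kap + 8 * (2 * Q + Q ^ 2) / kap ^ 2) * rho ^ 3.
Proof.
  intros Hk Hg HQ Hr Hkr Hsum Hone Hr1.
  set (g := rad - L) in *.
  assert (Hig : 0 < / g) by (apply Rinv_0_lt_compat; lra).
  assert (Higk : / g <= / kap) by (apply Rinv_le_contravar; lra).
  assert (Hbd : forall L', L' = L1 \/ L' = L2 \/ L' = L3 \/ L' = L4 ->
    0 < rad - L' /\ ln (rad - L') >= ln g - (L' - L) / g - 2 * ((rho + Q * rho ^ 2) / g) ^ 2).
  { intros L' HL'. specialize (Hone L' HL').
    set (z := (L' - L) / g).
    assert (Hz : Rabs z <= (rho + Q * rho ^ 2) / g).
    { unfold z, Rdiv. rewrite Rabs_mult, (Rabs_right (/ g)) by lra.
      apply Rmult_le_compat_r; [lra|exact Hone]. }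
    assert (Hz2 : (rho + Q * rho ^ 2) / g <= 1 / 2).
    { apply Rle_trans with ((1 + Q) * rho / kap).
      - unfold Rdiv. apply Rmult_le_compat; try lra.
        + assert (0 <= Q * rho ^ 2) by (apply Rmult_le_pos; [lra|apply pow2_ge_0]). lra.
        + assert (rho ^ 2 <= rho) by (simpl; nra). nra.
      - replace ((1 + Q) * rho / kap) with (2 * (1 + Q) / kap * rho / 2) by (field; lra). lra. }
    assert (E : rad - L' = g * (1 + - z)) by (unfold z, g; field; fold g; lra).
    assert (Hz1 : Rabs (- z) <= 1 / 2) by (rewrite Rabs_Ropp; lra).
    pose proof (ln_taylor2 (- z) Hz1) as Hln.
    replace ((- z) ^ 2) with (Rabs z ^ 2) in Hln by (rewrite pow2_abs; ring).
    assert (Hzz : Rabs z ^ 2 <= ((rho + Q * rho ^ 2) / g) ^ 2)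
      by (apply pow_incr; split; [apply Rabs_pos|exact Hz]).
    apply Rabs_le_between in Hz1. apply Rabs_le_between in Hln.
    split; [rewrite E; apply Rmult_lt_0_compat; lra|].
    rewrite E, ln_mult by lra. lra. }
  destruct (Hbd L1) as [P1 E1]; [tauto|]. destruct (Hbd L2) as [P2 E2]; [tauto|].
  destruct (Hbd L3) as [P3 E3]; [tauto|]. destruct (Hbd L4) as [P4 E4]; [tauto|].
  split; [tauto|].
  assert (HS : (L1 - L) / g + (L2 - L) / g + (L3 - L) / g + (L4 - L) / g <=
    rho ^ 2 * (A / g) + Q / kap * rho ^ 3).
  { replace (_ + _) with ((L1 + L2 + L3 + L4 - 4 * L) * / g) by (field; lra).
    apply Rle_trans with ((rho ^ 2 * A + Q * rho ^ 3) * / g).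
    - apply Rmult_le_compat_r; lra.
    - unfold Rdiv. assert (0 <= Q * rho ^ 3) by (apply Rmult_le_pos; [lra|apply pow_le; lra]).
      nra. }
  assert (HQ2 : 8 * ((rho + Q * rho ^ 2) / g) ^ 2 <=
    rho ^ 2 * (8 / g ^ 2) + 8 * (2 * Q + Q ^ 2) / kap ^ 2 * rho ^ 3).
  { replace (8 * ((rho + Q * rho ^ 2) / g) ^ 2) with
      (rho ^ 2 * (8 / g ^ 2) + 8 * (2 * Q + Q ^ 2 * rho) * rho ^ 3 * (/ g * / g)) by (field; lra).
    replace (8 * (2 * Q + Q ^ 2) / kap ^ 2 * rho ^ 3) with
      (8 * (2 * Q + Q ^ 2) * rho ^ 3 * (/ kap * / kap)) by (field; lra).
    apply Rplus_le_compat_l.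
    assert (0 <= Q ^ 2) by apply pow2_ge_0.
    assert (0 < rho ^ 3) by (apply pow_lt; lra).
    apply Rmult_le_compat.
    - apply Rmult_le_pos; [|lra]. nra.
    - nra.
    - apply Rmult_le_compat_r; [lra|]. nra.
    - apply Rmult_le_compat; lra. }
  lra.
Qed.

(** The product [r ln r] is at least [3/2 * 1/4 = 3/8]. *)
Lemma hyp_le (x y : R) : 3 / 2 <= modz x y -> hyp x y <= - ln (3 / 8).
Proof.
  intros H. pose proof (ln_modz_bound x y H). unfold hyp.
  apply Ropp_le_contravar, ln_le_mono; [lra|]. nra.
Qed.

Lemma gap_le (u : F3) (tau C t x y B T : R) :
  0 <= C -> 0 < t - tau -> t - tau <= T -> 3 / 2 <= modz x y -> - B <= u t x y ->
  gap u tau C t x y <= / 2 * ln (2 * (t - tau)) - ln (3 / 8) + B.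
Proof. intros HC H1 H2 Hxy Hu. pose proof (hyp_le x y Hxy). unfold gap. lra. Qed.

(** Being above the barrier means [exp (2 * phi) >= exp (2 * eps) * rad^2 / g^2]. After
    multiplication by [g^2] both the absorption and the penalty are bounded in terms of [rad], and
    since [g <= rad] the worst case is [g = rad], which is the last hypothesis. The remaining gain
    [/ g^2] is at least [/ rad^2]. *)
Lemma gain_bound (T t A g rad eps phi : R) :
  0 < t -> t <= T -> 0 < g <= rad -> 0 <= A -> 0 <= phi -> eps + ln rad - ln g < phi ->
  1 <= (exp (2 * eps) - 1) * rad ^ 2 / (2 * T) - A * rad - 8 ->
  / rad ^ 2 <= (exp (2 * phi) - 1) / (2 * t) - (A / g + 8 / g ^ 2).
Proof.
  intros Ht HtT Hg HA Hphi0 Hphi Hbig.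
  assert (Hig : 0 < / g) by (apply Rinv_0_lt_compat; lra).
  assert (Hi2 : 0 < / g * / g) by (apply Rmult_lt_0_compat; exact Hig).
  assert (Hit : 0 < / (2 * T)) by (apply Rinv_0_lt_compat; lra).
  assert (Hex : exp (2 * eps) * rad ^ 2 * (/ g * / g) <= exp (2 * phi)).
  { replace (exp (2 * eps) * rad ^ 2 * (/ g * / g)) with (exp (2 * (eps + ln rad - ln g))).
    - apply exp_le. lra.
    - replace (2 * (eps + ln rad - ln g)) with (2 * eps + (ln rad + ln rad) + - (ln g + ln g)) by ring.
      rewrite !exp_plus, exp_Ropp, exp_plus, !exp_ln by lra. field. lra. }
  assert (Hex1 : 0 <= exp (2 * phi) - 1).
  { assert (exp 0 <= exp (2 * phi)) by (apply exp_le; lra). rewrite exp_0 in *. lra. }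
  assert (Hden : (exp (2 * phi) - 1) * / (2 * T) <= (exp (2 * phi) - 1) * / (2 * t)).
  { apply Rmult_le_compat_l; [exact Hex1|]. apply Rinv_le_contravar; lra. }
  assert (Hgg : g * g <= rad ^ 2) by nra.
  assert (Hmul : / rad ^ 2 <= / g * / g).
  { rewrite <- Rinv_mult. apply Rinv_le_contravar; nra. }
  assert (Hbr : 1 <= (exp (2 * eps) * rad ^ 2 - g * g) * / (2 * T) - A * g - 8).
  { apply Rle_trans with (1 := Hbig). unfold Rdiv.
    assert (A * g <= A * rad) by (apply Rmult_le_compat_l; lra).
    assert ((exp (2 * eps) - 1) * rad ^ 2 * / (2 * T) <=
      (exp (2 * eps) * rad ^ 2 - g * g) * / (2 * T)) by (apply Rmult_le_compat_r; lra).
    lra. }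
  assert (Hfin : / g * / g <= (exp (2 * eps) * rad ^ 2 * (/ g * / g) - 1) * / (2 * T) - (A / g + 8 / g ^ 2)).
  { replace ((exp (2 * eps) * rad ^ 2 * (/ g * / g) - 1) * / (2 * T) - (A / g + 8 / g ^ 2))
      with (/ g * / g * ((exp (2 * eps) * rad ^ 2 - g * g) * / (2 * T) - A * g - 8)) by (field; lra).
    rewrite <- (Rmult_1_r (/ g * / g)) at 1. apply Rmult_le_compat_l; lra. }
  assert ((exp (2 * eps) * rad ^ 2 * (/ g * / g) - 1) * / (2 * T) <= (exp (2 * phi) - 1) * / (2 * T))
    by (apply Rmult_le_compat_r; lra).
  unfold Rdiv in *. lra.
Qed.

(* The maximum principle for [gap + ln (rad - L)] over all times and all curves of length [L]: its
   supremum need not be attained, but any value above the bound can be raised by a fixed amount. *)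
Lemma barrier (T : R) (u : F3) (D : list dir -> F3) (tau T1 C rad eps B1 K0 : R) :
  let b := exp (- B1) in
  solves T u D -> inst_complete T u -> 0 < tau -> tau < T1 -> T1 < T -> 0 <= C -> 0 < eps ->
  0 <= K0 ->
  (forall t x y, 0 <= t <= T -> 3 / 2 <= modz x y <= 7 / 4 ->
     / 2 * ln (2 * T) + hyp x y - C <= u t x y) ->
  (forall t x y, 0 <= t <= T -> modz x y <= 1 ->
     - B1 <= u t x y /\ Rabs (D (Dt :: nil) t x y) <= K0) ->
  0 < rad -> 1 <= (exp (2 * eps) - 1) * rad ^ 2 / (2 * T) - (K0 * b + 2 / b) * rad - 8 ->
  forall t x y L, tau < t <= T1 -> 3 / 2 <= modz x y -> reach (u t) (0, 0) (x, y) L -> L < rad ->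
    gap u tau C t x y + ln (rad - L) <= eps + ln rad.
Proof.
  intros b Hsol Hcomp Htau Htau1 HT1 HC Heps HK0 Hring Hbase HR HRbig.
  pose proof Hsol as [Hu _]. pose proof Hu as (Enil & Hcont & _).
  assert (Hb : 0 < b) by apply exp_pos.
  assert (HT : 0 < T) by lra.
  destruct (ball_bounded_uniform T u D tau T1 rad Hu Hcomp Htau HT1) as [W0 [HW0 HW]].
  (* The extra unit leaves room for displacements, which will be at most 1/40 in each coordinate. *)
  set (W := W0 + 1).
  destruct (cont_on_bounded_order T W 3 D Hcont) as [B [HB0 HB]].
  assert (HBb : bounded_order T W B 3 D) by (intros l Hl; apply HB, Hl).
  set (F := exp B). set (M := 2 / b + 2 * B * F). set (K := err B F M (2 / b)).
  assert (HF : 1 <= F) by (unfold F; rewrite <- exp_0; apply exp_le; lra).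
  assert (Hb2 : 0 < 2 / b) by (apply Rdiv_lt_0_compat; lra).
  assert (HM : 0 <= M) by (unfold M; assert (0 <= B * F) by nra; lra).
  assert (HK : 0 <= K).
  { unfold K, err. assert (0 <= F ^ 3) by (apply pow_le; lra).
    assert (0 <= B * F ^ 3) by nra. assert (0 <= M ^ 2) by apply pow2_ge_0.
    assert (0 <= M ^ 3) by (apply pow_le; lra).
    set (C0 := 48 * B * F ^ 3 + 10 * M ^ 2 + 108 * M ^ 3).
    assert (0 <= C0) by (unfold C0; lra).
    assert (0 <= (2 / b + C0) ^ 2) by apply pow2_ge_0.
    assert (0 <= (2 / b + C0) ^ 3) by (apply pow_le; lra). lra. }
  set (H0 := - ln (3 / 8)).
  (* [Phi] bounds [gap] from above on the ball. Before time [tau + th] the sharper bound of [gap_le]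
     is negative, so positive values of [gap] keep a definite time lag from [tau]. *)
  set (Phi := / 2 * ln (2 * T) + H0 + B).
  set (th := / 2 * exp (- 2 * (H0 + B))).
  assert (Hth : 0 < th) by (unfold th; pose proof (exp_pos (- 2 * (H0 + B))); lra).
  (* Above the barrier [ln rad - ln (rad - L)] is less than [gap], hence less than [Phi], so
     [rad - L] cannot fall below [kap]. *)
  set (kap := rad * exp (- Phi)).
  assert (Hkap : 0 < kap) by (apply Rmult_lt_0_compat; [exact HR|apply exp_pos]).
  set (Q := K * rad). assert (HQ : 0 <= Q) by (unfold Q; nra).
  set (E1 := / (4 * th ^ 2) + 80000 * F ^ 3 + 48 * B * F ^ 3).
  set (E2 := Q / kap + 8 * (2 * Q + Q ^ 2) / kap ^ 2).
  assert (HE1 : 0 <= E1).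
  { unfold E1. assert (0 <= F ^ 3) by (apply pow_le; lra). assert (0 <= B * F ^ 3) by nra.
    assert (0 < / (4 * th ^ 2)).
    { apply Rinv_0_lt_compat. assert (0 < th ^ 2) by (apply pow_lt; lra). lra. }
    lra. }
  assert (HE2 : 0 <= E2).
  { unfold E2. apply Rplus_le_le_0_compat; apply Rdiv_le_0_compat; try lra.
    - assert (0 <= Q ^ 2) by apply pow2_ge_0. lra.
    - apply pow_lt, Hkap. }
  set (N := 2 * rad ^ 2 * (E1 + E2)).
  assert (HN : 0 <= N) by (apply Rmult_le_pos; [pose proof (pow2_ge_0 rad); lra|lra]).
  assert (Hq : 0 <= 2 * (1 + Q) / kap) by (apply Rdiv_le_0_compat; lra).
  assert (Hth2 : 0 < / (2 * th)) by (apply Rinv_0_lt_compat; lra).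
  (* The reciprocal of a sum of nonnegative terms meets every smallness condition at once, one per
     summand. *)
  set (Z := 1 + 8 * M + K + 40 * F + / (2 * th) + 2 * (1 + Q) / kap + N).
  set (rho := / Z).
  assert (HZ : 0 < Z) by (unfold Z; lra).
  assert (Hrho : 0 < rho) by (apply Rinv_0_lt_compat, HZ).
  assert (Hsmall : forall k, 0 <= k <= Z -> k * rho <= 1).
  { intros k Hk. replace 1 with (Z * rho) by (unfold rho; field; lra). nra. }
  pose proof (Hsmall 1 ltac:(unfold Z; lra)) as R1.
  pose proof (Hsmall (8 * M) ltac:(unfold Z; lra)) as R2.
  pose proof (Hsmall K ltac:(unfold Z; lra)) as R3.
  pose proof (Hsmall (40 * F) ltac:(unfold Z; lra)) as R4.
  pose proof (Hsmall (/ (2 * th)) ltac:(unfold Z; lra)) as R5.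
  pose proof (Hsmall (2 * (1 + Q) / kap) ltac:(unfold Z; lra)) as R6.
  pose proof (Hsmall N ltac:(unfold Z; lra)) as R7.
  rewrite Rmult_1_l in R1.
  assert (Hh : rho ^ 2 / 4 <= th / 2).
  { assert (rho <= 2 * th).
    { apply Rmult_le_reg_l with (/ (2 * th)); [exact Hth2|]. rewrite Rinv_l by lra. exact R5. }
    simpl. nra. }
  clearbody rho. clear Hsmall R5.
  set (m0 := eps + ln rad).
  set (St := fun m => exists t x y L, tau < t <= T1 /\ 3 / 2 <= modz x y /\
    reach (u t) (0, 0) (x, y) L /\ L < rad /\ m <= gap u tau C t x y + ln (rad - L)).
  set (delta := rho ^ 2 / (8 * rad ^ 2)).
  assert (HR2 : 0 < rad ^ 2) by (apply pow_lt; lra).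
  assert (Hr2 : 0 < rho ^ 2) by (apply pow_lt; lra).
  assert (Hdelta : 0 < delta) by (apply Rdiv_lt_0_compat; lra).
  assert (Hin : forall t x y L, tau < t <= T1 -> reach (u t) (0, 0) (x, y) L -> L < rad ->
    0 <= L /\ modz x y <= W0 /\ - B <= u t x y).
  { intros t x y L Ht (c & S & HS & Es & Ee & HL) HLR.
    assert (Hxy : modz x y <= W0).
    { apply (HW t (x, y)); [lra|]. exists c, S. repeat split; try apply HS; auto; lra. }
    split; [|split; [exact Hxy|]].
    - rewrite <- HL, <- (proj1 HS). apply (arclength_mono (u t) c S); auto; lra.
    - destruct (modz_ge_coord x y). rewrite <- Enil.
      assert (Hn : Rabs (D nil t x y) <= B) by (apply HBb; simpl; try lia; unfold W; lra).
      apply Rabs_le_between in Hn. lra. }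
  assert (Hstep : forall m, m0 < m -> St m -> St (m + delta)).
  { intros m Hm (t & x & y & L & Ht & Hxy & Hreach & HLR & Hgap).
    destruct (Hin t x y L Ht Hreach HLR) as (HL0 & HxyW & Hut).
    set (g := rad - L) in *.
    assert (Hg : 0 < g <= rad) by (unfold g; lra).
    assert (HlnR : ln g <= ln rad) by (apply ln_le_mono; lra).
    set (phi := gap u tau C t x y) in *.
    assert (Hphi : eps + ln rad - ln g < phi) by (unfold m0 in Hm; lra).
    pose proof (gap_le u tau C t x y B T HC ltac:(lra) ltac:(lra) Hxy Hut) as Hup.
    fold phi H0 in Hup.
    assert (Htth : th <= t - tau).
    { assert (Hl : - 2 * (H0 + B) <= ln (2 * (t - tau))) by (unfold H0 in *; lra).
      apply exp_le in Hl. rewrite exp_ln in Hl by lra. unfold th. lra. }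
    assert (HlnT : ln (2 * (t - tau)) <= ln (2 * T)) by (apply ln_le_mono; lra).
    assert (Hkg : kap <= g).
    { unfold kap. rewrite <- (exp_ln rad) by exact HR. rewrite <- exp_plus.
      rewrite <- (exp_ln g) by lra. apply exp_le. unfold Phi, H0. lra. }
    (* On the annulus the hypothesis makes [gap] nonpositive, whereas here it is positive. All four
       displaced endpoints therefore remain outside radius 3/2. *)
    assert (Hxy7 : 7 / 4 < modz x y).
    { apply Rnot_le_lt. intros H7.
      specialize (Hring t x y ltac:(lra) (conj Hxy H7)). unfold phi, gap in Hphi. lra. }
    assert (HFr : rho * F <= 1 / 40) by lra.
    destruct Hreach as (c & S & HS & Es & Ee & HSL). injection Es as Esx Esy. injection Ee as Eex Eey.
    assert (HS1 : S 1 = L) by exact HSL.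
    assert (Hbox : forall s, 0 <= s <= 1 -> Rabs (cx c s) + rho * F <= W /\ Rabs (cy c s) + rho * F <= W).
    { intros s Hs.
      assert (Hq' : modz (cx c s) (cy c s) <= W0).
      { apply (HW t (cx c s, cy c s)); [lra|]. replace (0, 0) with (cx c 0, cy c 0) by congruence.
        apply (dlt_subcurve (u t) c S); auto; [lra|].
        pose proof (arclength_mono (u t) c S s 1 HS (proj2 Hs)). rewrite (proj1 HS). lra. }
      destruct (modz_ge_coord (cx c s) (cy c s)). unfold W. lra. }
    (* Until its length reaches [b] the curve stays in the unit disc, where [K0] bounds the time
       derivative of [u]; this is what makes the Laplacian bound depend only on [u] near 0. *)
    assert (Hexit : forall s, 0 <= s <= 1 -> 1 <= modz (cx c s) (cy c s) -> b <= S s).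
    { intros s Hs H1. unfold b. rewrite <- (Rmult_1_r (exp (- B1))).
      apply (exit_length (u t) c S); auto; try lra.
      - rewrite Esx, Esy. intros p q Hpq. rewrite !Rminus_0_r in Hpq.
        apply (Hbase t p q); [lra|exact Hpq].
      - rewrite Esx, Esy, !Rminus_0_r. exact H1. }
    destruct (length_variation T u D W B b K0 t rho c S)
      as (p & q & L1 & L2 & L3 & L4 & Hpq & Hp & Hq' & Hr1 & Hr2' & Hr3 & Hr4 & Hsum & Hone);
      auto; try lra.
    { intros s Hs HSs. apply Hbase; [lra|].
      apply Rnot_lt_le. intros H1. specialize (Hexit s Hs). lra. }
    { apply Hexit; [lra|]. rewrite Eex, Eey. lra. }
    fold F in Hp, Hq', Hsum, Hone. fold F in Hsum. fold M K in Hsum, Hone.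
    rewrite Eex, Eey in *. rewrite Esx, Esy in *. rewrite HS1 in *.
    assert (Hsum' : L1 + L2 + L3 + L4 <= 4 * L + rho ^ 2 * (K0 * b + 2 / b) + Q * rho ^ 3).
    { assert (0 < rho ^ 3) by (apply pow_lt; lra).
      assert (K * rho ^ 3 * L <= Q * rho ^ 3).
      { unfold Q. replace (K * rho ^ 3 * L) with (K * L * rho ^ 3) by ring.
        apply Rmult_le_compat_r; [lra|]. apply Rmult_le_compat_l; lra. }
      lra. }
    assert (Hone' : forall L', L' = L1 \/ L' = L2 \/ L' = L3 \/ L' = L4 ->
      Rabs (L' - L) <= rho + Q * rho ^ 2).
    { intros L' HL'. eapply Rle_trans; [apply Hone, HL'|]. apply Rplus_le_compat_l. unfold Q.
      replace (K * rho ^ 2 * L) with (K * L * rho ^ 2) by ring.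
      apply Rmult_le_compat_r; [lra|]. apply Rmult_le_compat_l; lra. }
    destruct (log_four_points rad L L1 L2 L3 L4 (K0 * b + 2 / b) Q kap rho) as [(P1 & P2 & P3 & P4) Hlog]; auto.
    assert (Hbx : Rabs x + rho * F <= W /\ Rabs y + rho * F <= W)
      by (rewrite <- Eex, <- Eey; apply Hbox; lra).
    pose proof (gap_four_points T u D W B F C tau th t x y rho p q Hsol HBb HB0 HF HC Hrho R1 Hth Htth
      Hh ltac:(lra) ltac:(lra) R4 Hp Hq' (proj1 Hbx) (proj2 Hbx) Hpq Hxy) as Hgap4.
    cbv zeta beta in Hgap4. fold phi E1 in Hgap4. fold E2 g in Hlog.
    set (t' := t - rho ^ 2 / 4) in *.
    set (G1 := gap u tau C t' (x + rho * p) (y + rho * q)) in *.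
    set (G2 := gap u tau C t' (x + rho * - p) (y + rho * - q)) in *.
    set (G3 := gap u tau C t' (x + rho * - q) (y + rho * p)) in *.
    set (G4 := gap u tau C t' (x + rho * q) (y + rho * - p)) in *.
    assert (Hgain : rho ^ 2 / rad ^ 2 <= rho ^ 2 * ((exp (2 * phi) - 1) / (2 * (t - tau))) -
      rho ^ 2 * ((K0 * b + 2 / b) / g + 8 / g ^ 2)).
    { rewrite <- Rmult_minus_distr_l. unfold Rdiv at 1. apply Rmult_le_compat_l; [lra|].
      assert (0 <= K0 * b) by (apply Rmult_le_pos; lra).
      apply (gain_bound T (t - tau) _ g rad eps phi); auto; lra. }
    (* The choice of [N] lets the cubic errors consume at most half of the gain. A quarter of the
       other half is [delta], so at least one of the four neighbours rises by [delta]. *)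
    assert (HNr : (E1 + E2) * rho ^ 3 <= rho ^ 2 / rad ^ 2 / 2).
    { replace (rho ^ 2 / rad ^ 2 / 2) with (rho ^ 2 * (1 * / (2 * rad ^ 2))) by (field; lra).
      replace ((E1 + E2) * rho ^ 3) with (rho ^ 2 * (N * rho * / (2 * rad ^ 2))) by (unfold N; field; lra).
      apply Rmult_le_compat_l; [lra|]. apply Rmult_le_compat_r; [|exact R7].
      left. apply Rinv_0_lt_compat. lra. }
    assert (Htot : (G1 + ln (rad - L1)) + (G2 + ln (rad - L2)) + (G3 + ln (rad - L3)) + (G4 + ln (rad - L4)) >=
      4 * (m + delta)).
    { assert (4 * delta = rho ^ 2 / rad ^ 2 / 2) by (unfold delta; field; lra). lra. }
    assert (Hmove : forall a a', Rabs a <= F -> Rabs a' <= F -> 3 / 2 <= modz (x + rho * a) (y + rho * a')).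
    { intros a a' Ha Ha'.
      pose proof (modz_triang (x + rho * a) (y + rho * a') (- (rho * a)) (- (rho * a'))) as Htr.
      replace (x + rho * a + - (rho * a)) with x in Htr by ring.
      replace (y + rho * a' + - (rho * a')) with y in Htr by ring.
      rewrite modz_opp in Htr. pose proof (modz_le_sum (rho * a) (rho * a')) as Hle.
      rewrite !Rabs_mult, (Rabs_right rho) in Hle by lra.
      assert (rho * Rabs a <= rho * F) by (apply Rmult_le_compat_l; lra).
      assert (rho * Rabs a' <= rho * F) by (apply Rmult_le_compat_l; lra). lra. }
    assert (Ht' : tau < t' <= T1) by (unfold t'; lra).
    assert (Hp' : Rabs (- p) <= F) by now rewrite Rabs_Ropp.
    assert (Hq'' : Rabs (- q) <= F) by now rewrite Rabs_Ropp.
    destruct (Rle_lt_dec (m + delta) (G1 + ln (rad - L1))) as [C1|C1].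
    { exists t', (x + rho * p), (y + rho * q), L1. repeat split; auto; try lra; apply Ht'. }
    destruct (Rle_lt_dec (m + delta) (G2 + ln (rad - L2))) as [C2|C2].
    { exists t', (x + rho * - p), (y + rho * - q), L2. repeat split; auto; try lra; apply Ht'. }
    destruct (Rle_lt_dec (m + delta) (G3 + ln (rad - L3))) as [C3|C3].
    { exists t', (x + rho * - q), (y + rho * p), L3. repeat split; auto; try lra; apply Ht'. }
    assert (C4 : m + delta <= G4 + ln (rad - L4)) by lra.
    exists t', (x + rho * q), (y + rho * - p), L4. repeat split; auto; try lra; apply Ht'. }
  intros t x y L Ht Hxy Hreach HLR. apply Rnot_lt_le. intros Hlt.
  set (m := gap u tau C t x y + ln (rad - L)) in *.
  assert (Hall : forall n : nat, St (m + INR n * delta)).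
  { induction n as [|n IH].
    - exists t, x, y, L. simpl. repeat split; auto; try apply Ht. unfold m. lra.
    - rewrite S_INR. replace (m + (INR n + 1) * delta) with (m + INR n * delta + delta) by ring.
      apply Hstep; [|exact IH]. pose proof (pos_INR n).
      assert (0 <= INR n * delta) by (apply Rmult_le_pos; lra). unfold m0 in *. lra. }
  (* Enough raises push the value above [Phi + ln rad], the absolute bound for admissible data. *)
  destruct (INR_unbounded ((Phi + ln rad - m) / delta)) as [n Hn].
  destruct (Hall n) as (t1 & x1 & y1 & L1 & Ht1 & Hxy1 & Hreach1 & HLR1 & Hm1).
  destruct (Hin t1 x1 y1 L1 Ht1 Hreach1 HLR1) as (HL0 & _ & Hut).
  pose proof (gap_le u tau C t1 x1 y1 B T HC ltac:(lra) ltac:(lra) Hxy1 Hut) as Hup.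
  assert (ln (2 * (t1 - tau)) <= ln (2 * T)) by (apply ln_le_mono; lra).
  assert (ln (rad - L1) <= ln rad) by (apply ln_le_mono; lra).
  assert (Phi + ln rad - m < INR n * delta).
  { replace (Phi + ln rad - m) with ((Phi + ln rad - m) / delta * delta) by (field; lra).
    apply Rmult_lt_compat_r; assumption. }
  unfold Phi, H0 in *. lra.
Qed.

Lemma gap_le0 (T : R) (u : F3) (D : list dir -> F3) (tau C t x y : R) :
  solves T u D -> inst_complete T u -> 0 <= C ->
  (forall t x y, 0 <= t <= T -> 3 / 2 <= modz x y <= 7 / 4 ->
     / 2 * ln (2 * T) + hyp x y - C <= u t x y) ->
  0 < tau < t -> t < T -> 3 / 2 <= modz x y -> gap u tau C t x y <= 0.
Proof.
  intros Hsol Hcomp HC Hring Htau HtT Hxy.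
  pose proof Hsol as [(Enil & Hcont & _) _].
  destruct (cont_on_bounded_order T 1 1 D Hcont) as [B [HB0 HB]].
  assert (Hbase : forall t x y, 0 <= t <= T -> modz x y <= 1 ->
    - B <= u t x y /\ Rabs (D (Dt :: nil) t x y) <= B).
  { intros s a b Hs Hab. destruct (modz_ge_coord a b).
    split; [|apply HB; simpl; lia || lra].
    assert (Hn : Rabs (D nil s a b) <= B) by (apply HB; simpl; lia || lra).
    rewrite Enil in Hn. apply Rabs_le_between in Hn. lra. }
  assert (Hcu : cont2 (u t)) by (rewrite <- Enil; apply (cont_on_cont2 T); auto; lra).
  destruct (arclength_exists (u t) (segment (0, 0) (x, y)) Hcu) as [S HS].
  set (L := S 1).
  assert (HL : 0 <= L).
  { unfold L. rewrite <- (proj1 HS). apply (arclength_mono _ _ _ 0 1 HS). lra. }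
  assert (Hreach : reach (u t) (0, 0) (x, y) L).
  { exists (segment (0, 0) (x, y)), S. simpl. repeat split; try apply HS; f_equal; ring. }
  apply le_epsilon. intros eps' Heps'. set (eps := eps' / 2).
  assert (Heps : 0 < eps) by (unfold eps; lra).
  set (k := (exp (2 * eps) - 1) / (2 * T)).
  assert (Hk : 0 < k).
  { apply Rdiv_lt_0_compat; [|lra]. assert (exp 0 < exp (2 * eps)) by (apply exp_increasing; lra).
    rewrite exp_0 in *. lra. }
  set (A := B * exp (- B) + 2 / exp (- B)).
  assert (HA : 0 <= A).
  { pose proof (exp_pos (- B)). unfold A. assert (0 < 2 / exp (- B)) by (apply Rdiv_lt_0_compat; lra).
    assert (0 <= B * exp (- B)) by (apply Rmult_le_pos; lra). lra. }
  set (e := exp (- eps)).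
  assert (He : 0 < e < 1).
  { unfold e. split; [apply exp_pos|]. rewrite <- exp_0. apply exp_increasing. lra. }
  assert (HAk : 0 <= (A + 9) / k) by (apply Rdiv_le_0_compat; lra).
  assert (HLe : 0 <= L / (1 - e)) by (apply Rdiv_le_0_compat; lra).
  (* The first summand gives [k * rad >= A + 9], where 9 is the 8 of the penalty plus the required
     gain 1. The second ensures [rad >= 1]. The third makes the fixed length [L] of the segment so
     small against [rad] that [ln (rad - L)] loses at most [eps]. *)
  set (rad := (A + 9) / k + 1 + L / (1 - e)).
  assert (Hrad1 : 1 <= rad) by (unfold rad; lra).
  assert (HradL : L <= (1 - e) * rad).
  { replace L with ((1 - e) * (L / (1 - e))) at 1 by (field; lra).
    apply Rmult_le_compat_l; [lra|]. unfold rad. lra. }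
  assert (Herad : 0 < e * rad) by (apply Rmult_lt_0_compat; lra).
  assert (Hbig : 1 <= (exp (2 * eps) - 1) * rad ^ 2 / (2 * T) - A * rad - 8).
  { replace ((exp (2 * eps) - 1) * rad ^ 2 / (2 * T)) with (k * rad * rad) by (unfold k; field; lra).
    assert (A + 9 <= k * rad).
    { replace (A + 9) with (k * ((A + 9) / k)) by (field; lra).
      apply Rmult_le_compat_l; [lra|]. unfold rad. lra. }
    assert ((A + 9) * rad <= k * rad * rad) by (apply Rmult_le_compat_r; lra).
    lra. }
  assert (Hlt : L < rad) by lra.
  assert (H := barrier T u D tau t C rad eps B B Hsol Hcomp (proj1 Htau) (proj2 Htau) HtT HC Heps HB0
    Hring Hbase ltac:(lra) Hbig t x y L ltac:(lra) Hxy Hreach Hlt).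
  assert (Hln : ln rad - eps <= ln (rad - L)).
  { replace (ln rad - eps) with (ln (e * rad)).
    - apply ln_le_mono; lra.
    - rewrite ln_mult by lra. unfold e. rewrite ln_exp. ring. }
  unfold eps in *. lra.
Qed.

Lemma flow_lower_bound (T : R) (u : F3) (D : list dir -> F3) (C t x y : R) :
  solves T u D -> inst_complete T u -> 0 <= C ->
  (forall t x y, 0 <= t <= T -> 3 / 2 <= modz x y <= 7 / 4 ->
     / 2 * ln (2 * T) + hyp x y - C <= u t x y) ->
  0 < t <= T -> 3 / 2 <= modz x y -> / 2 * ln (2 * t) + hyp x y - C <= u t x y.
Proof.
  intros Hsol Hcomp HC Hring Ht Hxy.
  assert (Hexp : forall d, 0 < d -> 0 < exp (- d) < 1).
  { intros d Hd. split; [apply exp_pos|]. rewrite <- exp_0. apply exp_increasing. lra. }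
  assert (Hopen : forall s, 0 < s < T -> / 2 * ln (2 * s) + hyp x y - C <= u s x y).
  { intros s Hs. apply Rnot_lt_le. intros Hlt.
    set (d := / 2 * ln (2 * s) + hyp x y - C - u s x y).
    assert (Hd : 0 < d) by (unfold d; lra). specialize (Hexp d Hd).
    (* The limit [tau -> 0] in contrapositive form: with this [tau] the elapsed time is
       [s * exp (- d)], so half its logarithm loses only [d / 2], less than the supposed defect
       [d]. *)
    pose proof (gap_le0 T u D (s * (1 - exp (- d))) C s x y Hsol Hcomp HC Hring) as H.
    unfold gap in H.
    replace (2 * (s - s * (1 - exp (- d)))) with (2 * s * exp (- d)) in H by ring.
    rewrite ln_mult, ln_exp in H by lra.
    specialize (H ltac:(split; nra) ltac:(lra) Hxy). unfold d in *. lra. }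
  destruct (Rle_lt_or_eq_dec t T (proj2 Ht)) as [HtT|HtT]; [apply Hopen; lra|].
  subst t. apply Rnot_lt_le. intros Hlt.
  set (d := / 2 * ln (2 * T) + hyp x y - C - u T x y).
  assert (Hd : 0 < d) by (unfold d; lra).
  pose proof Hsol as [(Enil & Hcont & _) _].
  destruct (Hcont nil T x y ltac:(lra) (d / 2) ltac:(lra)) as [e [He Hcu]]. rewrite Enil in Hcu.
  specialize (Hexp (d / 2) ltac:(lra)).
  (* Close enough to [T] for continuity to cost [d / 2] and the time logarithm [d / 4], together
     less than the defect [d]. *)
  set (s := Rmax (T - e / 2) (T * exp (- (d / 2)))).
  assert (Hs : T * exp (- (d / 2)) <= s < T /\ T - e / 2 <= s).
  { assert (T * exp (- (d / 2)) < T) by nra.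
    unfold s, Rmax. destruct Rle_dec; lra. }
  assert (Hs0 : 0 < T * exp (- (d / 2))) by (apply Rmult_lt_0_compat; lra).
  specialize (Hopen s ltac:(lra)).
  specialize (Hcu s x y ltac:(lra)). rewrite !Rminus_diag, Rabs_R0 in Hcu.
  assert (Hse : Rabs (s - T) < e) by (rewrite Rabs_left; lra).
  specialize (Hcu Hse He He). apply Rabs_def2 in Hcu.
  assert (Hln : ln (2 * T) - d / 2 <= ln (2 * s)).
  { replace (ln (2 * T) - d / 2) with (ln (2 * T * exp (- (d / 2)))).
    - apply ln_le_mono; lra.
    - rewrite ln_mult, ln_exp by lra. ring. }
  unfold d in *. lra.
Qed.

(* "C depends only on u restricted to [0,T] x D_2 and T": for every T and every
   prescribed data u0, one C works for all flows agreeing with u0 there. *)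
Theorem theorem3p2 :
  forall (T : R), 0 < T ->
  forall (u0 : F3), exists C : R,
  forall (u : F3),
    ricci_flow T u ->
    inst_complete T u ->
    (forall t x y, 0 <= t <= T -> modz x y < 2 -> u t x y = u0 t x y) ->
    forall t x y, 0 < t <= T -> modz x y >= 2 ->
      u t x y >= - C - ln (modz x y * ln (modz x y)) + / 2 * ln (2 * t).
Proof.
  intros T HT u0.
  (* The constant must be fixed before the flow. Any one flow with the prescribed data supplies the
     continuity from which a bound on [u0] is drawn; if there is none, every constant works. *)
  destruct (classic (exists u, ricci_flow T u /\
    forall t x y, 0 <= t <= T -> modz x y < 2 -> u t x y = u0 t x y)) as [[u1 [[D1 [Hu1 _]] Heq1]]|Hno].
  2: { exists 0. intros u Hu _ Heq. exfalso. apply Hno. exists u. auto. }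
  destruct Hu1 as (Enil & Hcont & _).
  destruct (cont_on_bounded T 2 (D1 nil) (Hcont nil)) as [B [HB0 HB]]. rewrite Enil in HB.
  (* On the annulus, which lies inside the disc of radius 2, [hyp] is at most [- ln (3 / 8)] and [u]
     at least [- B]. The maximum with 0 provides the sign of [C] used in the absorption estimate. *)
  exists (Rmax 0 (/ 2 * ln (2 * T) - ln (3 / 8) + B)).
  intros u [D Hsol] Hcomp Heq t x y Ht Hxy.
  pose proof (Rmax_l 0 (/ 2 * ln (2 * T) - ln (3 / 8) + B)) as HC.
  pose proof (Rmax_r 0 (/ 2 * ln (2 * T) - ln (3 / 8) + B)) as HC'.
  set (C := Rmax _ _) in *.
  pose proof (flow_lower_bound T u D C t x y Hsol Hcomp HC) as H.
  unfold hyp at 2 in H. enough (/ 2 * ln (2 * t) + - ln (modz x y * ln (modz x y)) - C <= u t x y) by lra.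
  apply H; [|exact Ht|lra].
  intros s a b Hs Hab. pose proof (hyp_le a b (proj1 Hab)).
  destruct (modz_ge_coord a b).
  rewrite Heq, <- Heq1 by lra.
  specialize (HB s a b Hs ltac:(lra) ltac:(lra)). apply Rabs_le_between in HB. lra.
Qed.
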